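(* Let $G$ be a finite weighted multi-graph, with universal cover $G^{\mathrm{uni}}$ and maximal abelian cover $G^{\mathrm{ab}}$. Then $G^{\mathrm{uni}}$ and $G^{\mathrm{ab}}$ have the same eigenvalues; that is, for every real number $\theta$, $\theta$ is an eigenvalue of the adjacency operator $A^{G^{\mathrm{uni}}}$ on $\ell^2(V(G^{\mathrm{uni}}))$ if and only if $\theta$ is an eigenvalue of the adjacency operator $A^{G^{\mathrm{ab}}}$ on $\ell^2(V(G^{\mathrm{ab}}))$.
   Context: A finite weighted multi-graph $G=(V(G),E(G))$ may have loops and parallel edges. Every edge (including a loop) corresponds to two mutually inverse arcs $e,e^{-1}$; $\vec E(G)$ is the set of arcs, and $o(e),t(e)$ denote the origin and terminus of the arc $e$. Each vertex $i$ has a weight $r_i\in\mathbb{R}$, and each arc $e$ has a weight $\rho_e\in\mathbb{C}$ with $\rho_{e^{-1}}=\overline{\rho_e}\neq 0$. Covers. Fix an orientation of the edges, i.e. a set $\vec E_+(G)\subseteq\vec E(G)$ containing exactly one of the two arcs of each edge. Let $\mathbb{F}_{\vec E_+(G)}$ be the free group on $\vec E_+(G)$, where the inverse of a generator is identified with the reverse arc, so that $\vec E(G)$ is the set of generators and their inverses. Fix a maximal spanning forest $F$ of $G$ and let $S_+$ be the set of arcs in $\vec E_+(G)$ not contained in $F$. (Different choices lead to equivalent constructions.) Given a group $\mathcal{G}$ and a surjective homomorphism $\phi:\mathbb{F}_{\vec E_+(G)}\to\mathcal{G}$ that maps every edge of $F$ to the identity, the cover $G^\phi$ is the multi-graph with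 vertex set $V(G)\times\mathcal{G}$ having, for each $e\in\vec E(G)$ and $g\in\mathcal{G}$, an arc from $(o(e),g)$ to $(t(e),g\cdot\phi(e))$ (the reverse arc being the one coming from $e^{-1}$). Weights are lifted from $G$: vertex $(i,g)$ has weight $r_i$ and an arc coming from $e$ has weight $\rho_e$. The universal cover $G^{\mathrm{uni}}$ is $G^\phi$ for the homomorphism $\phi$ onto the free group $\mathbb{F}_{S_+}$ on $S_+$ that sends the arcs of $F$ to the identity and each arc in $S_+$ to its corresponding generator. The maximal abelian cover $G^{\mathrm{ab}}$ is defined in the same way with the free abelian group $\mathbb{F}^{\mathrm{ab}}_{S_+}$ on $S_+$ in place of $\mathbb{F}_{S_+}$. Adjacency operator. For a (possibly infinite) weighted multi-graph $X$ that is one of the covers $G^\phi$ of the finite weighted multi-graph $G$ (in particular $X=G^{\mathrm{uni}}$ or $X=G^{\mathrm{ab}}$), with set of arcs $\vec E(X)$, lifted vertex weights $r_u\in\mathbb{R}$ for $u\in V(X)$, and lifted arc weights $\rho_e\in\mathbb{C}$ for $e\in\vec E(X)$ satisfying $\rho_{e^{-1}}=\overline{\rho_e}\neq 0$, $A^X$ is the bounded Hermitian operator on $\ell^2(V(X))$ with matrix entries $A^X_{uv}=r_u\delta_{uv}+\sum_{e\in\vec E(X),\,o(e)=u,\,t(e)=v}\rho_e$. The eigenvalues of $X$ are the eigenvalues (point spectrum) of $A^X$, i.e. the $\theta$ for which there is a nonzero $f\in\ell^2(V(X))$ with $A^Xf=\theta f$; they are real. *)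

(* Defs.v *)
From HB Require Import structures.
From mathcomp Require Import all_boot all_order all_algebra.
From mathcomp Require Import complex.
From mathcomp Require Import all_classical all_reals all_analysis.

Set Implicit Arguments.
Unset Strict Implicit.
Unset Printing Implicit Defensive.

Import Order.TTheory GRing.Theory Num.Theory.
Local Open Scope group_scope.

(* The free group on T, as reduced words: a letter (x, b) stands for x if b   *)
(* is false and for the inverse of x if b is true.                            *)
Section FreeGroup.
Variable T : choiceType.
Implicit Types (a b : T * bool) (u v w : seq (T * bool)).

Definition linv a := (a.1, ~~ a.2).

Definition reduced w := sorted (fun a b => b != linv a) w.

Record free_group := FreeGroup { fword :> seq (T * bool); _ : reduced fword }.

HB.instance Definition _ := [isSub for fword].
HB.instance Definition _ := [Choice of free_group by <:].

Definition push a w :=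
  if w is b :: w' then if b == linv a then w' else a :: w else [:: a].

Definition fmulw u v := foldr push v u.

Lemma linvK : involutive linv.
Proof. by case=> x b; rewrite /linv /= negbK. Qed.

Lemma linv_neq a : linv a != a.
Proof. by case: a => x []; rewrite /linv xpair_eqE andbF. Qed.

Lemma reduced_tail a w : reduced (a :: w) -> reduced w.
Proof. by case: w => //= b w /andP[]. Qed.

Lemma reduced_push a w : reduced w -> reduced (push a w).
Proof.
case: w => //= b w rw; case: ifP => [_|/negbT ba]; first exact: reduced_tail rw.
by rewrite /reduced /= ba.
Qed.

Lemma reduced_mul u v : reduced v -> reduced (fmulw u v).
Proof. by move=> rv; elim: u => //= a u; apply: reduced_push. Qed.

Lemma pushK a w : reduced w -> push (linv a) (push a w) = w.
Proof.
case: w => [|b w] rw /=; first by rewrite linvK eqxx.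
case: eqVneq => [eba|_]; last by rewrite /= linvK eqxx.
rewrite eba in rw *; case: w rw => [|c w] //=.
by rewrite /reduced /= => /andP[/negPf-> _].
Qed.

Lemma push_mul a u v : reduced u -> reduced v ->
  fmulw (push a u) v = push a (fmulw u v).
Proof.
case: u => //= b u ru rv; case: eqVneq => // ->.
rewrite /=; have := @pushK (linv a) (fmulw u v); rewrite linvK => -> //.
by apply/reduced_mul.
Qed.

Lemma fmulwA u v w : reduced u -> reduced v -> reduced w ->
  fmulw u (fmulw v w) = fmulw (fmulw u v) w.
Proof.
move=> ru rv rw; elim: u ru => //= a u IH ru.
by rewrite IH ?(reduced_tail ru) // push_mul // reduced_mul.
Qed.

Lemma fmulw1 u : reduced u -> fmulw u [::] = u.
Proof.
elim: u => //= a u IH ru; rewrite IH ?(reduced_tail ru) //.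
by case: u ru {IH} => //= b u /andP[/negPf->].
Qed.

Definition finvw w := rev (map linv w).

Lemma reduced_inv w : reduced w -> reduced (finvw w).
Proof.
rewrite /reduced /finvw rev_sorted sorted_map; apply: sub_sorted => a b /=.
by apply: contra => /eqP->; rewrite linvK.
Qed.

Lemma fmulw_cat u v w : fmulw (u ++ v) w = fmulw u (fmulw v w).
Proof. exact: foldr_cat. Qed.

Lemma finvwK w : finvw (finvw w) = w.
Proof. by rewrite /finvw map_rev revK mapK //; apply: linvK. Qed.

Lemma fmulVw w : reduced w -> fmulw (finvw w) w = [::].
Proof.
elim: w => //= a w IH rw.
rewrite /finvw map_cons rev_cons -cats1 fmulw_cat.
by rewrite [X in fmulw _ X](_ : _ = w) ?IH ?(reduced_tail rw) //= linvK eqxx.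
Qed.

Lemma fwordP (x : free_group) : reduced x. Proof. by case: x. Qed.

Definition fg_mul (x y : free_group) := FreeGroup (reduced_mul x (fwordP y)).
Definition fg_one := @FreeGroup [::] isT.
Definition fg_inv (x : free_group) := FreeGroup (reduced_inv (fwordP x)).

Lemma fg_mulA : associative fg_mul.
Proof. by move=> x y z; apply: val_inj; apply: fmulwA; apply: fwordP. Qed.

Lemma fg_mul1x : left_id fg_one fg_mul.
Proof. by move=> x; apply: val_inj. Qed.

Lemma fg_mulx1 : right_id fg_one fg_mul.
Proof. by move=> x; apply: val_inj; apply: fmulw1; apply: fwordP. Qed.

Lemma fg_mulVx : left_inverse fg_one fg_inv fg_mul.
Proof. by move=> x; apply: val_inj; apply: fmulVw; apply: fwordP. Qed.

Lemma fg_mulxV : right_inverse fg_one fg_inv fg_mul.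
Proof.
move=> x; apply: val_inj => /=; rewrite -{1}[fword x]finvwK.
by apply/fmulVw/reduced_inv/fwordP.
Qed.

End FreeGroup.

HB.instance Definition _ (T : choiceType) := hasMul.Build (free_group T) (@fg_mul T).
HB.instance Definition _ (T : choiceType) := hasOne.Build (free_group T) (fg_one T).
HB.instance Definition _ (T : choiceType) := hasInv.Build (free_group T) (@fg_inv T).
HB.instance Definition _ (T : choiceType) :=
  Magma_isSemigroup.Build (free_group T) (@fg_mulA T).
HB.instance Definition _ (T : choiceType) :=
  Magma_isUMagma.Build (free_group T) (@fg_mul1x T) (@fg_mulx1 T).
HB.instance Definition _ (T : choiceType) :=
  Monoid_isGroup.Build (free_group T) (@fg_mulVx T) (@fg_mulxV T).

Section FreeGroupMorphism.
Variable T : choiceType.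

Lemma reduced1 (a : T * bool) : reduced [:: a]. Proof. by []. Qed.

Definition fgen (x : T) : free_group T := FreeGroup (reduced1 (x, false)).

Variables (gT : groupType) (f : T -> gT).

Definition fletter (a : T * bool) : gT := if a.2 then (f a.1)^-1 else f a.1.

(* The unique group morphism extending f.                                     *)
Definition flift (w : free_group T) : gT :=
  foldr (fun a y => fletter a * y) 1 (fword w).

Lemma flift_gen x : flift (fgen x) = f x.
Proof. by rewrite /flift /= mulg1. Qed.

Lemma fletterV a : fletter (linv a) = (fletter a)^-1.
Proof. by case: a => x []; rewrite /fletter //= invgK. Qed.

Lemma fliftM : {morph flift : x y / x * y}.
Proof.
move=> [u ru] [v rv]; rewrite /flift /= => {ru rv}.
elim: u => [|a u IH] /=; first by rewrite mul1g.
rewrite -mulgA -IH; case: (fmulw u v) => //= b w.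
by case: eqVneq => // ->; rewrite /= fletterV mulVKg.
Qed.

HB.instance Definition _ :=
  isUMagmaMorphism.Build (free_group T) gT flift (erefl, fliftM).

End FreeGroupMorphism.

Local Open Scope classical_set_scope.
Local Open Scope ring_scope.
Local Open Scope complex_scope.

(* V and E (the arcs) may be infinite; a finite multigraph is a wgraph whose  *)
(* V and E are finTypes. An edge is a pair {e, arev e}; by arev_neq this also *)
(* holds for loops.                                                           *)
Record wgraph (R : realType) (V E : choiceType) := WGraph {
  org : E -> V;
  tgt : E -> V;
  arev : E -> E;
  vwt : V -> R;
  awt : E -> R[i];
  arevK : involutive arev;
  arev_neq : forall e, arev e != e;
  org_arev : forall e, org (arev e) = tgt e;
  awt_arev : forall e, awt (arev e) = (awt e)^*;
  awt_neq0 : forall e, awt e != 0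
}.

Section Spectrum.
Variables (R : realType) (V E : choiceType) (X : wgraph R V E).

(* The sums below are over finite supports whenever every vertex of X is the  *)
(* origin of finitely many arcs only, as in a cover of a finite graph.        *)
Definition adj_entry (u v : V) : R[i] :=
  (vwt X u)%:C *+ (u == v) +
  \sum_(e \in [set e | org X e = u /\ tgt X e = v]) awt X e.

Definition adj_op (f : V -> R[i]) : V -> R[i] :=
  fun u => \sum_(v \in [set: V]) adj_entry u v * f v.

Definition square_summable (f : V -> R[i]) : Prop :=
  (\esum_(u in [set: V]) (Normc.normc (f u) ^+ 2)%:E < +oo)%E.

Definition l2_eigenvalue (theta : R[i]) : Prop :=
  exists f : V -> R[i], [/\ square_summable f, exists u, f u != 0
    & forall u, adj_op f u = theta * f u].

End Spectrum.

Section Covers.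
Variables (R : realType) (V E : finType) (G : wgraph R V E).

Record orientation := Orientation {
  oset :> {set E};
  _ : forall e, (arev G e \in oset) = (e \notin oset)
}.

(* A cycle is a nonempty cyclic sequence of consecutive arcs with distinct    *)
(* origins, in which no arc is followed by its reverse: loops and pairs of    *)
(* parallel edges are cycles, but an arc followed by its reverse is not.      *)
Definition graph_cycle (p : seq E) : bool :=
  [&& p != [::], uniq (map (org G) p)
    & path.cycle [rel e e' | (tgt G e == org G e') && (e' != arev G e)] p].

(* An edge set is given by the set F of all its arcs. As a subgraph it has    *)
(* vertex set V, so every acyclic F spans.                                    *)
Definition spanning_forest (F : {set E}) : Prop :=
  (forall e, (arev G e \in F) = (e \in F)) /\
  (forall p, graph_cycle p -> ~~ all (fun e => e \in F) p).

Definition maximal_spanning_forest (F : {set E}) : Prop :=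
  spanning_forest F /\
  (forall F' : {set E}, spanning_forest F' -> F \subset F' -> F' = F).

Variable O : orientation.

Lemma orientationP e : (arev G e \in O) = (e \notin O). Proof. by case: O. Qed.

(* An arc as an element of the free group on O: a generator or the inverse of *)
(* one. The last case never occurs.                                           *)
Definition arc_elt (e : E) : free_group {x : E | x \in O} :=
  if insub e is Some x then fgen x
  else if insub (arev G e) is Some x then (fgen x)^-1%g else 1%g.

Lemma arc_elt_rev e : arc_elt (arev G e) = (arc_elt e)^-1%g.
Proof.
rewrite /arc_elt arevK; case: (boolP (e \in O)) => eO.
  rewrite insubN ?orientationP ?negbK //.
  by case: insubP => [x //|]; rewrite eO.
have eO' : arev G e \in O by rewrite orientationP.
rewrite [insub e]insubN //.
by case: insubP => [x _ _|]; [rewrite invgK | rewrite eO'].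
Qed.

Section Cover.
Variables (gT : groupType)
  (phi : UMagmaMorphism.type (free_group {x | x \in O}) gT).

(* The arc (e, g) goes from (org e, g) to (tgt e, g * phi e).                 *)
Definition cover_org (a : E * gT) : V * gT := (org G a.1, a.2).
Definition cover_tgt (a : E * gT) : V * gT :=
  (tgt G a.1, a.2 * phi (arc_elt a.1))%g.
Definition cover_arev (a : E * gT) : E * gT :=
  (arev G a.1, a.2 * phi (arc_elt a.1))%g.

Fact cover_arevK : involutive cover_arev.
Proof.
by case=> e g; rewrite /cover_arev /= arevK arc_elt_rev gmulfV mulgK.
Qed.

Fact cover_arev_neq a : cover_arev a != a.
Proof. by case: a => e g; rewrite xpair_eqE negb_and arev_neq. Qed.

Fact cover_org_arev a : cover_org (cover_arev a) = cover_tgt a.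
Proof. by rewrite /cover_org /= org_arev. Qed.

Definition cover : wgraph R (V * gT)%type (E * gT)%type :=
  @WGraph R (V * gT)%type (E * gT)%type cover_org cover_tgt cover_arev
    (fun u => vwt G u.1) (fun a => awt G a.1)
    cover_arevK cover_arev_neq cover_org_arev
    (fun a => awt_arev G a.1) (fun a => awt_neq0 G a.1).

Lemma adj_entry_cover (u v : V * gT) :
  adj_entry cover u v = (vwt G u.1)%:C *+ (u == v) +
    \sum_(e | org G e == u.1)
      awt G e *+ ((tgt G e, (u.2 * phi (arc_elt e))%g) == v).
Proof.
rewrite /adj_entry; congr (_ + _).
rewrite (fsbigE [seq (e, u.2) | e <- enum E & (org G e == u.1) &&
           ((tgt G e, (u.2 * phi (arc_elt e))%g) == v)]); first last.
- move=> [e g] [/= eu ev] /mapP[]; exists e; last by rewrite -eu.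
  by rewrite mem_filter mem_enum -eu -ev /= /cover_tgt /= !eqxx.
- move=> a /= /mapP[e]; rewrite mem_filter => /andP[/andP[/eqP eu /eqP <-] _ ->].
  by split; rewrite //= /cover_org /= eu -surjective_pairing.
- by rewrite map_inj_uniq => [|e e' []//]; apply/filter_uniq/enum_uniq.
rewrite big_map big_filter_cond big_enum_cond /=.
under [RHS]eq_bigr do rewrite mulrb.
rewrite -big_mkcondr; apply: eq_bigl => e.
case: eqVneq => //= eu; case: eqVneq => //= ev.
by rewrite mem_set //=; split=> //; rewrite /cover_org /= eu -surjective_pairing.
Qed.

Lemma adj_op_cover (f : V * gT -> R[i]) (u : V * gT) :
  adj_op cover f u = (vwt G u.1)%:C * f u +
    \sum_(e | org G e == u.1) awt G e * f (tgt G e, (u.2 * phi (arc_elt e))%g).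
Proof.
set n := fun e => (tgt G e, (u.2 * phi (arc_elt e))%g).
pose r := undup (u :: [seq n e | e <- enum E]).
have ur : u \in r by rewrite mem_undup mem_head.
have nr e : n e \in r by rewrite mem_undup inE map_f ?orbT // mem_enum.
have single (c : R[i]) w : w \in r -> \sum_(v <- r) c *+ (w == v) * f v = c * f w.
  move=> wr; rewrite (bigD1_seq w) ?undup_uniq //= eqxx big1 ?addr0 // => v vw.
  by rewrite eq_sym (negPf vw) mul0r.
rewrite /adj_op (fsbigE r) ?undup_uniq //; last first.
  move=> v _ vr; rewrite adj_entry_cover big1 => [|e _].
    by case: eqVneq vr => [<-|_ _]; rewrite ?ur // addr0 mul0r.
  by case: eqVneq vr => // <-; rewrite nr.
rewrite (eq_bigl xpredT) => [|v]; last by rewrite in_setT.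
under eq_bigr do rewrite adj_entry_cover mulrDl mulr_suml.
rewrite big_split single // exchange_big; congr (_ + _).
by apply: eq_bigr => e _; exact: (single _ (n e) (nr e)).
Qed.

End Cover.

Variable F : {set E}.

(* On generators: 1 on the arcs of F and c on those of S_+ = O :\: F.         *)
Definition cotree_hom (gT : groupType) (c : {e : E | e \in O :\: F} -> gT) :
    UMagmaMorphism.type (free_group {x | x \in O}) gT :=
  flift (fun x => oapp c 1%g (insub (val x))).

Definition uni_hom := cotree_hom (@fgen {e : E | e \in O :\: F}).

(* The free abelian group on S_+ is {ffun S_+ -> int}, written                *)
(* multiplicatively.                                                          *)
Definition abgen (s : {e : E | e \in O :\: F}) :
    Algebra.to_multiplicative {ffun {e : E | e \in O :\: F} -> int} :=
  [ffun s' => (s' == s)%:R].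

Definition ab_hom := cotree_hom abgen.

Lemma cotree_hom_forest (gT : groupType) (c : {e : E | e \in O :\: F} -> gT) e :
  (forall e, (arev G e \in F) = (e \in F)) -> e \in F ->
  cotree_hom c (arc_elt e) = 1%g.
Proof.
move=> Fsym eF; rewrite /arc_elt /cotree_hom.
case: insubP => [x _ xe|_].
  by rewrite /= flift_gen insubN // xe inE eF.
case: insubP => [x _ xe|_]; last by rewrite gmulf1.
by rewrite gmulfV /= flift_gen insubN ?invg1 // xe inE Fsym eF.
Qed.

Lemma cotree_hom_arc (gT : groupType) (c : {e : E | e \in O :\: F} -> gT) s :
  cotree_hom c (arc_elt (val s)) = c s.
Proof.
have sO : val s \in O by have := valP s; rewrite inE => /andP[].
rewrite /arc_elt /cotree_hom; case: insubP => [x _ xe|]; last by rewrite sO.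
by rewrite /= flift_gen xe valK.
Qed.

Lemma cotree_hom_flift (gT : groupType) (c : {e : E | e \in O :\: F} -> gT) w :
  cotree_hom c (flift (fun s => arc_elt (val s)) w) = flift c w.
Proof.
rewrite /flift; elim: (fword w) => [|a u IH] /=; first by rewrite gmulf1.
rewrite gmulfM IH; congr (_ * _)%g.
by rewrite /fletter; case: a.2; rewrite ?gmulfV cotree_hom_arc.
Qed.

Lemma uni_hom_surj w : exists x, uni_hom x = w.
Proof.
exists (flift (fun s => arc_elt (val s)) w); rewrite /uni_hom cotree_hom_flift.
case: w => w rw; apply: val_inj => /=; rewrite /flift /=.
elim: w rw => //= a w IH rw; rewrite IH ?(reduced_tail rw) //.
have -> : fword (fletter (@fgen _) a) = [:: a] by case: a {rw IH} => x [].
by case: w rw {IH} => //= b w /andP[/negPf->].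
Qed.

Lemma ab_hom_surj w : exists x, ab_hom x = w.
Proof.
have homD x y : ab_hom (x * y)%g = (ab_hom x : {ffun _ -> int}) + ab_hom y.
  exact: gmulfM.
have homN x : ab_hom x^-1%g = - (ab_hom x : {ffun _ -> int}) by exact: gmulfV.
have -> : w = \sum_s (abgen s : {ffun _ -> int}) *~ w s.
  apply/ffunP => s; rewrite sum_ffunE (bigD1 s) //= big1 => [|s' ss'].
    by rewrite addr0 ffunMzE ffunE eqxx intz.
  by rewrite ffunMzE ffunE eq_sym (negPf ss') mul0rz.
elim/big_ind: _ => [|_ _ [x <-] [y <-]|s _].
- by exists 1%g; rewrite gmulf1.
- by exists (x * y)%g; rewrite homD.
have gen n : exists x, ab_hom x = (abgen s : {ffun _ -> int}) *+ n.
  elim: n => [|n [x xE]]; first by exists 1%g; rewrite gmulf1.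
  exists (arc_elt (val s) * x)%g.
  by rewrite homD xE mulrS; congr (_ + _); exact: (cotree_hom_arc abgen s).
case: (w s) => n; last by have [x xE] := gen n.+1; exists x^-1%g; rewrite homN xE.
by have [x xE] := gen n; exists x; rewrite xE.
Qed.

Definition universal_cover := cover uni_hom.

Definition maximal_abelian_cover := cover ab_hom.

End Covers.

(* Main.v *)
(* theta is an eigenvalue of a cover iff G has an Aomoto set for theta: a set *)

(* The two covers are never compared directly: the [certificate], which mentions only [G], is shown
   to be equivalent to [theta] being an eigenvalue of either of them. Eigenfunctions are l2 kernel
   elements of [adj_shift], by [cover_kernelP]. [certificate_kernel] produces one for any labelling
   of the arcs by group elements in which reversal inverts the label, so it serves both covers at
   once. For the converse, [uni_embed] and [ab_embed] pass to larger covers in which every arc, also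
   those of the forest, has a label of its own, so that all arcs play the same role. Then
   [kernel_certificate] treats the free group, and [finite_kernel] with [finite_kernel_certificate]
   the free abelian group.

   The counting is an index theorem for equivariant operators with #|I| orbits of unknowns and #|J|
   orbits of equations: [has_kernel_of_card] gives a kernel from #|J| < #|I|, and
   [card_of_has_kernel] gives this inequality back when the adjoint has no kernel. Both rest on
   [trace_sub]. In both converses, the Aomoto set consists of the vertices over which some kernel
   element is nonzero; a Wronskian identity, from [flux_kernel] or [twisted_wronskian], gives the
   common ratios along arcs, from which [rigid] makes the function phi. *)
(* D of vertices such that G[D] is a forest with a nowhere zero solution phi  *)
(* of A phi = theta phi on G[D], and with more components than D has outer    *)
(* neighbours.                                                                *)
(* Given D, a function equal on each lift of a component to a constant times  *)
(* phi, and zero off the lifts of D, need only satisfy one equation per lift  *)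
(* of an outer neighbour. This is an equivariant operator with more orbits of *)
(* unknowns than of equations, hence with an l2 kernel. In place of von       *)
(* Neumann dimensions, the proof uses the trace of (1 - t T^* T)^n, which for *)
(* n even is nonincreasing, and exceeds that of (1 - t T T^* )^n by the       *)
(* difference of the numbers of orbits.                                       *)
(* Conversely, let D be the set of vertices with an eigenfunction not         *)
(* vanishing over them. In the universal cover every arc separates, so        *)
(* Green's formula on one side shows that the Wronskian of two eigenfunctions *)
(* vanishes along every arc: the eigenfunctions have a common ratio along     *)
(* each arc within D. A cycle in D would then make them grow geometrically    *)
(* along a line, and the same cut shows that the adjoint of the operator      *)
(* above is injective, which gives the strict inequality.                     *)
(* In the maximal abelian cover, amenability yields a finitely supported      *)
(* eigenfunction. Its Fourier transform satisfies the eigenvalue equation     *)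
(* with weights twisted by unitary phases x, and Green's formula for two      *)
(* twists that differ at one edge only replaces the cut.                      *)
Require Import Defs.
From mathcomp Require Import all_boot all_order all_algebra.
From mathcomp Require Import complex.
From mathcomp Require Import all_classical all_reals all_analysis.
From mathcomp Require Import ring lra zify.

Set Implicit Arguments.
Unset Strict Implicit.
Unset Printing Implicit Defensive.

Import Order.TTheory GRing.Theory Num.Theory.

Local Open Scope classical_set_scope.
Local Open Scope ring_scope.
Local Open Scope complex_scope.

Local Notation "z ^*" := (@conjc _ z) : ring_scope.

(** * Equivariant operators with finite propagation *)

Section FiniteSums.
Variable X : choiceType.

Definition fin_supp (A : nmodType) (F : X -> A) :=
  exists r : seq X, forall x, x \notin r -> F x = 0.

(* Equal to 0 when the support of F is infinite.                              *)
Definition fin_sum (A : nmodType) (F : X -> A) : A := \sum_(x \in [set: X]) F x.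

Lemma fin_sumE (A : nmodType) (F : X -> A) r :
  uniq r -> (forall x, x \notin r -> F x = 0) -> fin_sum F = \sum_(x <- r) F x.
Proof.
move=> ur rF; rewrite /fin_sum (fsbigE r) //; last by move=> x _; apply: rF.
by apply: eq_bigl => x; rewrite in_setT.
Qed.

Lemma fin_supp_common (A : nmodType) (K : finType) (F : K -> X -> A) :
  (forall k, fin_supp (F k)) ->
  exists2 r : seq X, uniq r & forall k x, x \notin r -> F k x = 0.
Proof.
move=> /fin_all_exists[r rF].
exists (undup (flatten [seq r k | k <- enum K])); first exact: undup_uniq.
move=> k x; rewrite mem_undup => xr; apply: rF; apply: contra xr => xr.
by apply/flattenP; exists (r k) => //; apply: map_f; rewrite mem_enum.
Qed.

Lemma fin_suppP (A : nmodType) (F : X -> A) : fin_supp F ->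
  exists2 r : seq X, uniq r & forall x, x \notin r -> F x = 0.
Proof.
case=> r rF; exists (undup r); first exact: undup_uniq.
by move=> x; rewrite mem_undup; apply: rF.
Qed.

Lemma eq_fin_supp (A B : nmodType) (F : X -> A) (G : X -> B) :
  (forall x, F x = 0 -> G x = 0) -> fin_supp F -> fin_supp G.
Proof. by move=> FG [r rF]; exists r => x /rF/FG. Qed.

Lemma fin_supp_sum (A : nmodType) (K : finType) (P : pred K) (F : K -> X -> A) :
  (forall k, fin_supp (F k)) -> fin_supp (fun x => \sum_(k | P k) F k x).
Proof.
move=> /fin_supp_common[r _ rF]; exists r => x xr.
by rewrite big1 // => k _; apply: rF.
Qed.

Lemma fin_sum_sum (A : nmodType) (K : finType) (P : pred K) (F : K -> X -> A) :
  (forall k, fin_supp (F k)) ->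
  fin_sum (fun x => \sum_(k | P k) F k x) = \sum_(k | P k) fin_sum (F k).
Proof.
move=> /fin_supp_common[r ur rF]; rewrite (fin_sumE ur) => [|x xr]; last first.
  by rewrite big1 // => k _; apply: rF.
by rewrite exchange_big; apply: eq_bigr => k _; rewrite (fin_sumE ur) // => x /rF.
Qed.

Lemma fin_suppD (A : nmodType) (F G : X -> A) :
  fin_supp F -> fin_supp G -> fin_supp (fun x => F x + G x).
Proof.
move=> [r rF] [s sG]; exists (r ++ s) => x.
by rewrite mem_cat negb_or => /andP[/rF-> /sG->]; rewrite addr0.
Qed.

Lemma fin_sumD (A : nmodType) (F G : X -> A) :
  fin_supp F -> fin_supp G -> fin_sum (fun x => F x + G x) = fin_sum F + fin_sum G.
Proof.
move=> [r rF] [s sG]; pose t := undup (r ++ s).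
have tF x : x \notin t -> F x = 0.
  by rewrite mem_undup mem_cat negb_or => /andP[/rF].
have tG x : x \notin t -> G x = 0.
  by rewrite mem_undup mem_cat negb_or => /andP[_ /sG].
rewrite !(@fin_sumE _ _ t) ?undup_uniq // ?big_split // => x xt.
by rewrite tF // tG // addr0.
Qed.

Lemma fin_sum_additive (A B : nmodType) (f : {additive A -> B}) (F : X -> A) :
  fin_supp F -> fin_sum (fun x => f (F x)) = f (fin_sum F).
Proof.
move=> /fin_suppP[r ur rF].
rewrite (fin_sumE ur rF) raddf_sum (fin_sumE ur) // => x /rF->; exact: raddf0.
Qed.

Lemma fin_sumZ (A : pzRingType) (a : A) (F : X -> A) :
  fin_supp F -> fin_sum (fun x => a * F x) = a * fin_sum F.
Proof.
move=> /fin_suppP[r ur rF].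
rewrite (fin_sumE ur rF) mulr_sumr (fin_sumE ur) // => x /rF->; exact: mulr0.
Qed.

Lemma fin_sumB (A : zmodType) (F G : X -> A) :
  fin_supp F -> fin_supp G -> fin_sum (fun x => F x - G x) = fin_sum F - fin_sum G.
Proof.
move=> fF fG; rewrite fin_sumD //; last by apply: eq_fin_supp fG => x ->; rewrite oppr0.
by rewrite (fin_sum_additive (GRing.opp : {additive A -> A})).
Qed.

Lemma eq_fin_sum (A : nmodType) (F G : X -> A) : F =1 G -> fin_sum F = fin_sum G.
Proof. by move=> /funext->. Qed.

Lemma fin_sum_ge0 (A : numDomainType) (F : X -> A) :
  (forall x, 0 <= F x) -> 0 <= fin_sum F.
Proof. by move=> F0; apply: fsumr_ge0. Qed.

Lemma fin_sum_le (A : numDomainType) (F G : X -> A) :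
  fin_supp F -> fin_supp G -> (forall x, F x <= G x) -> fin_sum F <= fin_sum G.
Proof.
move=> fF fG FG; rewrite -subr_ge0 -fin_sumB //; apply: fin_sum_ge0 => x.
by rewrite subr_ge0.
Qed.

Lemma fin_sum_ge (A : numDomainType) (F : X -> A) x :
  fin_supp F -> (forall y, 0 <= F y) -> F x <= fin_sum F.
Proof.
move=> /fin_suppP[r ur rF] F0; rewrite (fin_sumE ur rF).
have [xr|/rF->] := boolP (x \in r); last exact: sumr_ge0.
by rewrite (bigD1_seq x) //= lerDl; apply: sumr_ge0.
Qed.

Lemma fin_sum_pt (A : nmodType) (F : X -> A) x :
  (forall y, y != x -> F y = 0) -> fin_sum F = F x.
Proof.
move=> Fx; rewrite (@fin_sumE _ _ [:: x]) ?big_seq1 // => y.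
by rewrite inE; apply: Fx.
Qed.

End FiniteSums.

Lemma fin_sum_bij (X Y : choiceType) (A : nmodType) (h : X -> Y) (F : Y -> A) :
  bijective h -> fin_sum F = fin_sum (fun x => F (h x)).
Proof. by move=> bh; rewrite /fin_sum (reindex_fsbigT h F bh). Qed.

Lemma fin_supp_inj (X Y : choiceType) (A : nmodType) (h : X -> Y) (F : Y -> A) :
  bijective h -> fin_supp F -> fin_supp (fun x => F (h x)).
Proof.
move=> [k hK kK] [r rF]; exists [seq k y | y <- r] => x xr.
by apply: rF; apply: contra xr => xr; rewrite -[x]hK map_f.
Qed.

Lemma fin_supp_row (I : finType) (X : choiceType) (A : nmodType) (F : I * X -> A) i :
  fin_supp F -> fin_supp (fun x => F (i, x)).
Proof.
move=> [r rF]; exists [seq y.2 | y <- r] => x xr; apply: rF.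
by apply: contra xr => xr; apply/mapP; exists (i, x).
Qed.

Lemma fin_supp_rows (I : finType) (X : choiceType) (A : nmodType) (F : I * X -> A) :
  (forall i, fin_supp (fun x => F (i, x))) -> fin_supp F.
Proof.
move=> /fin_supp_common[r _ rF]; exists [seq (i, x) | i <- enum I, x <- r] => -[i x].
move=> xr; apply: (rF i); apply: contra xr => xr.
by apply/allpairsP; exists (i, x); rewrite mem_enum.
Qed.

Lemma fin_sum_rows (I : finType) (X : choiceType) (A : nmodType) (F : I * X -> A) :
  fin_supp F -> fin_sum F = \sum_i fin_sum (fun x => F (i, x)).
Proof.
move=> fF; have [r ur rF] := fin_supp_common (fun i => fin_supp_row i fF).
rewrite (@fin_sumE _ _ _ [seq (i, x) | i <- enum I, x <- r]); first last.
- move=> [i x] xr; apply: (rF i); apply: contra xr => xr.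
  by apply/allpairsP; exists (i, x); rewrite mem_enum.
- by apply: allpairs_uniq; rewrite ?enum_uniq // => -[a b] [].
rewrite big_allpairs big_enum /=; apply: eq_bigr => i _.
by rewrite (fin_sumE ur) // => x /rF.
Qed.

Section SquareNorm.
Variable R : realType.
Local Notation C := R[i].
Implicit Types z u : C.

Definition sqmod z : R := complex.Re z ^+ 2 + complex.Im z ^+ 2.

Lemma conjBZ (t : R) z u : (z - t%:C * u)^* = z^* - t%:C * u^*.
Proof.
by case: z => a b; case: u => c d; apply/eqP; rewrite eq_complex /=;
  apply/andP; split; apply/eqP; ring.
Qed.

Lemma sqmod_ge0 z : 0 <= sqmod z. Proof. by rewrite addr_ge0 ?sqr_ge0. Qed.

Lemma sqmodE z : (sqmod z)%:C = z^* * z.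
Proof. by case: z => a b; apply/eqP; rewrite eq_complex /= /sqmod /=; apply/andP; split; apply/eqP; ring. Qed.

Lemma sqmod_normc z : sqmod z = Normc.normc z ^+ 2.
Proof. by case: z => a b /=; rewrite sqr_sqrtr // addr_ge0 ?sqr_ge0. Qed.

Lemma sqmodM z u : sqmod (z * u) = sqmod z * sqmod u.
Proof. by case: z => a b; case: u => c d; rewrite /sqmod /=; ring. Qed.

Lemma sqmodJ z : sqmod z^* = sqmod z.
Proof. by case: z => a b; rewrite /sqmod /= sqrrN. Qed.

Lemma sqmodN z : sqmod (- z) = sqmod z.
Proof. by case: z => a b; rewrite /sqmod /= !sqrrN. Qed.

Lemma sqmod0 : sqmod 0 = 0. Proof. by rewrite /sqmod /= expr0n /= addr0. Qed.

Lemma sqmod1 : sqmod 1 = 1. Proof. by rewrite /sqmod /= expr1n expr0n addr0. Qed.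

Lemma sqmod_real (x : R) : sqmod x%:C = x ^+ 2.
Proof. by rewrite /sqmod /= expr0n addr0. Qed.

Lemma sqmod_eq0 z : (sqmod z == 0) = (z == 0).
Proof.
case: z => a b; rewrite eq_complex /sqmod /= paddr_eq0 ?sqr_ge0 //.
by rewrite !sqrf_eq0.
Qed.

Lemma sqmod_gt0 z : (0 < sqmod z) = (z != 0).
Proof. by rewrite lt_def sqmod_ge0 sqmod_eq0 andbT. Qed.

Lemma Re_le_sqmod z : complex.Re z ^+ 2 <= sqmod z.
Proof. by rewrite lerDl sqr_ge0. Qed.

Lemma sqmodD z u : sqmod (z + u) <= 2 * (sqmod z + sqmod u).
Proof.
case: z => a b; case: u => c d; rewrite /sqmod /= -subr_ge0.
have -> : 2 * (a ^+ 2 + b ^+ 2 + (c ^+ 2 + d ^+ 2)) - ((a + c) ^+ 2 + (b + d) ^+ 2) = (a - c) ^+ 2 + (b - d) ^+ 2 by ring.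
by rewrite addr_ge0 ?sqr_ge0.
Qed.

(** The inequality of arithmetic and geometric means, for the cross term in the induction of
    [cauchy_schwarz]. *)
Lemma double_le_add (t u v : R) : 0 <= u -> 0 <= v -> t ^+ 2 <= u * v -> 2 * t <= u + v.
Proof.
move=> u0 v0 tuv; have [t0|t0] := leP t 0; first by apply: (@le_trans _ _ 0); nra.
rewrite -ler_sqr ?nnegrE ?addr_ge0 ?mulr_ge0 ?(ltW t0) //.
have := sqr_ge0 (u - v); nra.
Qed.

Lemma cauchy_schwarz (X : choiceType) (r : seq X) (a b : X -> C) :
  sqmod (\sum_(x <- r) (a x)^* * b x) <=
    (\sum_(x <- r) sqmod (a x)) * (\sum_(x <- r) sqmod (b x)).
Proof.
elim: r => [|x r IH]; first by rewrite !big_nil sqmod0 mulr0.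
rewrite !big_cons; set A := \sum_(_ <- r) sqmod (a _).
set B := \sum_(_ <- r) sqmod (b _); set S := \sum_(_ <- r) _ in IH *.
have A0 : 0 <= A by apply: sumr_ge0 => y _; apply: sqmod_ge0.
have B0 : 0 <= B by apply: sumr_ge0 => y _; apply: sqmod_ge0.
have a0 := sqmod_ge0 (a x); have b0 := sqmod_ge0 (b x).
set p := _^* * _; have pE : sqmod p = sqmod (a x) * sqmod (b x) by rewrite sqmodM sqmodJ.
have -> : sqmod (p + S) = sqmod p + sqmod S + 2 * complex.Re (S^* * p).
  by case: p {pE} => c d; case: (S) => e f; rewrite /sqmod /=; ring.
have : 2 * complex.Re (S^* * p) <= A * sqmod (b x) + sqmod (a x) * B.
  apply: double_le_add; rewrite ?mulr_ge0 //.
  apply: (le_trans (Re_le_sqmod _)); rewrite sqmodM sqmodJ pE.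
  rewrite [leRHS](_ : _ = A * B * (sqmod (a x) * sqmod (b x))); last by ring.
  by rewrite ler_wpM2r // mulr_ge0.
by rewrite pE; have := IH; rewrite -/A -/B; lra.
Qed.

Lemma sqmod_sum (K : finType) (P : pred K) (a : K -> C) :
  sqmod (\sum_(k | P k) a k) <= #|K|%:R * \sum_(k | P k) sqmod (a k).
Proof.
have := cauchy_schwarz (index_enum K) (fun=> 1) (fun k => if P k then a k else 0).
under eq_bigr do rewrite conjc1 mul1r.
rewrite -big_mkcond; under [X in _ * X]eq_bigr do rewrite (fun_if sqmod) sqmod0.
rewrite -big_mkcond sqmod1 big_const_seq count_predT iter_addr_0.
by rewrite [size _](_ : _ = #|K|) // cardT enumT.
Qed.

End SquareNorm.

Section EquivariantOperators.
Variables (R : realType) (G : groupType).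
Local Notation C := R[i].
Implicit Types I J K : finType.

(* A finite list of terms k, for the operator mapping c to the function whose *)
(* value at (j, g) is the sum over esrc k = j of ew k * c (etg k, g * es k).  *)
Record equivop (I J : finType) := Eop {
  eK : finType; esrc : eK -> J; etg : eK -> I; ew : eK -> C; es : eK -> G }.
Arguments es {I J} e _.

Definition op I J (T : equivop I J) (c : I * G -> C) : J * G -> C :=
  fun x => \sum_(k | esrc k == x.1) ew k * c (etg k, (x.2 * es T k)%g).

Definition adj I J (T : equivop I J) : equivop J I :=
  @Eop J I (eK T) (@etg I J T) (@esrc I J T) (fun k => (ew k)^*)
    (fun k => (es T k)^-1%g).

Definition translate I (h : G) (c : I * G -> C) : I * G -> C :=
  fun x => c (x.1, (h * x.2)%g).

Definition iprod I (h c : I * G -> C) : C := fin_sum (fun x : I * G => (h x)^* * c x).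
Definition sqnorm I (c : I * G -> C) : R := fin_sum (fun x : I * G => sqmod (c x)).

Definition delta I (i : I) : I * G -> C := fun x => (x == (i, 1%g))%:R.

(** A bound on finite partial sums, which avoids infinite sums; [square_summableP] links it to
    [square_summable]. *)
Definition l2 (X : choiceType) (f : X -> C) :=
  exists B : R, forall r : seq X, uniq r -> \sum_(x <- r) sqmod (f x) <= B.

Lemma op_adjK I J (T : equivop I J) : op (adj (adj T)) = op T.
Proof.
apply/funext => c; apply/funext => x; apply: eq_bigr => k _ /=.
by rewrite conjcK invgK.
Qed.

Lemma sum_fiber (A : nmodType) (I K : finType) (f : K -> I) (F : I -> K -> A) :
  \sum_i \sum_(k | f k == i) F i k = \sum_k F (f k) k.
Proof.
rewrite (exchange_big_dep xpredT) //=; apply: eq_bigr => k _.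
by under eq_bigl do rewrite eq_sym; rewrite big_pred1_eq.
Qed.

Section OneOperator.
Variables (I J : finType) (T : equivop I J).
Implicit Types (c : I * G -> C) (h : J * G -> C).

Lemma mulg_bij (s : G) : bijective (fun g => g * s)%g.
Proof. by exists (fun g => g * s^-1)%g => g; rewrite ?mulgK ?mulgVK. Qed.

Lemma fin_supp_shift (A : nmodType) (F : I * G -> A) i s :
  fin_supp F -> fin_supp (fun g => F (i, (g * s)%g)).
Proof. by move=> /(fin_supp_row i)/(fin_supp_inj (mulg_bij s)). Qed.

Lemma fin_supp_op c : fin_supp c -> fin_supp (op T c).
Proof.
move=> fc; apply: fin_supp_rows => j; rewrite /op /=; apply: fin_supp_sum => k.
apply: (@eq_fin_supp _ C C (fun g => c (etg k, (g * es T k)%g))) => [g -> /=|].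
  by rewrite mulr0.
exact: fin_supp_shift.
Qed.

Lemma iprod_op h c : fin_supp c ->
  iprod h (op T c) =
  \sum_(k : eK T) fin_sum (fun g => (h (esrc k, g))^* * (ew k * c (etg k, (g * es T k)%g))).
Proof.
move=> fc; rewrite /iprod fin_sum_rows; last first.
  by apply: eq_fin_supp (fin_supp_op fc) => x ->; rewrite mulr0.
have fk k : fin_supp (fun g => (h (esrc k, g))^* * (ew k * c (etg k, (g * es T k)%g))).
  apply: (@eq_fin_supp _ C C (fun g => c (etg k, (g * es T k)%g))) => [g -> /=|].
    by rewrite !mulr0.
  exact: fin_supp_shift.
rewrite -(sum_fiber (@esrc _ _ T) (fun j k =>
  fin_sum (fun g => (h (esrc k, g))^* * (ew k * c (etg k, (g * es T k)%g))))).
apply: eq_bigr => j _; rewrite -fin_sum_sum //; apply: eq_fin_sum => g.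
by rewrite mulr_sumr; apply: eq_bigr => k /eqP /= <-.
Qed.

Lemma iprod_adj h c : fin_supp c ->
  iprod (op (adj T) h) c =
  \sum_(k : eK T) fin_sum (fun g => (h (esrc k, g))^* * (ew k * c (etg k, (g * es T k)%g))).
Proof.
move=> fc; rewrite /iprod fin_sum_rows; last first.
  by apply: eq_fin_supp fc => x ->; rewrite mulr0.
have fk k : fin_supp (fun g => (h (esrc k, (g * (es T k)^-1)%g))^* * (ew k * c (etg k, g))).
  apply: (@eq_fin_supp _ C C (fun g => c (etg k, g))) => [g -> /=|].
    by rewrite !mulr0.
  exact: fin_supp_row.
under [RHS]eq_bigr => k _.
  rewrite (_ : fin_sum _ = fin_sum (fun g => (h (esrc k, (g * (es T k)^-1)%g))^* * (ew k * c (etg k, g)))).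
    over.
  rewrite [RHS](fin_sum_bij _ (mulg_bij (es T k))).
  by apply: eq_fin_sum => g; rewrite mulgK.
rewrite -(sum_fiber (@etg _ _ T) (fun j k =>
  fin_sum (fun g => (h (esrc k, (g * (es T k)^-1)%g))^* * (ew k * c (etg k, g))))).
apply: eq_bigr => j _; rewrite -fin_sum_sum //; apply: eq_fin_sum => g.
rewrite rmorph_sum mulr_suml; apply: eq_bigr => k /eqP /= <-.
by rewrite rmorphM /= conjcK; ring.
Qed.

(** The two sides are the same sum over the terms of [T], up to a right translation in each. Only
    [c] has finite support: [h] may later be an l2 function. *)
Lemma adjoint h c : fin_supp c -> iprod h (op T c) = iprod (op (adj T) h) c.
Proof. by move=> fc; rewrite iprod_op // iprod_adj. Qed.

(* Bounds the square of the operator norm.                                    *)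
Definition beta : R := #|eK T|%:R * \sum_(k : eK T) sqmod (ew k).

Lemma beta_ge0 : 0 <= beta.
Proof. by rewrite mulr_ge0 // sumr_ge0 // => k _; apply: sqmod_ge0. Qed.

Lemma op_bound c : fin_supp c -> sqnorm (op T c) <= beta * sqnorm c.
Proof.
move=> fc; have fN : fin_supp (fun x => sqmod (c x)).
  by apply: eq_fin_supp fc => x ->; rewrite sqmod0.
have fk k : fin_supp (fun g => sqmod (ew k) * sqmod (c (etg k, (g * es T k)%g))).
  apply: (@eq_fin_supp _ C R (fun g => c (etg k, (g * es T k)%g))) => [g -> /=|].
    by rewrite sqmod0 mulr0.
  exact: fin_supp_shift.
have fT : fin_supp (fun x => sqmod (op T c x)).
  by apply: eq_fin_supp (fin_supp_op fc) => x ->; rewrite sqmod0.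
rewrite /sqnorm fin_sum_rows // /beta -mulrA.
apply: (@le_trans _ _ (\sum_j fin_sum (fun g =>
    #|eK T|%:R * \sum_(k : eK T | esrc k == j) sqmod (ew k) * sqmod (c (etg k, (g * es T k)%g))))).
  apply: ler_sum => j _; apply: fin_sum_le => [||g]; first exact: (fin_supp_row j fT).
    have fj := fin_supp_sum (fun k => esrc k == j) fk.
    by apply: eq_fin_supp fj => g /= ->; rewrite mulr0.
  apply: (le_trans (sqmod_sum _ _)); apply: ler_wpM2l => //=.
  by apply: ler_sum => k _; rewrite sqmodM.
under eq_bigr => j _.
  rewrite fin_sumZ; last exact: fin_supp_sum.
  rewrite fin_sum_sum //; over.
rewrite -mulr_sumr; apply: ler_wpM2l => //.
rewrite (sum_fiber (@esrc _ _ T) (fun j k => fin_sum _)) mulr_suml; apply: ler_sum => k _.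
rewrite fin_sumZ; last first.
  exact: (fin_supp_shift _ _ fN).
apply: ler_wpM2l; first exact: sqmod_ge0.
rewrite -(fin_sum_bij (fun g => sqmod (c (etg k, g))) (mulg_bij (es T k))).
rewrite [leRHS]fin_sum_rows // (bigD1 (etg k)) //= lerDl sumr_ge0 // => i _.
by apply: fin_sum_ge0 => g; apply: sqmod_ge0.
Qed.

Lemma op_lt (s : G) c : op T (translate s c) = translate s (op T c).
Proof.
by apply/funext => x; apply: eq_bigr => k _; rewrite /translate /= mulgA.
Qed.

Lemma op_sum (K : finType) (P : pred K) (w : K -> C) (c : K -> I * G -> C) :
  op T (fun x => \sum_(k | P k) w k * c k x) =
  fun x => \sum_(k | P k) w k * op T (c k) x.
Proof.
apply/funext => x; rewrite /op.
under eq_bigr do rewrite mulr_sumr; rewrite exchange_big /=.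
apply: eq_bigr => k _; rewrite mulr_sumr; apply: eq_bigr => l _; ring.
Qed.

Lemma opB c d : op T (fun x => c x - d x) = fun x => op T c x - op T d x.
Proof.
by apply/funext => x; rewrite -sumrB; apply: eq_bigr => k _; rewrite mulrBr.
Qed.

Lemma opBZ c a d :
  op T (fun x => c x - a * d x) = fun x => op T c x - a * op T d x.
Proof.
apply/funext => x; rewrite /op mulr_sumr -sumrB.
by apply: eq_bigr => k _; ring.
Qed.

End OneOperator.

Lemma beta_adj I J (T : equivop I J) : beta (adj T) = beta T.
Proof. by congr (_ * _); apply: eq_bigr => k _; rewrite sqmodJ. Qed.

Lemma iprod_sqnorm I (c : I * G -> C) : fin_supp c -> iprod c c = (sqnorm c)%:C.
Proof.
move=> fc; rewrite -(fin_sum_additive (real_complex R)); last first.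
  by apply: eq_fin_supp fc => x ->; rewrite sqmod0.
by apply: eq_fin_sum => x; rewrite -sqmodE.
Qed.

Lemma iprod_delta I (i : I) c : iprod (delta i) c = c (i, 1%g).
Proof.
rewrite /iprod (fin_sum_pt (x := (i, 1%g))) => [|y /negPf yx]; rewrite /delta.
  by rewrite eqxx rmorph1 mul1r.
by rewrite yx rmorph0 mul0r.
Qed.

Lemma fin_supp_delta I (i : I) : fin_supp (delta i).
Proof.
by exists [:: (i, 1%g)] => x; rewrite inE /delta => /negPf->.
Qed.

Lemma sqnorm_ge0 I (c : I * G -> C) : 0 <= sqnorm c.
Proof. by apply: fin_sum_ge0 => x; apply: sqmod_ge0. Qed.

Lemma sqnorm_pt I (c : I * G -> C) x : fin_supp c -> sqmod (c x) <= sqnorm c.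
Proof.
move=> fc; apply: (fin_sum_ge (F := fun x => sqmod (c x))) => [|y]; last exact: sqmod_ge0.
by apply: eq_fin_supp fc => y ->; rewrite sqmod0.
Qed.

Lemma sqnormBZ I (c d : I * G -> C) (t : R) : fin_supp c -> fin_supp d ->
  sqnorm (fun x => c x - t%:C * d x) =
  sqnorm c - 2 * t * complex.Re (iprod c d) + t ^+ 2 * sqnorm d.
Proof.
move=> fc fd.
have f1 : fin_supp (fun x => sqmod (c x)) by apply: eq_fin_supp fc => x ->; rewrite sqmod0.
have f2 : fin_supp (fun x => sqmod (d x)) by apply: eq_fin_supp fd => x ->; rewrite sqmod0.
have f3 : fin_supp (fun x => (c x)^* * d x).
  by apply: eq_fin_supp fd => x ->; rewrite mulr0.
have f4 : fin_supp (fun x => complex.Re ((c x)^* * d x)).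
  by apply: eq_fin_supp f3 => x ->.
rewrite /iprod -(fin_sum_additive (@complex.Re R : {additive Rcomplex R -> R}) f3).
rewrite /sqnorm -(fin_sumZ (2 * t)) // -fin_sumB //; last first.
  by apply: eq_fin_supp f4 => x /= ->; rewrite mulr0.
rewrite -fin_sumZ // -fin_sumD; first last.
- by apply: eq_fin_supp f2 => x /= ->; rewrite mulr0.
- apply: (@eq_fin_supp _ (C * C)%type R (fun x => (c x, d x))).
    by move=> x [-> ->]; rewrite conjc0 mulr0 sqmod0 !mulr0 subr0.
  by case: fc => r rc; case: fd => s sd; exists (r ++ s) => x;
    rewrite mem_cat negb_or => /andP[/rc-> /sd->].
apply: eq_fin_sum => x; case: (c x) => a b; case: (d x) => e f; rewrite /sqmod /=; ring.
Qed.

End EquivariantOperators.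
Arguments es {R G I J} e _.

(** * Powers of 1 - t T^* T and their trace *)

Section Index.
Variables (R : realType) (G : groupType).
Local Notation C := R[i].
Local Notation equivop := (equivop R G).

(* The powers of this operator 1 - t T^* T decrease to the orthogonal         *)
(* projection onto the l2 kernel of T.                                        *)
Definition step (t : R) I J (T : equivop I J) (c : I * G -> C) : I * G -> C :=
  fun x => c x - t%:C * op (adj T) (op T c) x.

Section Step.
Variables (I J : finType) (T : equivop I J) (t : R).
Hypotheses (t0 : 0 < t) (tb : t * beta T <= 1).
Implicit Types c h : I * G -> C.

Lemma fin_supp_step c : fin_supp c -> fin_supp (step t T c).
Proof.
move=> fc; apply: (@fin_suppD _ C c) => //.
by apply: eq_fin_supp (fin_supp_op (adj T) (fin_supp_op T fc)) => x ->; rewrite mulr0 oppr0.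
Qed.

Lemma fin_supp_iter n c : fin_supp c -> fin_supp (iter n (step t T) c).
Proof. by move=> fc; elim: n => //= n IH; apply: fin_supp_step. Qed.

(** The square expands to |c|^2 - 2 t |T c|^2 + t^2 |T^* T c|^2, and [tb] bounds the last term by t
    |T c|^2. *)
Lemma sqnorm_step c : fin_supp c -> sqnorm (step t T c) <= sqnorm c - t * sqnorm (op T c).
Proof.
move=> fc; rewrite sqnormBZ //; last exact/fin_supp_op/fin_supp_op.
rewrite adjoint ?op_adjK; last exact: fin_supp_op.
rewrite iprod_sqnorm /=; last exact: fin_supp_op.
have := op_bound (adj T) (fin_supp_op T fc); rewrite beta_adj.
set n := sqnorm (op T c); set m := sqnorm (op (adj T) _) => mn.
have n0 : 0 <= n by apply: sqnorm_ge0.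
have h1 : t * m <= t * beta T * n by rewrite -mulrA ler_wpM2l // ltW.
have h2 : t * beta T * n <= n by rewrite ler_piMl.
have : t * (t * m) <= t * n by rewrite ler_wpM2l ?(ltW t0) //; apply: le_trans h2.
lra.
Qed.

Lemma iprod_step h c : fin_supp c -> iprod h (step t T c) = iprod (step t T h) c.
Proof.
move=> fc; have fTc := fin_supp_op (adj T) (fin_supp_op T fc).
have H : iprod (op (adj T) (op T h)) c = iprod h (op (adj T) (op T c)).
  by rewrite -adjoint // [RHS]adjoint ?op_adjK //; apply: fin_supp_op.
have -> : iprod h (step t T c) = iprod h c - t%:C * iprod h (op (adj T) (op T c)).
  rewrite /iprod -fin_sumZ -?fin_sumB; first last.
  - by apply: eq_fin_supp fTc => x ->; rewrite mulr0.
  - by apply: eq_fin_supp fTc => x ->; rewrite !mulr0.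
  - by apply: eq_fin_supp fc => x ->; rewrite mulr0.
  by apply: eq_fin_sum => x; rewrite /step; ring.
rewrite -H /iprod -fin_sumZ -?fin_sumB; first last.
- by apply: eq_fin_supp fc => x ->; rewrite mulr0.
- by apply: eq_fin_supp fc => x ->; rewrite !mulr0.
- by apply: eq_fin_supp fc => x ->; rewrite mulr0.
by apply: eq_fin_sum => x; rewrite /step conjBZ; ring.
Qed.

Lemma iprod_iter n h c : fin_supp c ->
  iprod h (iter n (step t T) c) = iprod (iter n (step t T) h) c.
Proof.
move=> fc; elim: n h => //= n IH h.
by rewrite iprod_step ?IH -?iterSr //; apply: fin_supp_iter.
Qed.

Definition heat n i := iter n (step t T) (delta R i).
(** By [heat_diag] this is the diagonal coefficient at [i] of the power 2m, which is why the traces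
    below are taken at even times. *)
Definition heatN i m : R := sqnorm (heat m i).

Lemma fin_supp_heat n i : fin_supp (heat n i). Proof. exact/fin_supp_iter/fin_supp_delta. Qed.

Lemma iprod_heat m n i : iprod (heat m i) (heat n i) = heat (m + n) i (i, 1%g).
Proof.
rewrite /heat -iprod_iter; last exact/fin_supp_iter/fin_supp_delta.
by rewrite -iterD iprod_delta.
Qed.

Lemma heat_diag m i : heat (m + m) i (i, 1%g) = (heatN i m)%:C.
Proof. by rewrite -iprod_heat iprod_sqnorm //; apply: fin_supp_heat. Qed.

Lemma heatN_dec i m n : (m <= n)%N -> heatN i n <= heatN i m.
Proof.
elim: n => [|n IH]; first by rewrite leqn0 => /eqP->.
rewrite leq_eqVlt => /orP[/eqP->//|mn]; apply: le_trans (IH mn).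
apply: (le_trans (sqnorm_step (fin_supp_heat n i))); rewrite gerBl.
by rewrite mulr_ge0 ?sqnorm_ge0 // ltW.
Qed.

(** By [iprod_heat] the left side is heatN (2m) - 2 heatN (m + n) + heatN (2n), and m + n <= 2n. *)
Lemma heat_sub i m n : (m <= n)%N ->
  sqnorm (fun x => heat (m + m) i x - heat (n + n) i x) <=
  heatN i (m + m) - heatN i (n + n).
Proof.
move=> mn; have -> : (fun x => heat (m + m) i x - heat (n + n) i x) =
    (fun x => heat (m + m) i x - 1%:C * heat (n + n) i x).
  by apply/funext => x; rewrite mul1r.
rewrite sqnormBZ; try exact: fin_supp_heat.
rewrite iprod_heat addnACA heat_diag /= -!/(heatN _ _).
have : heatN i (n + n) <= heatN i (m + n) by apply: heatN_dec; rewrite leq_add2r.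
lra.
Qed.

Lemma heatN0 i : heatN i 0 = 1.
Proof.
rewrite /heatN /heat /= /sqnorm (fin_sum_pt (x := (i, 1%g))) => [|y /negPf yx].
  by rewrite /delta eqxx sqmod1.
by rewrite /delta yx sqmod0.
Qed.

End Step.

Section Trace.
Variables (I J : finType) (T : equivop I J) (t : R).

(** The trace property: T^* A and A T^* have the same sum of diagonal coefficients, one for each
    orbit. [A] is any linear equivariant map, since it will be [T] after an iterate of [step]. *)
Lemma trace_adj (A : (I * G -> C) -> (J * G -> C)) :
  (forall (K : finType) (P : pred K) (w : K -> C) (c : K -> I * G -> C),
    A (fun x => \sum_(k | P k) w k * c k x) = fun x => \sum_(k | P k) w k * A (c k) x) ->
  (forall s c, A (translate s c) = translate s (A c)) ->
  \sum_i op (adj T) (A (delta R i)) (i, 1%g) =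
  \sum_j A (op (adj T) (delta R j)) (j, 1%g).
Proof.
move=> AL AT; rewrite /op /=.
rewrite (sum_fiber (@etg _ _ _ _ T) (fun i k => (ew k)^* * A (delta R i) (esrc k, (1 * (es T k)^-1)%g))).
(* T^* maps a point mass to a finite combination of translated point masses, to which linearity and
   equivariance of [A] apply. *)
have D j : (fun x : I * G => \sum_(k | etg k == x.1) (ew k)^* * delta R j (esrc k, (x.2 * (es T k)^-1)%g))
  = (fun x => \sum_(k | esrc k == j) (ew k)^* * translate (es T k)^-1%g (delta R (etg k)) x).
  apply/funext => -[i g] /=.
  rewrite big_mkcond [RHS]big_mkcond /=; apply: eq_bigr => k _.
  rewrite /translate /delta /= !xpair_eqE divg_eq1 mulg_eq1 eqg_inv
    [etg k == i]eq_sym [g == _]eq_sym.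
  by case: (i == _); case: (esrc k == j); case: (_ == g); rewrite ?mulr0.
under [RHS]eq_bigr do rewrite D AL.
rewrite (sum_fiber (@esrc _ _ _ _ T) (fun j k => (ew k)^* * A (translate (es T k)^-1%g (delta R (etg k))) (j, 1%g))).
by apply: eq_bigr => k _; rewrite AT /translate /= mulg1 mul1g.
Qed.

Lemma step_lin (K : finType) (P : pred K) (w : K -> C) (c : K -> I * G -> C) :
  step t T (fun x => \sum_(k | P k) w k * c k x) =
  fun x => \sum_(k | P k) w k * step t T (c k) x.
Proof.
apply/funext => x; rewrite /step op_sum op_sum mulr_sumr -sumrB.
by apply: eq_bigr => k _; ring.
Qed.

Lemma step_lt s (c : I * G -> C) : step t T (translate s c) = translate s (step t T c).
Proof. by rewrite /step !op_lt. Qed.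

Lemma iter_lin n (K : finType) (P : pred K) (w : K -> C) (c : K -> I * G -> C) :
  iter n (step t T) (fun x => \sum_(k | P k) w k * c k x) =
  fun x => \sum_(k | P k) w k * iter n (step t T) (c k) x.
Proof. by elim: n => //= n ->; rewrite step_lin. Qed.

Lemma iter_lt n s (c : I * G -> C) :
  iter n (step t T) (translate s c) = translate s (iter n (step t T) c).
Proof. by elim: n => //= n ->; rewrite step_lt. Qed.

Lemma step_adj (d : J * G -> C) :
  step t T (op (adj T) d) = op (adj T) (step t (adj T) d).
Proof. by rewrite /step opBZ op_adjK. Qed.

Lemma iter_adj n (d : J * G -> C) :
  iter n (step t T) (op (adj T) d) = op (adj T) (iter n (step t (adj T)) d).
Proof. by elim: n => //= n ->; rewrite step_adj. Qed.

(** The von Neumann trace of the power [n] of 1 - t T^* T: one diagonal coefficient for each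
    orbit. *)
Definition trace n : C := \sum_i heat T t n i (i, 1%g).

End Trace.

(* From T (T^* T) = (T T^* ) T and the trace property.                        *)
Lemma trace_sub I J (T : equivop I J) t n :
  trace T t n - trace (adj T) t n = #|I|%:R - #|J|%:R.
Proof.
elim: n => [|n IH].
  rewrite /trace /heat /=.
  have dE (K : finType) : \sum_(i : K) delta R i (i, 1%g : G) = #|K|%:R.
    by under eq_bigr do rewrite /delta eqxx; rewrite sumr_const.
  by rewrite !dE.
rewrite -IH /trace /heat /= {1 3}/step !sumrB -!mulr_sumr.
rewrite op_adjK (@trace_adj _ _ T (fun c => op T (iter n (step t T) c))).
- under [X in _ - _ * X - _]eq_bigr do rewrite iter_adj.
  ring.
- by move=> K P w c; rewrite iter_lin op_sum.
- by move=> s c; rewrite iter_lt op_lt.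
Qed.

End Index.

(** * Kernels by counting orbits *)

Section L2Kernel.
Variable R : realType.
Local Notation C := R[i].

(** The limit is the supremum of the eventual lower bounds of [v]. *)
Lemma real_cauchy (v : nat -> R) :
  (forall d, 0 < d -> exists M, forall m n, (M <= m)%N -> (M <= n)%N -> v m <= v n + d) ->
  exists l, forall d, 0 < d -> exists M, forall m, (M <= m)%N -> v m - d <= l <= v m + d.
Proof.
move=> cv; pose S := [set y | exists M, forall m, (M <= m)%N -> y <= v m].
exists (sup S) => d d0; have [M vM] := cv d d0; exists M => m Mm.
have inS : S (v m - d).
  by exists M => n Mn; rewrite lerBlDr; apply: vM.
have ubS : ubound S (v m + d).
  move=> y [M' yM']; apply: le_trans (vM _ m (leq_maxl M M') Mm).
  exact/yM'/leq_maxr.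
apply/andP; split; last by apply: ge_sup => //; exists (v m - d).
by apply: ub_le_sup => //; exists (v m + d).
Qed.

(** The limit is taken pointwise, on real and imaginary parts; it is uniform because at each point
    the Cauchy bound is compared with a late index [n] that may depend on the point. *)
Lemma cauchy_lim (X : Type) (u : nat -> X -> C) :
  (forall d, 0 < d -> exists M, forall m n, (M <= m)%N -> (M <= n)%N ->
    forall x, sqmod (u m x - u n x) <= d) ->
  exists f : X -> C, forall d, 0 < d -> exists M, forall m, (M <= m)%N ->
    forall x, sqmod (u m x - f x) <= d.
Proof.
move=> cu.
have part x (p : C -> R) : (forall z w, (p z - p w) ^+ 2 <= sqmod (z - w)) ->
    exists l, forall d, 0 < d -> exists M, forall m, (M <= m)%N ->
      p (u m x) - d <= l <= p (u m x) + d.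
  move=> pl; apply: real_cauchy => d d0.
  have [|M uM] := cu (d ^+ 2); first by rewrite exprn_gt0.
  exists M => m n Mm Mn; rewrite -lerBlDl.
  apply: (le_trans (ler_norm _)).
  rewrite -ler_sqr ?nnegrE ?normr_ge0 ?(ltW d0) // real_normK ?num_real //.
  exact: (le_trans (pl _ _) (uM _ _ Mm Mn x)).
have reL z w : (complex.Re z - complex.Re w) ^+ 2 <= sqmod (z - w) :> R.
  by case: z w => ? ? [? ?]; rewrite /sqmod /= lerDl sqr_ge0.
have imL z w : (complex.Im z - complex.Im w) ^+ 2 <= sqmod (z - w) :> R.
  by case: z w => ? ? [? ?]; rewrite /sqmod /= lerDr sqr_ge0.
have [a aP] := choice (fun x => part x _ reL).
have [b bP] := choice (fun x => part x _ imL).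
exists (fun x => Complex (a x) (b x)) => d d0.
have [|M uM] := cu (d / 4); first by rewrite divr_gt0.
exists M => m Mm x.
(* The minimum with 1 gives e^2 <= e; then 2 (d / 4 + 2 e) <= d. *)
pose e := Num.min 1 (d / 8).
have e0 : 0 < e by rewrite lt_min ltr01 divr_gt0.
have [Ma aM] := aP x _ e0; have [Mb bM] := bP x _ e0.
pose n := maxn M (maxn Ma Mb).
have h := uM m n Mm (leq_maxl _ _) x.
have /aM/andP[a1 a2] : (Ma <= n)%N by rewrite /n !leq_max leqnn orbT.
have /bM/andP[b1 b2] : (Mb <= n)%N by rewrite /n !leq_max leqnn !orbT.
rewrite -[u m x - _](subrKA (u n x)).
apply: (le_trans (sqmodD _ _)).
have : sqmod (u n x - Complex (a x) (b x)) <= 2 * e.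
  have e1 : e ^+ 2 <= e.
    by rewrite expr2 ger_pMr // /e ge_min lexx.
  have sq (y z : R) : y - e <= z -> z <= y + e -> (y - z) ^+ 2 <= e.
    move=> h1 h2; apply: le_trans e1; rewrite -real_normK ?num_real //.
    by rewrite ler_sqr ?nnegrE ?normr_ge0 ?(ltW e0) // ler_norml; apply/andP; split; lra.
  by case: (u n x) a1 a2 b1 b2 => c g /= *; rewrite /sqmod /= mulr_natl mulr2n lerD // sq.
have : e <= d / 8 by rewrite /e ge_min lexx orbT.
lra.
Qed.

Lemma l2_pt_pos (X : choiceType) (f : X -> C) (B : R) : (forall r : seq X, uniq r -> \sum_(x <- r) sqmod (f x) <= B) ->
  forall c : X -> C, fin_supp c -> sqmod (fin_sum (fun x => (f x)^* * c x)) <= B * fin_sum (fun x => sqmod (c x)).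
Proof.
move=> fB c /fin_suppP[r ur rc].
rewrite !(fin_sumE ur) => [|x /rc->|x /rc->]; rewrite ?sqmod0 ?mulr0 //.
apply: (le_trans (cauchy_schwarz _ _ _)); apply: ler_wpM2r; last exact: fB.
by apply: sumr_ge0 => x _; apply: sqmod_ge0.
Qed.

Lemma small_le0 (a Q : R) : 0 <= Q -> (forall d, 0 < d -> a <= Q * d) -> a <= 0.
Proof.
move=> Q0 aQ; rewrite leNgt; apply/negP => a0.
have Q1 : 0 < Q + 1 by lra.
have := aQ (a / (Q + 1)) (divr_gt0 a0 Q1).
rewrite leNgt => /negP; apply.
by rewrite mulrCA gtr_pMr // ltr_pdivrMr // mul1r; lra.
Qed.

Lemma sum_le_fin_sum (X : choiceType) (F : X -> R) (r : seq X) :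
  fin_supp F -> (forall x, 0 <= F x) -> uniq r -> \sum_(x <- r) F x <= fin_sum F.
Proof.
move=> [s sF] F0 ur; pose t := undup (r ++ s).
rewrite (@fin_sumE _ _ _ t) ?undup_uniq // => [|x]; last first.
  by rewrite mem_undup mem_cat negb_or => /andP[_ /sF].
rewrite [leRHS](bigID (mem r)) /= -[X in _ <= X + _]big_filter.
rewrite [X in _ <= X + _](perm_big r); last first.
  apply: uniq_perm => // [|x]; first by rewrite filter_uniq // undup_uniq.
  by rewrite mem_filter mem_undup mem_cat; case: (x \in r).
by rewrite lerDl sumr_ge0.
Qed.

Variable G : groupType.
Local Notation equivop := (equivop R G).

Definition has_kernel I J (T : equivop I J) :=
  exists f : I * G -> C, [/\ l2 f, exists x, f x != 0 & forall x, op T f x = 0].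

Lemma l2_lt (I : finType) s (f : I * G -> C) : l2 f -> l2 (translate s f).
Proof.
move=> [B fB]; exists B => r ur.
have := fB [seq (x.1, (s * x.2)%g) | x <- r]; rewrite big_map; apply.
by rewrite map_inj_uniq // => -[i g] [j h] [-> /mulgI ->].
Qed.

Lemma op_pt I J (T : equivop I J) (g : I * G -> C) d x :
  (forall y, sqmod (g y) <= d) -> sqmod (op T g x) <= beta T * d.
Proof.
move=> gd; apply: (le_trans (sqmod_sum _ _)); rewrite -mulrA ler_wpM2l //.
rewrite mulr_suml big_mkcond; apply: ler_sum => k _ /=.
case: ifP => _; first by rewrite sqmodM ler_wpM2l ?sqmod_ge0.
by rewrite mulr_ge0 ?sqmod_ge0 //; apply: le_trans (gd (etg k, 1%g)); apply: sqmod_ge0.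
Qed.

(* heat (m + m) i is a Cauchy sequence, since its squared distances are       *)
(* bounded by the decrease of heatN; its limit is a kernel element.           *)
Lemma heat_lim I J (T : equivop I J) (t e : R) (i : I) :
  0 < t -> t * beta T <= 1 -> 0 < e -> (forall m, e <= heatN T t i m) ->
  has_kernel T.
Proof.
move=> t0 tb e0 he; pose b m := heatN T t i m; pose u m := heat T t (m + m) i.
have bdec m n : (m <= n)%N -> b n <= b m by apply: heatN_dec.
have bcv d : 0 < d -> exists M, forall m n, (M <= m)%N -> (M <= n)%N -> b m <= b n + d.
  move=> d0; pose S := range b.
  have hS : has_inf S.
    by split; [exists (b 0); exists 0%N | exists e => _ [m _ <-]; apply: he].
  have [_ [M _ <-] bM] := inf_adherent d0 hS.
  exists M => m n Mm Mn; apply: (le_trans (bdec _ _ Mm)).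
  apply: (le_trans (ltW bM)); rewrite lerD2r.
  by apply: ge_inf; [case: hS | exists n].
have fsu m : fin_supp (u m) by apply: fin_supp_heat.
have ucv d : 0 < d -> exists M, forall m n, (M <= m)%N -> (M <= n)%N ->
    forall x, sqmod (u m x - u n x) <= d.
  move=> d0; have [M bM] := bcv d d0; exists M.
  have key m n x : (M <= m)%N -> (m <= n)%N -> sqmod (u m x - u n x) <= d.
    move=> Mm mn; apply: (@le_trans _ _ (sqnorm (fun x => u m x - u n x))).
      apply: (@sqnorm_pt _ _ _ (fun x => u m x - u n x)).
      apply: fin_suppD => //; apply: eq_fin_supp (fsu n) => y -> //; exact: oppr0.
    apply: (le_trans (heat_sub t0 tb i mn)); rewrite lerBlDl.
    by apply: bM; [apply: leq_trans (leq_addr _ _) | apply: leq_trans (leq_trans Mm mn) (leq_addr _ _)].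
  move=> m n Mm Mn x; case/orP: (leq_total m n) => mn; first exact: key.
  by rewrite -sqmodN opprB; apply: key.
have [f fu] := cauchy_lim ucv.
have Nu m : sqnorm (u m) <= 1.
  by rewrite -(heatN0 T t i); apply: bdec.
exists f; split.
(* The error is uniform but not summable, so it is taken smaller than 1 / size r; both the norm of
   [u M] and the total error are then at most 1. *)
- exists 4 => r ur; pose d : R := (size r).+1%:R^-1.
  have d0 : 0 < d by rewrite invr_gt0.
  have [M fM] := fu d d0; have {}fM := fM M (leqnn M).
  apply: (@le_trans _ _ (\sum_(x <- r) (2 * sqmod (u M x) + 2 * d))).
    apply: ler_sum => x _; rewrite -mulrDr.
    rewrite [f x](_ : _ = u M x + - (u M x - f x)); last by ring.
    by apply: (le_trans (sqmodD _ _)); rewrite sqmodN ler_wpM2l // lerD2l.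
  rewrite big_split /= -mulr_sumr big_const_seq count_predT iter_addr_0.
  have h1 : \sum_(x <- r) sqmod (u M x) <= 1.
    apply: le_trans (Nu M); apply: sum_le_fin_sum => // [|x]; last exact: sqmod_ge0.
    by apply: eq_fin_supp (fsu M) => x ->; rewrite sqmod0.
  have h2 : d *+ size r <= 1.
    by rewrite -mulr_natl ler_pdivrMr // mul1r ler_nat.
  have -> : (2 * d) *+ size r = 2 * (d *+ size r) by rewrite mulrnAr.
  lra.
- exists (i, 1%g); apply/eqP => fi0.
  have [|M fM] := fu (e ^+ 2 / 2); first by rewrite divr_gt0 ?exprn_gt0.
  have := fM M (leqnn M) (i, 1%g); rewrite fi0 subr0 /u heat_diag sqmod_real.
  have : e ^+ 2 <= heatN T t i M ^+ 2.
    by rewrite ler_sqr ?nnegrE ?(ltW e0) ?he // (le_trans (ltW e0)).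
  have : 0 < e ^+ 2 by rewrite exprn_gt0.
  lra.
(* [T (u m)] is small, since by [sqnorm_step] its squared norm times [t] is at most the decrease of
   [b] in one step. *)
- move=> x; apply/eqP; rewrite -sqmod_eq0 eq_le sqmod_ge0 andbT.
  apply: (@small_le0 _ (2 * (t^-1 + beta T))).
    by rewrite mulr_ge0 // addr_ge0 ?beta_ge0 // invr_ge0 ltW.
  move=> d d0; have [M fM] := fu d d0; have [M' bM] := bcv d d0.
  pose m := maxn M M'.
  have {}fM := fM m (leq_maxl _ _).
  have mM' : (M' <= m + m)%N by apply: leq_trans (leq_maxr M M') (leq_addr _ _).
  have {}bM := bM (m + m)%N (m + m).+1 mM' (leqW mM').
  have h1 : sqmod (op T (u m) x) <= t^-1 * d.
    apply: (le_trans (sqnorm_pt x (fin_supp_op T (fsu m)))).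
    rewrite mulrC ler_pdivlMr // mulrC.
    by have := sqnorm_step t0 tb (fsu m); rewrite /b /heatN /heat /= in bM *; rewrite -/(heat _ _ _ _) -/(u m) in bM *; lra.
  have h2 : sqmod (op T (u m) x - op T f x) <= beta T * d.
    by have := @op_pt _ _ T (fun y => u m y - f y) d x fM; rewrite opB.
  rewrite [op T f x](_ : _ = op T (u m) x + - (op T (u m) x - op T f x)); last by ring.
  apply: (le_trans (sqmodD _ _)); rewrite sqmodN -mulrA ler_wpM2l // mulrDl.
  exact: lerD.
Qed.

(** If each [heatN] fell below [e'], all would be below it at a common time, by monotonicity, and
    the trace, a sum of #|I| of them, would be less than [e]. *)
Lemma has_kernel_of_trace I J (T : equivop I J) (t e : R) :
  0 < t -> t * beta T <= 1 -> 0 < e ->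
  (forall n, e <= complex.Re (trace T t (n + n))) -> has_kernel T.
Proof.
move=> t0 tb e0 tre; pose e' := e / #|I|.+1%:R.
have e'0 : 0 < e' by rewrite divr_gt0.
have [[i ie]|] := pselect (exists i, forall m, e' <= heatN T t i m).
  exact: heat_lim ie.
move=> /forallNP noi; exfalso.
have /fin_all_exists[m mP] : forall i, exists m, heatN T t i m < e'.
  by move=> i; have /existsNP[m /negP] := noi i; rewrite -ltNge; exists m.
pose M := \max_i m i.
have := tre M; rewrite /trace raddf_sum /=.
under eq_bigr do rewrite heat_diag /=.
rewrite leNgt => /negP; apply.
apply: (@le_lt_trans _ _ (\sum_(i : I) e')).
  apply: ler_sum => i _; apply: le_trans (ltW (mP i)).
  by apply: heatN_dec => //; apply: leq_bigmax.
by rewrite sumr_const -mulr_natr -mulrA gtr_pMr // mulrC ltr_pdivrMr ?mul1r ?ltr_nat.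
Qed.

(** A kernel element [f] is fixed by [step], so its product with [heat n] is the conjugate of f (i,
    1) for every [n]; Cauchy-Schwarz bounds [heatN] from below. *)
Lemma trace_of_kernel I J (T : equivop I J) (t : R) :
  0 < t -> t * beta T <= 1 -> has_kernel T ->
  exists2 e, 0 < e & forall n, e <= complex.Re (trace T t (n + n)).
Proof.
move=> t0 tb [f0 [l2f0 [[i s] fx] Tf0]].
pose f := translate s f0; have l2f : l2 f by apply: l2_lt.
have fi : f (i, 1%g) != 0 by rewrite /f /translate /= mulg1.
have Tf : step t T f = f.
  apply/funext => x; rewrite /step op_lt (_ : op T f0 = fun=> 0); last exact/funext.
  by rewrite /op big1 ?mulr0 ?subr0 // => k _; rewrite /translate mulr0.
have [B fB] := l2f.
have B0 : 0 < B.
  have := fB [:: (i, 1%g)] isT; rewrite big_seq1; apply: lt_le_trans.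
  by rewrite sqmod_gt0.
exists (sqmod (f (i, 1%g)) / B); first by rewrite divr_gt0 // sqmod_gt0.
move=> n; rewrite /trace raddf_sum (bigD1 i) //=.
under eq_bigr do rewrite heat_diag /=.
rewrite heat_diag /=; apply: (@le_trans _ _ (heatN T t i n)); last first.
  by rewrite lerDl sumr_ge0 // => j _; apply: sqnorm_ge0.
rewrite ler_pdivrMr // mulrC -sqmodJ.
have <- : iprod f (heat T t n i) = (f (i, 1%g))^*.
  rewrite iprod_iter; last exact: fin_supp_delta.
  rewrite (_ : iter n (step t T) f = f); last by elim: n => //= n ->.
  rewrite /iprod (fin_sum_pt (x := (i, 1%g))) => [|y /negPf yx]; rewrite /delta.
    by rewrite eqxx mulr1.
  by rewrite yx mulr0.
exact: l2_pt_pos fB _ (fin_supp_heat T t n i).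
Qed.

Lemma trace_ge0 I J (T : equivop I J) (t : R) n :
  0 <= complex.Re (trace T t (n + n)).
Proof.
rewrite /trace raddf_sum sumr_ge0 // => i _.
by rewrite /= heat_diag; apply: sqnorm_ge0.
Qed.

Lemma small_time I J (T : equivop I J) :
  exists2 t : R, 0 < t & t * beta T <= 1 /\ t * beta (adj T) <= 1.
Proof.
have b1 : 0 < 1 + beta T by apply: ltr_pwDl => //; apply: beta_ge0.
exists (1 + beta T)^-1; first by rewrite invr_gt0.
by rewrite beta_adj mulrC ler_pdivrMr // mul1r lerDr.
Qed.

Lemma Re_trace_sub I J (T : equivop I J) (t : R) n :
  complex.Re (trace T t n) = complex.Re (trace (adj T) t n) + #|I|%:R - #|J|%:R.
Proof.
have := congr1 (@complex.Re R) (trace_sub T t n).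
rewrite !(raddfB (@complex.Re R : {additive Rcomplex R -> R})) /= => h.
have ReN m : complex.Re (m%:R : C) = m%:R.
  by rewrite -(rmorph_nat (real_complex R)).
by move: h; rewrite !ReN; lra.
Qed.

(** At even times the trace for [adj T] is nonnegative, so the trace for [T] is at least #|I| - #|J|
    >= 1. *)
Theorem has_kernel_of_card I J (T : equivop I J) : (#|J| < #|I|)%N -> has_kernel T.
Proof.
move=> JI; have [t t0 [tb _]] := small_time T.
apply: (@has_kernel_of_trace _ _ T t 1) => // n; rewrite Re_trace_sub.
have := trace_ge0 (adj T) t n.
have : #|J|.+1%:R <= #|I|%:R :> R by rewrite ler_nat.
by rewrite -natr1; lra.
Qed.

(** If #|I| <= #|J|, the trace for [adj T] is at least that for [T], which the kernel keeps away
    from 0; then [adj T] has a kernel too. *)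
Theorem card_of_has_kernel I J (T : equivop I J) :
  has_kernel T -> ~ has_kernel (adj T) -> (#|J| < #|I|)%N.
Proof.
move=> kT nkT; rewrite ltnNge; apply/negP => IJ; apply: nkT.
have [t t0 [tb tb']] := small_time T.
have [e e0 eT] := trace_of_kernel t0 tb kT.
apply: (has_kernel_of_trace t0 tb' e0) => n.
have := eT n; rewrite Re_trace_sub.
have : #|I|%:R <= #|J|%:R :> R by rewrite ler_nat.
lra.
Qed.

End L2Kernel.

(** * Green's formula across a cut *)

Section Cut.
Variables (R : realType) (G : groupType).
Local Notation C := R[i].
Local Notation equivop := (equivop R G).

Lemma sqnorm_restrict (I : finType) (f : I * G -> C) (q : seq (I * G)) :
  sqnorm (fun x => if x \in q then f x else 0) = \sum_(x <- undup q) sqmod (f x).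
Proof.
rewrite /sqnorm (@fin_sumE _ _ _ (undup q)) ?undup_uniq // => [|x]; last first.
  by rewrite mem_undup => /negPf->; rewrite sqmod0.
rewrite !big_seq; apply: eq_bigr => x.
by rewrite mem_undup => ->.
Qed.

Lemma fin_supp_restrict (X : choiceType) (f : X -> C) (q : seq X) :
  fin_supp (fun x => if x \in q then f x else 0).
Proof. by exists q => x /negPf->. Qed.

(* The restriction of f to a finite set carrying all but e' of its squared    *)
(* norm: T then maps it to minus the image of a part of the rest.             *)
Lemma truncate I J (T : equivop I J) (f : I * G -> C) (B : R) :
  (forall r : seq (I * G), uniq r -> \sum_(x <- r) sqmod (f x) <= B) ->
  (forall x, op T f x = 0) ->
  forall (r0 : seq (I * G)) e, 0 < e ->
  exists c, [/\ fin_supp c, {in r0, c =1 f}, sqnorm c <= B & sqnorm (op T c) <= e].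
Proof.
move=> fB Tf r0 e e0; pose e' := e / (1 + beta T).
have b1 : 0 < 1 + beta T by apply: ltr_pwDl => //; apply: beta_ge0.
have e'0 : 0 < e' by rewrite divr_gt0.
pose S := [set s | exists2 r : seq (I * G), uniq r & s = \sum_(x <- r) sqmod (f x)].
have hS : has_sup S.
  split; first by exists 0, [::]; rewrite ?big_nil.
  by exists B => _ [r ur ->]; apply: fB.
have [_ [r1 ur1 ->] Sr1] := sup_adherent e'0 hS.
pose r := undup (r0 ++ r1).
have tail q : uniq q -> (forall x, x \in q -> x \notin r) ->
    \sum_(x <- q) sqmod (f x) <= e'.
  move=> uq qr; have : \sum_(x <- r1 ++ q) sqmod (f x) <= sup S.
    apply: ub_le_sup; first by case: hS.
    exists (r1 ++ q) => //; rewrite cat_uniq ur1 uq andbT.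
    apply/hasPn => x /qr; rewrite mem_undup mem_cat negb_or.
    by case/andP.
  rewrite big_cat /= => h; rewrite -(lerD2l (\sum_(x <- r1) sqmod (f x))).
  by apply: (le_trans h); rewrite -lerBlDr ltW.
pose c x := if x \in r then f x else 0.
have fc : fin_supp c by apply: fin_supp_restrict.
have [Y uY YT] := fin_suppP (fin_supp_op T fc).
(* The points whose values enter [op T] on the support of [op T c]. *)
pose Z := [seq (etg k, (y.2 * es T k)%g) | y <- Y, k <- enum (eK T)].
pose q := [seq x <- Z | x \notin r].
pose d x := if x \in q then f x else 0.
have fd : fin_supp d by apply: fin_supp_restrict.
have Td y : y \in Y -> op T c y = - op T d y.
  move=> yY; apply/eqP; rewrite -addr_eq0 -(Tf y) /op -big_split /=.
  apply/eqP/eq_bigr => k _; rewrite -mulrDr; congr (_ * _).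
  rewrite /c /d mem_filter; case: ifP => //= _; first by rewrite addr0.
  rewrite (_ : _ \in Z) ?add0r //.
  by apply/allpairsP; exists (y, k); rewrite mem_enum.
exists c; split=> //.
- by move=> x xr0; rewrite /c mem_undup mem_cat xr0.
- by rewrite sqnorm_restrict; apply: fB; apply: undup_uniq.
apply: (@le_trans _ _ (sqnorm (op T d))).
  rewrite {1}/sqnorm (@fin_sumE _ _ _ Y) // => [|x /YT->]; last exact: sqmod0.
  apply: (@le_trans _ _ (\sum_(y <- Y) sqmod (op T d y))).
    by rewrite !big_seq; apply: ler_sum => y yY; rewrite Td // sqmodN.
  apply: sum_le_fin_sum => // [|x]; last exact: sqmod_ge0.
  by apply: eq_fin_supp (fin_supp_op T fd) => x ->; rewrite sqmod0.
apply: (le_trans (op_bound _ fd)).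
have : sqnorm d <= e'.
  rewrite sqnorm_restrict; apply: tail; first exact: undup_uniq.
  by move=> x; rewrite mem_undup mem_filter => /andP[].
move=> Nd; apply: (@le_trans _ _ (beta T * e')).
  by rewrite ler_wpM2l // beta_ge0.
rewrite /e' mulrCA ger_pMr // ler_pdivrMr // mul1r; lra.
Qed.

Lemma iprod_bound (I : finType) (h c : I * G -> C) :
  fin_supp h -> fin_supp c -> sqmod (iprod h c) <= sqnorm h * sqnorm c.
Proof.
move=> fh fc; apply: l2_pt_pos => // r ur; apply: sum_le_fin_sum => // [|x].
  by apply: eq_fin_supp fh => x ->; rewrite sqmod0.
exact: sqmod_ge0.
Qed.

Definition mask (I : finType) (chi : pred (I * G)) (c : I * G -> C) : I * G -> C :=
  fun x => (chi x)%:R * c x.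

Lemma fin_supp_mask (I : finType) (chi : pred (I * G)) c : fin_supp c -> fin_supp (mask chi c).
Proof. by apply: eq_fin_supp => x; rewrite /mask => ->; rewrite mulr0. Qed.

Lemma sqnorm_mask (I : finType) (chi : pred (I * G)) c : fin_supp c -> sqnorm (mask chi c) <= sqnorm c.
Proof.
move=> fc; apply: fin_sum_le => [||x].
- by apply: eq_fin_supp (fin_supp_mask chi fc) => x ->; rewrite sqmod0.
- by apply: eq_fin_supp fc => x ->; rewrite sqmod0.
by rewrite /mask; case: (chi x); rewrite ?mul1r // mul0r sqmod0 sqmod_ge0.
Qed.

Section OneCut.
Variables (I J : finType) (T : equivop I J).
Variables (chiI : pred (I * G)) (chiJ : pred (J * G)) (Z : seq (eK T * G)).
Hypothesis uZ : uniq Z.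
Hypothesis ZP : forall k g, (k, g) \notin Z ->
  chiJ (esrc k, g) = chiI (etg k, (g * es T k)%g).

(* chiI and chiJ cut I * G and J * G in two sides; Z contains the terms of T  *)
(* that cross the cut.                                                        *)
Definition flux (h : J * G -> C) (f : I * G -> C) : C :=
  \sum_(z <- Z) ((chiJ (esrc z.1, z.2))%:R - (chiI (etg z.1, (z.2 * es T z.1)%g))%:R) *
    ((h (esrc z.1, z.2))^* * (ew z.1 * f (etg z.1, (z.2 * es T z.1)%g))).

(** Both products are sums over all terms of [T], and a term that does not cross the cut contributes
    equally to both. *)
Lemma fluxE h c : fin_supp h -> fin_supp c ->
  iprod (mask chiJ h) (op T c) - iprod (op (adj T) h) (mask chiI c) = flux h c.
Proof.
move=> fh fc; rewrite iprod_op // iprod_adj; last exact: fin_supp_mask.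
have f1 : fin_supp (fun x : eK T * G => c (etg x.1, (x.2 * es T x.1)%g)).
  by apply: fin_supp_rows => k; exact: (fin_supp_shift (etg k) (es T k) fc).
have f2 : fin_supp (fun x : eK T * G => (mask chiJ h (esrc x.1, x.2))^* *
    (ew x.1 * c (etg x.1, (x.2 * es T x.1)%g))).
  by apply: eq_fin_supp f1 => x ->; rewrite !mulr0.
have f3 : fin_supp (fun x : eK T * G => (h (esrc x.1, x.2))^* *
    (ew x.1 * mask chiI c (etg x.1, (x.2 * es T x.1)%g))).
  by apply: eq_fin_supp f1 => x; rewrite /mask => ->; rewrite !mulr0.
rewrite -(fin_sum_rows f2) -(fin_sum_rows f3) -fin_sumB // (fin_sumE uZ) => [|[k g] kg].
  apply: eq_bigr => -[k g] _ /=; rewrite /mask rmorphM /= rmorph_nat; ring.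
by rewrite /mask /= (ZP kg) rmorphM /= rmorph_nat; ring.
Qed.

(** Truncations that agree with [h] and [f] on the crossing terms have the same flux, and by [fluxE]
    it is small, since [T] and its adjoint nearly annihilate them. *)
Lemma flux_kernel h f : l2 h -> l2 f ->
  (forall x, op (adj T) h x = 0) -> (forall x, op T f x = 0) -> flux h f = 0.
Proof.
move=> [Bh hB] [Bf fB] Th Tf; apply/eqP; rewrite -sqmod_eq0 eq_le sqmod_ge0 andbT.
have Bh0 : 0 <= Bh by have := hB [::] isT; rewrite big_nil.
have Bf0 : 0 <= Bf by have := fB [::] isT; rewrite big_nil.
apply: (@small_le0 _ _ (2 * (Bh + Bf))) => [|d d0].
  by rewrite mulr_ge0 // addr_ge0.
pose rJ := [seq (esrc z.1, z.2) | z <- Z].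
pose rI := [seq (etg z.1, (z.2 * es T z.1)%g) | z <- Z].
have [h' [fh' hh' Nh Nh']] := truncate hB Th rJ d0.
have [c [fc cf Nc Nc']] := truncate fB Tf rI d0.
have -> : flux h f = flux h' c.
  rewrite /flux !big_seq; apply: eq_bigr => z zZ.
  rewrite hh'; last by apply/mapP; exists z.
  by rewrite cf //; apply/mapP; exists z.
rewrite -fluxE //; apply: (le_trans (sqmodD _ _)); rewrite sqmodN -mulrA ler_wpM2l //.
rewrite mulrDl; apply: lerD.
  apply: (le_trans (iprod_bound (fin_supp_mask _ fh') (fin_supp_op _ fc))).
  apply: ler_pM; rewrite ?sqnorm_ge0 //; exact: le_trans (sqnorm_mask _ fh') Nh.
apply: (le_trans (iprod_bound (fin_supp_op _ fh') (fin_supp_mask _ fc))).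
rewrite mulrC; apply: ler_pM; rewrite ?sqnorm_ge0 //; exact: le_trans (sqnorm_mask _ fc) Nc.
Qed.

End OneCut.
End Cut.

(** * Aomoto sets *)

Section Potential.
Variables (R : realType) (V E : finType) (G : wgraph R V E).

Definition acyclic (F : {set E}) : Prop :=
  forall p, graph_cycle G p -> ~~ all (fun e => e \in F) p.

Definition arc_rel (F : {set E}) : rel V :=
  fun u v => [exists e in F, (org G e == u) && (tgt G e == v)].

Lemma tgt_arev e : tgt G (arev G e) = org G e.
Proof. by rewrite -org_arev arevK. Qed.

Lemma arc_rel_sym (F : {set E}) :
  (forall e, (arev G e \in F) = (e \in F)) -> symmetric (arc_rel F).
Proof.
move=> sF; suff H u v : arc_rel F u v -> arc_rel F v u.
  by move=> u v; apply/idP/idP; apply: H.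
case/exists_inP=> e eF /andP[eu ev]; apply/exists_inP; exists (arev G e).
  by rewrite sF.
by rewrite org_arev tgt_arev eu ev.
Qed.

Section Step.
Variables (F : {set E}) (e0 : E).
Hypothesis sF : forall e, (arev G e \in F) = (e \in F).
Hypothesis e0F : e0 \notin F.

Definition arc_of u v : E :=
  odflt e0 [pick e in F | (org G e == u) && (tgt G e == v)].

Lemma arc_ofP u v : arc_rel F u v ->
  [/\ arc_of u v \in F, org G (arc_of u v) = u & tgt G (arc_of u v) = v].
Proof.
case/exists_inP=> e eF euv; rewrite /arc_of; case: pickP => [e' /=|/(_ e)].
  by case/and3P=> -> /eqP -> /eqP ->.
by rewrite eF euv.
Qed.

(** [e] is the preceding arc. The last hypothesis excludes backtracking: the reverse of [e] is not
    in the rest of the path, either because it is not in [F] or because it ends at a vertex not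
    visited again. *)
Lemma arcs_cycle u p e : path.path (arc_rel F) u p -> uniq (u :: p) ->
  tgt G e = u -> last u p = org G e0 ->
  e = e0 \/ (e \in F /\ org G e \notin u :: p) ->
  path.path [rel e e' | (tgt G e == org G e') && (e' != arev G e)] e
    (rcons (pairmap arc_of u p) e0).
Proof.
elim: p u e => [|v p IH] u e /=.
  move=> _ _ -> -> he; rewrite eqxx andbT /=.
  case: he => [->|[eF _]]; first by rewrite eq_sym arev_neq.
  by apply: contraNneq e0F => ->; rewrite sF.
case/andP=> uv vp /andP[up uvp] eu lp he; have [aF oa ta] := arc_ofP uv.
rewrite eu oa eqxx /=; apply/andP; split; last first.
  by apply: IH => //; right; rewrite oa.
apply/eqP => ae; case: he => [ee0|[eF]].
  by move: aF; rewrite ae ee0 sF (negPf e0F).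
by rewrite !inE !negb_or -(tgt_arev e) -ae ta eqxx andbF.
Qed.

(** [e0] closes a path of [F] without repeated vertices. *)
Lemma connect_cycle : connect (arc_rel F) (tgt G e0) (org G e0) ->
  exists2 p, graph_cycle G p & all (fun e => (e \in F) || (e == e0)) p.
Proof.
case/connectP=> p0 p0P; case/shortenP: p0P => p pP up _ lp {p0}.
exists (e0 :: pairmap arc_of (tgt G e0) p); last first.
  rewrite /= eqxx orbT /=; elim: p (tgt G e0) pP {up lp} => //= v p IH u.
  by case/andP=> /arc_ofP[-> _ _] /IH ->.
apply/and3P; split=> //.
  have -> : [seq org G e | e <- e0 :: pairmap arc_of (tgt G e0) p] =
      last (tgt G e0) p :: belast (tgt G e0) p.
    rewrite /= lp; congr (_ :: _).
    elim: p (tgt G e0) pP {up lp} => //= v p IH u.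
    by case/andP=> /arc_ofP[_ -> _] /IH ->.
  by rewrite cons_uniq -rcons_uniq -lastI.
by apply: (arcs_cycle pP up) => //; left.
Qed.

End Step.

(* By the second part, tau takes its values in the subgroup generated by the  *)
(* values of a on F.                                                          *)
Lemma potential (gT : groupType) (a : E -> gT) (F : {set E}) :
  (forall e, a (arev G e) = (a e)^-1%g) ->
  (forall e, (arev G e \in F) = (e \in F)) -> acyclic F ->
  exists2 tau : V -> gT, forall e, e \in F -> tau (tgt G e) = (tau (org G e) * a e)%g
    & forall P : gT -> Prop, P 1%g -> (forall x y, P x -> P y -> P (x * y)%g) ->
        (forall x, P x -> P x^-1%g) -> (forall e, e \in F -> P (a e)) -> forall v, P (tau v).
Proof.
move=> aV; have [n] := ubnP #|F|; elim: n F => // n IH F Fn sF aF.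
have [->|[e0 e0F]] := set_0Vmem F.
  by exists (fun=> 1%g) => [e|P P1 _ _ _ v //]; rewrite inE.
pose F' := F :\ e0 :\ arev G e0.
have F'F e : e \in F' -> e \in F by rewrite !inE => /and3P[].
have sF' e : (arev G e \in F') = (e \in F').
  rewrite !inE sF (inj_eq (can_inj (@arevK _ _ _ G))).
  by rewrite -[arev G e == e0](inj_eq (can_inj (@arevK _ _ _ G))) arevK andbCA.
have e0F' : e0 \notin F' by rewrite !inE eqxx andbF.
have [|||tau tauP tauS] := IH F' => //.
- rewrite -ltnS; apply: leq_trans Fn; rewrite ltnS; apply/proper_card/properP.
  by split; [apply/fintype.subsetP | exists e0].
- move=> p /aF; apply: contra => /allP pF; apply/allP => e /pF; exact: F'F.
have nc : ~~ connect (arc_rel F') (tgt G e0) (org G e0).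
  apply/negP => /(connect_cycle sF' e0F')[p /aF/allPn[e ep eF] /allP/(_ e ep)].
  by move=> h; move/negP: eF; apply; case/orP: h => [/F'F|/eqP->].
pose c v := connect (arc_rel F') (tgt G e0) v.
have cF' e : e \in F' -> c (tgt G e) = c (org G e).
  have H e' : e' \in F' -> c (org G e') -> c (tgt G e').
    move=> e'F ce'; apply: connect_trans ce' (connect1 _).
    by apply/exists_inP; exists e'; rewrite ?eqxx.
  move=> eF; apply/idP/idP; last exact: H.
  by rewrite -org_arev -[c (org G e)]/(c _) -(tgt_arev e); apply: H; rewrite sF'.
(* No arc of [F'] leaves the component [c] of the terminus of [e0], so [tau] may be shifted there by
   the [d] that makes the equation at [e0] hold. *)
pose d := (tau (org G e0) * a e0 * (tau (tgt G e0))^-1)%g.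
exists (fun v => if c v then (d * tau v)%g else tau v) => [e eF|P P1 PM PV Pa v]; last first.
  have Ptau u : P (tau u) by apply: tauS => // e /F'F; apply: Pa.
  by case: ifP => // _; apply: (PM) => //; apply: (PM); [apply: (PM) => //; apply: (Pa) | apply: (PV)].
have c0 : c (tgt G e0) by apply: connect0.
have {}nc : c (org G e0) = false by apply: negPf.
have [eF'|] := boolP (e \in F').
  by rewrite cF' // tauP //; case: ifP => // _; rewrite mulgA.
rewrite !inE eF andbT negb_and !negbK => /orP[]/eqP->.
  by rewrite tgt_arev org_arev aV nc c0 /d mulgVK mulgK.
by rewrite nc c0 /d mulgVK.
Qed.

End Potential.

Section Certificate.
Variables (R : realType) (V E : finType) (G : wgraph R V E).
Local Notation C := R[i].

Section Components.
Variable D : {set V}.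

Definition inner : {set E} := [set e | (org G e \in D) && (tgt G e \in D)].
Definition cut_arcs : {set E} := [set e | (org G e \notin D) && (tgt G e \in D)].
Definition boundary : {set V} := [set org G e | e in cut_arcs].
(** A representative names the component of G[D]; a vertex outside [D] represents itself, whence the
    restriction to [D] in [comp_roots]. *)
Definition comp_root (v : V) : V := fingraph.root (arc_rel G inner) v.
Definition comp_roots : {set V} := [set v in D | comp_root v == v].

Lemma inner_arev e : (arev G e \in inner) = (e \in inner).
Proof. by rewrite !inE org_arev tgt_arev andbC. Qed.

Lemma inner_csym : connect_sym (arc_rel G inner).
Proof. exact/sym_connect_sym/arc_rel_sym/inner_arev. Qed.

Lemma comp_root_inner e : e \in inner -> comp_root (org G e) = comp_root (tgt G e).
Proof.
move=> eD; apply/eqP; rewrite (root_connect inner_csym); apply: connect1.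
by apply/exists_inP; exists e; rewrite ?eqxx.
Qed.

Lemma comp_rootK v : comp_root (comp_root v) = comp_root v.
Proof. exact: root_root inner_csym v. Qed.

Lemma comp_root_in v : (comp_root v \in D) = (v \in D).
Proof.
have clD : fingraph.closed (arc_rel G inner) (mem D).
  by move=> u w /exists_inP[e]; rewrite inE => /andP[eu ew] /andP[/eqP<- /eqP<-]; rewrite /= eu ew.
by rewrite -(closed_connect clD (connect_root _ v)).
Qed.

Lemma comp_root_mem v : v \in D -> comp_root v \in comp_roots.
Proof. by move=> vD; rewrite inE comp_root_in vD comp_rootK /=. Qed.

Lemma cut_tgt (k : {e | e \in cut_arcs}) : comp_root (tgt G (val k)) \in comp_roots.
Proof. by apply: comp_root_mem; have := valP k; rewrite inE => /andP[]. Qed.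

Lemma cut_org (k : {e | e \in cut_arcs}) : org G (val k) \in boundary.
Proof. exact: imset_f (valP k). Qed.

Variables (gT : groupType) (w : E -> C) (s : E -> gT).

(* The unknowns are one function of g for each component of G[D], the         *)
(* equations one for each outer neighbour of D and each g.                    *)
Definition boundary_op : equivop R gT {v | v \in comp_roots} {v | v \in boundary} :=
  @Eop R gT {v | v \in comp_roots} {v | v \in boundary} {e | e \in cut_arcs}
    (fun k => exist (fun v => is_true (v \in boundary)) _ (cut_org k))
    (fun k => exist (fun v => is_true (v \in comp_roots)) _ (cut_tgt k))
    (fun k => w (val k)) (fun k => s (val k)).

Definition ext (A : {set V}) (c : {v | v \in A} * gT -> C) : V * gT -> C :=
  fun x => if insub x.1 is Some i then c (i, x.2) else 0.

Lemma extE (A : {set V}) (c : {v | v \in A} * gT -> C) i g :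
  ext c (val i, g) = c (i, g).
Proof. by rewrite /ext /= valK. Qed.

Lemma boundary_opE c j g : op boundary_op c (j, g) =
  \sum_(e | (org G e == val j) && (tgt G e \in D))
    w e * ext c (comp_root (tgt G e), (g * s e)%g).
Proof.
rewrite /op /=; transitivity (\sum_(k : {e | e \in cut_arcs} | org G (val k) == val j)
    w (val k) * ext c (comp_root (tgt G (val k)), (g * s (val k))%g)).
  by apply: eq_big => k //= _; rewrite -(extE c).
rewrite -(big_sub_cond (mem cut_arcs) (fun e => org G e == val j)
  (fun e => w e * ext c (comp_root (tgt G e), (g * s e)%g))).
apply: eq_bigl => e; rewrite !inE; have := valP j.
case: (eqVneq (org G e) (val j)) => [<-|_] /=; last by rewrite andbF.
case/imsetP=> e'; rewrite inE => /andP[/negPf ne' _] ->.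
by rewrite ne' andbT.
Qed.

End Components.

(* D is an Aomoto set.                                                        *)
Definition certificate (theta : R) : Prop :=
  exists (D : {set V}) (phi : V -> C),
  [/\ acyclic G (inner D), forall v, v \in D -> phi v != 0,
      forall v, v \in D -> ((vwt G v)%:C - theta%:C) * phi v +
        \sum_(e | (org G e == v) && (tgt G e \in D)) awt G e * phi (tgt G e) = 0
    & (#|boundary D| < #|comp_roots D|)%N].

(* A - theta on the cover with vertex set V * gT in which an arc e goes from  *)
(* (org e, g) to (tgt e, g * s e).                                            *)
Definition adj_shift (gT : groupType) (s : E -> gT) (theta : R) : equivop R gT V V :=
  @Eop R gT V V (V + E)%type
    (fun k => match k with inl v => v | inr e => org G e end)
    (fun k => match k with inl v => v | inr e => tgt G e end)
    (fun k => match k with inl v => (vwt G v)%:C - theta%:C | inr e => awt G e end)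
    (fun k => match k with inl v => 1%g | inr e => s e end).

Lemma adj_shiftE (gT : groupType) (s : E -> gT) (theta : R) c x :
  op (adj_shift s theta) c x = ((vwt G x.1)%:C - theta%:C) * c x +
    \sum_(e | org G e == x.1) awt G e * c (tgt G e, (x.2 * s e)%g).
Proof.
rewrite /op big_sumType /=; congr (_ + _).
by rewrite big_pred1_eq mulg1; case: x.
Qed.

Lemma adj_shift_adj (gT : groupType) (s : E -> gT) (theta : R) :
  (forall e, s (arev G e) = (s e)^-1%g) -> op (adj (adj_shift s theta)) = op (adj_shift s theta).
Proof.
move=> sV; apply/funext => c; apply/funext => x; rewrite adj_shiftE /op big_sumType /=.
congr (_ + _).
  rewrite big_pred1_eq invg1 mulg1 -rmorphB; case: x => v g /=.
  by congr (_ * _); apply/eqP; rewrite eq_complex /= subr0 oppr0 !eqxx.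
rewrite (reindex_inj (can_inj (@arevK _ _ _ G))) /=.
apply: eq_big => e; first by rewrite tgt_arev.
by rewrite awt_arev conjcK org_arev sV invgK.
Qed.

End Certificate.

Section SquareSummable.
Variables (R : realType) (V E X : choiceType).
Local Notation C := R[i].

Lemma square_summableP (f : X -> C) : square_summable f <-> l2 f.
Proof.
rewrite /square_summable /esum; split=> [fin|[B fB]].
  have sup0 : (0 <= ereal_sup [set (\sum_(u \in A) (Normc.normc (f u) ^+ 2)%:E)%E | A in fsets [set: X]])%E.
    by apply: ereal_sup_ubound; exists set0; [exact: fsets_set0 | rewrite fsbig_set0].
  exists (fine (ereal_sup [set (\sum_(u \in A) (Normc.normc (f u) ^+ 2)%:E)%E | A in fsets [set: X]])).
  move=> r ur; rewrite -lee_fin fineK; last by rewrite ge0_fin_numE.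
  apply: ereal_sup_ubound; exists [set` r].
    by split=> //; exact: finite_seq.
  by rewrite -fsbig_seq // -sumEFin; apply: eq_bigr => x _; rewrite sqmod_normc.
apply: (@le_lt_trans _ _ B%:E); last exact: ltry.
apply: ge_ereal_sup => _ [A [fA _] <-].
rewrite fsbig_finite //= sumEFin lee_fin.
rewrite (eq_bigr (fun x => sqmod (f x))) => [|x _]; last by rewrite sqmod_normc.
exact/fB/finmap.fset_uniq.
Qed.

End SquareSummable.

Section L2Tools.
Variable R : realType.
Local Notation C := R[i].

Lemma l2_comp (X Y : choiceType) (h : X -> Y) (f : Y -> C) :
  injective h -> l2 f -> l2 (fun x => f (h x)).
Proof.
move=> ih [B fB]; exists B => r ur.
by have := fB (map h r); rewrite big_map map_inj_uniq //; apply.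
Qed.

Lemma l2_scale (X : choiceType) (a : C) (f : X -> C) : l2 f -> l2 (fun x => a * f x).
Proof.
move=> [B fB]; exists (sqmod a * B) => r ur.
under eq_bigr do rewrite sqmodM; rewrite -mulr_sumr.
by apply: ler_wpM2l; [exact: sqmod_ge0 | exact: fB].
Qed.

Lemma l2_rows (I : finType) (X : choiceType) (f : I * X -> C) :
  (forall i, l2 (fun x => f (i, x))) -> l2 f.
Proof.
move=> /fin_all_exists[B fB]; exists (\sum_i B i) => r ur.
rewrite (partition_big (fun x => x.1) xpredT) //=; apply: ler_sum => i _.
pose q := [seq x.2 | x <- [seq x <- r | x.1 == i]].
have uq : uniq q.
  rewrite map_inj_in_uniq ?filter_uniq // => -[a x] [b y].
  by rewrite !mem_filter /= => /andP[/eqP-> _] /andP[/eqP-> _] ->.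
apply: le_trans (fB i q uq); rewrite big_map big_filter.
by apply: ler_sum => -[j x] /eqP /= ->.
Qed.

Lemma l2_0 (X : choiceType) : l2 (fun _ : X => 0 : C).
Proof. by exists 0 => r _; rewrite big1 // => x _; rewrite sqmod0. Qed.

End L2Tools.

Section CertificateKernel.
Variables (R : realType) (V E : finType) (G : wgraph R V E).
Variables (gT : groupType) (s : E -> gT) (theta : R).
Local Notation C := R[i].
Hypothesis sV : forall e, s (arev G e) = (s e)^-1%g.

Lemma l2_ext (A : {set V}) (c : {v | v \in A} * gT -> C) : l2 c -> l2 (ext c).
Proof.
move=> lc; apply: l2_rows => v; rewrite /ext /=.
case: insub => [i|]; last exact: l2_0.
by apply: (l2_comp (h := fun x => (i, x))) lc => x y [].
Qed.

(** Since G[D] is a forest, [potential] makes the labels on it trivial: each component lifts to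
    disjoint copies of itself, on which phi solves the equation. *)
Theorem certificate_kernel : certificate G theta -> has_kernel (adj_shift G s theta).
Proof.
move=> [D [phi [aD phi0 phiE card]]].
have [tau tauP _] := potential sV (@inner_arev _ _ _ G D) aD.
pose T := boundary_op G D (fun e => awt G e * phi (tgt G e)) (fun e => (s e * (tau (tgt G e))^-1)%g).
have [|c [lc [[i h] ci] Tc]] := @has_kernel_of_card _ _ _ _ T.
  by rewrite !card_sig.
(* The pair of the root of [v] and g * tau(v)^-1 names the copy of the component through (v, g); [c]
   is the constant chosen on it. *)
pose f (x : V * gT) : C :=
  if x.1 \in D then phi x.1 * ext c (comp_root G D x.1, (x.2 * (tau x.1)^-1)%g) else 0.
have [iD /eqP ri] : val i \in D /\ comp_root G D (val i) == val i.
  by have := valP i; rewrite inE => /andP[].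
exists f; split.
- apply: l2_rows => v; rewrite /f /=.
  have [vD|vD] := boolP (v \in D); last exact: l2_0.
  apply: l2_scale; apply: (l2_comp (h := fun g => (comp_root G D v, (g * (tau v)^-1)%g))).
    by move=> a b [/mulIg].
  exact: l2_ext.
- exists (val i, (h * tau (val i))%g).
  by rewrite /f /= iD ri mulgK extE mulf_neq0 // phi0.
move=> [v g]; rewrite adj_shiftE /=.
have inn e : (org G e == v) && (tgt G e \in D) -> v \in D -> e \in inner G D.
  by case/andP=> /eqP ov tD vD; rewrite inE ov vD.
have fE : \sum_(e | org G e == v) awt G e * f (tgt G e, (g * s e)%g) =
    \sum_(e | (org G e == v) && (tgt G e \in D)) awt G e * phi (tgt G e) *
      ext c (comp_root G D (tgt G e), (g * (s e * (tau (tgt G e))^-1))%g).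
  rewrite big_mkcondr; apply: eq_bigr => e _; rewrite /f /=.
  by case: ifP => _; rewrite ?mulr0 // mulrA mulgA.
have [vD|vD] := boolP (v \in D).
  rewrite fE /f /= vD mulrA.
  rewrite (eq_bigr (fun e => awt G e * phi (tgt G e) *
      ext c (comp_root G D v, (g * (tau v)^-1)%g))) => [|e ev].
    by rewrite -mulr_suml -mulrDl phiE // mul0r.
  have eD := inn e ev vD; have /andP[/eqP ov _] := ev.
  by rewrite -(comp_root_inner eD) (tauP _ eD) ov invgM mulVKg.
rewrite fE {1}/f /= (negPf vD) mulr0 add0r.
have [vb|vb] := boolP (v \in boundary G D).
  by have := Tc (exist _ v vb, g); rewrite boundary_opE.
rewrite big1 // => e /andP[/eqP ov tD]; case/negP: vb.
by rewrite -ov; apply: imset_f; rewrite inE ov vD.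
Qed.

End CertificateKernel.

(** * Passage between the covers and equivariant operators *)

Section CoverKernel.
Variables (R : realType) (V E : finType) (G : wgraph R V E) (O : orientation G).
Variables (gT : groupType)
  (phi : UMagmaMorphism.type (free_group {x | x \in O}) gT) (theta : R).

Lemma cover_kernelP : l2_eigenvalue (Defs.cover phi) theta%:C <->
  has_kernel (adj_shift G (fun e => phi (arc_elt O e)) theta).
Proof.
split=> -[f [lf nz Af]]; exists f; split=> //; try exact/square_summableP.
  move=> x; rewrite adj_shiftE mulrBl addrAC.
  by have := Af x; rewrite adj_op_cover => ->; rewrite subrr.
move=> x; rewrite adj_op_cover; apply/eqP; rewrite -subr_eq0; apply/eqP.
by have := Af x; rewrite adj_shiftE mulrBl addrAC.
Qed.

Lemma cover_arcV e : phi (arc_elt O (arev G e)) = (phi (arc_elt O e))^-1%g.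
Proof. by rewrite arc_elt_rev gmulfV. Qed.

End CoverKernel.

(* The cover by gT is a union of components of the cover by hT: psi and tau   *)
(* embed it, and a function extends by zero.                                  *)
Section Embedding.
Variables (R : realType) (V E : finType) (G : wgraph R V E) (theta : R).
Variables (gT hT : groupType) (s : E -> gT) (s' : E -> hT).
Variables (pi : hT -> gT) (psi : gT -> hT) (tau : V -> hT).
Hypothesis pis : forall k e, pi (k * s' e)%g = (pi k * s e)%g.
Hypothesis psis : forall g e,
  (psi (g * s e) * tau (tgt G e))%g = (psi g * tau (org G e) * s' e)%g.
Hypothesis piK : forall g v, pi (psi g * tau v)%g = g.

Lemma kernel_embed : has_kernel (adj_shift G s theta) -> has_kernel (adj_shift G s' theta).
Proof.
move=> [f [[B fB] [[v0 g0] f0] Tf]].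
(* The image of the embedding of (v, g) as (v, psi g * tau v); by [psis], an arc never leads out of
   it or into it. *)
pose on (x : V * hT) := x.2 == (psi (pi x.2) * tau x.1)%g.
pose F (x : V * hT) := (on x)%:R * f (x.1, pi x.2).
exists F; split.
- exists B => r ur.
  pose q := [seq (x.1, pi x.2) | x <- r & on x].
  have uq : uniq q.
    rewrite map_inj_in_uniq ?filter_uniq // => -[v k] [w l].
    rewrite !mem_filter /on /= => /andP[/eqP ek _] /andP[/eqP el _] [vw kl].
    by rewrite ek el vw kl.
  apply: le_trans (fB q uq); rewrite big_map big_filter [leRHS]big_mkcond /=.
  by apply: ler_sum => x _; rewrite /F; case: ifP; rewrite ?mul1r // mul0r sqmod0.
- by exists (v0, (psi g0 * tau v0)%g); rewrite /F /on /= piK eqxx mul1r.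
move=> [v k]; have := Tf (v, pi k); rewrite !adj_shiftE /= => Tfv.
rewrite /F /= mulrCA -[RHS](mulr0 (on (v, k))%:R) -[in RHS]Tfv mulrDr.
congr (_ + _); rewrite mulr_sumr; apply: eq_bigr => e /eqP ev.
rewrite mulrCA pis; congr (_%:R * _).
by rewrite /on /= pis psis ev (inj_eq (@mulIg _ _)).
Qed.

End Embedding.

Lemma free_group_ind (T : choiceType) (P : free_group T -> Prop) :
  P 1%g -> (forall x, P (fgen x)) -> (forall u, P u -> P u^-1%g) ->
  (forall u v, P u -> P v -> P (u * v)%g) -> forall w, P w.
Proof.
move=> P1 Pg PV PM [w rw]; elim: w rw => [|a w IH] rw.
  by rewrite (_ : FreeGroup rw = 1%g) //; apply: val_inj.
have rw' := reduced_tail rw.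
have -> : FreeGroup rw = ((if a.2 then (fgen a.1)^-1 else fgen a.1) * FreeGroup rw')%g.
  apply: val_inj => /=.
  have -> : fword (if a.2 then (fgen a.1)^-1%g else fgen a.1) = [:: a].
    by case: a {rw} => x [].
  by case: w rw rw' {IH} => //= b w /andP[/negPf->].
by apply: PM => //; case: ifP => _; [apply: PV|]; apply: Pg.
Qed.

Lemma uniq_map_inj (T1 T2 : eqType) (f : T1 -> T2) (s : seq T1) :
  uniq (map f s) -> {in s &, injective f}.
Proof.
elim: s => //= z s IH /andP[fz us] x y; rewrite !inE.
move=> /orP[/eqP->|xs] /orP[/eqP->|ys] fxy //; last exact: IH.
  by rewrite fxy map_f in fz.
by rewrite -fxy map_f in fz.
Qed.

Section Cycles.
Variables (R : realType) (V E : finType) (G : wgraph R V E).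

(** The successor of [e] starts where the reverse of [e] does. As origins are distinct, the reverse
    could only occur as this successor, which is excluded. *)
Lemma cycle_arev (p : seq E) e : graph_cycle G p -> e \in p -> arev G e \notin p.
Proof.
case/and3P=> _ up cp ep; apply/negP => ep'.
have /andP[/eqP te /eqP ne] := next_cycle cp ep.
apply: ne; apply: (uniq_map_inj up) => //; first by rewrite mem_next.
by rewrite org_arev.
Qed.

End Cycles.

Section CotreeEmbedding.
Variables (R : realType) (V E : finType) (G : wgraph R V E) (O : orientation G).
Variables (F : {set E}) (theta : R).
Hypothesis hF : spanning_forest G F.
Local Notation S := {e : E | e \in O :\: F}.

Lemma arc_cases e : [\/ e \in F, exists sg : S, e = val sg
  | exists sg : S, e = arev G (val sg)].
Proof.
have [eF|eF] := boolP (e \in F); first by constructor 1.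
have [eO|eO] := boolP (e \in O).
  have eS : e \in O :\: F by rewrite inE eF.
  by constructor 2; exists (exist _ e eS).
have eS : arev G e \in O :\: F by rewrite inE hF.1 eF orientationP.
by constructor 3; exists (exist (fun e => is_true (e \in O :\: F)) _ eS); rewrite /= arevK.
Qed.

(** The labels [arc_elt] are single letters, distinct for distinct arcs. The potential [tau] for
    them along [F] lies in the kernel of [uni_hom], by the second part of [potential], and [psi] is
    a section of [uni_hom]. *)
Lemma uni_embed : has_kernel (adj_shift G (fun e => uni_hom O F (arc_elt O e)) theta) ->
  has_kernel (adj_shift G (arc_elt O) theta).
Proof.
have [tau tauP tauS] := potential (@arc_elt_rev _ _ _ G O) hF.1 hF.2.
have tau1 v : uni_hom O F (tau v) = 1%g.
  apply: (tauS (fun x => uni_hom O F x = 1%g)) => [|x y hx hy|x hx|e eF].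
  - exact: gmulf1.
  - by rewrite gmulfM hx hy mulg1.
  - by rewrite gmulfV hx invg1.
  - exact: cotree_hom_forest hF.1 eF.
(* The label of the arc, corrected at both ends by the labels along the forest: that of a
   fundamental cycle. *)
pose c (sg : S) := (tau (org G (val sg)) * arc_elt O (val sg) * (tau (tgt G (val sg)))^-1)%g.
pose psi : free_group S -> free_group {x | x \in O} := flift c.
have psiM : {morph psi : x y / (x * y)%g} := fliftM c.
have psi1 : psi 1%g = 1%g by [].
have psiV x : psi x^-1%g = (psi x)^-1%g.
  by apply: (mulIg (psi x)); rewrite -psiM !mulVg.
have psiE e : psi (uni_hom O F (arc_elt O e)) =
    (tau (org G e) * arc_elt O e * (tau (tgt G e))^-1)%g.
  case: (arc_cases e) => [eF|[sg ->]|[sg ->]].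
  - by rewrite [uni_hom O F _](cotree_hom_forest _ hF.1 eF) tauP // mulgV.
  - by rewrite [uni_hom O F _]cotree_hom_arc /psi flift_gen.
  - rewrite arc_elt_rev gmulfV psiV [uni_hom O F _]cotree_hom_arc /psi flift_gen.
    by rewrite /c org_arev tgt_arev !invgM invgK mulgA.
have piK x : uni_hom O F (psi x) = x.
  elim/free_group_ind: x => [|sg|u hu|u v hu hv].
  - by rewrite psi1 gmulf1.
  - rewrite /psi flift_gen /c !gmulfM gmulfV !tau1 mul1g invg1 mulg1.
    exact: cotree_hom_arc.
  - by rewrite psiV gmulfV hu.
  - by rewrite psiM gmulfM hu hv.
apply: (@kernel_embed _ _ _ G theta _ _ _ _ (uni_hom O F) psi tau).
- by move=> k e; rewrite gmulfM.
- by move=> g e; rewrite psiM psiE -!mulgA mulVg mulg1.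
- by move=> g v; rewrite gmulfM piK tau1 mulg1.
Qed.

Local Notation ZE := (Algebra.to_multiplicative {ffun E -> int}).

(** With a coordinate for each arc and not for each edge, no orientation has to be chosen. *)
Definition arc_vec (e : E) : ZE := [ffun e' => (e' == e)%:R - (e' == arev G e)%:R].

Lemma arc_vecV e : arc_vec (arev G e) = (arc_vec e)^-1%g.
Proof. by apply/ffunP => e'; rewrite !ffunE arevK opprB. Qed.

Lemma arc_vecN e : arc_vec (arev G e) = - (arc_vec e : {ffun E -> int}).
Proof. exact: arc_vecV. Qed.

(** The argument of [uni_embed] in additive notation: [pi] keeps the coordinates in S_+, and [psi]
    is a section of it. *)
Lemma ab_embed : has_kernel (adj_shift G (fun e => ab_hom O F (arc_elt O e)) theta) ->
  has_kernel (adj_shift G arc_vec theta).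
Proof.
have [tau tauP tauS] := potential arc_vecV hF.1 hF.2.
pose pi (h : {ffun E -> int}) : {ffun S -> int} := [ffun sg => h (val sg)].
have piD h k : pi (h + k) = pi h + pi k by apply/ffunP => sg; rewrite !ffunE.
have piN h : pi (- h) = - pi h by apply/ffunP => sg; rewrite !ffunE.
have piS sg : pi (arc_vec (val sg)) = abgen sg :> {ffun S -> int}.
  apply/ffunP => sg'; rewrite !ffunE -val_eqE /=.
  rewrite [val sg' == arev G _](_ : _ = false) ?subr0 //.
  apply/eqP => h; have := valP sg'; have := valP sg; rewrite !inE h orientationP.
  by case/andP=> _ ->; rewrite andbF.
have pi_arc e : pi (arc_vec e) = ab_hom O F (arc_elt O e) :> {ffun S -> int}.
  case: (arc_cases e) => [eF|[sg ->]|[sg ->]].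
  - rewrite [ab_hom O F _](cotree_hom_forest _ hF.1 eF).
    apply/ffunP => sg; rewrite !ffunE /=.
    have sgF : val sg \notin F by have := valP sg; rewrite inE => /andP[].
    have -> : (val sg == e) = false by apply/eqP => h; move: sgF; rewrite h eF.
    have -> : (val sg == arev G e) = false.
      by apply/eqP => h; move: sgF; rewrite h hF.1 eF.
    by rewrite subr0.
  - by rewrite piS [ab_hom O F _]cotree_hom_arc.
  - rewrite arc_vecN piN piS arc_elt_rev gmulfV.
    by rewrite [ab_hom O F (arc_elt _ _)]cotree_hom_arc.
have tau1 v : pi (tau v) = 0.
  apply: (tauS (fun x : {ffun E -> int} => pi x = 0)) => [|x y hx hy|x hx|e eF].
  - by apply/ffunP => sg; rewrite !ffunE.
  - by rewrite [LHS]piD hx hy addr0.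
  - by rewrite [LHS]piN hx oppr0.
  - by rewrite pi_arc [ab_hom O F _](cotree_hom_forest _ hF.1 eF).
pose d e : {ffun E -> int} := (tau (org G e) : {ffun E -> int}) + arc_vec e - (tau (tgt G e) : {ffun E -> int}).
pose psi (g : {ffun S -> int}) : {ffun E -> int} := \sum_sg d (val sg) *~ g sg.
have psiD g k : psi (g + k) = psi g + psi k.
  by rewrite /psi -big_split; apply: eq_bigr => sg _; rewrite ffunE mulrzDr.
have psiN g : psi (- g) = - psi g.
  by rewrite /psi -sumrN; apply: eq_bigr => sg _; rewrite ffunE mulrNz.
have psiS sg : psi (abgen sg) = d (val sg).
  rewrite /psi (bigD1 sg) //= big1 ?addr0 => [|sg' ne]; rewrite ffunE ?eqxx //.
  by rewrite (negPf ne).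
have psiE e : psi (ab_hom O F (arc_elt O e)) = d e.
  case: (arc_cases e) => [eF|[sg ->]|[sg ->]].
  - rewrite [ab_hom O F _](cotree_hom_forest _ hF.1 eF) /d tauP //.
    by rewrite [X in _ - X](_ : _ = (tau (org G e) : {ffun E -> int}) + arc_vec e) // subrr /psi big1 // => sg _; rewrite ffunE.
  - by rewrite [ab_hom O F _]cotree_hom_arc psiS.
  - rewrite arc_elt_rev gmulfV [psi _]psiN [ab_hom O F (arc_elt _ _)]cotree_hom_arc psiS.
    by rewrite /d org_arev tgt_arev arc_vecN opprB opprD addrA addrAC.
have piK x : pi (psi x) = x.
  have pid sg : pi (d (val sg)) = abgen sg :> {ffun S -> int}.
    by rewrite /d !piD piN !tau1 add0r oppr0 addr0 piS.
  have {}pid (sg sg' : S) : d (val sg) (val sg') = (sg' == sg)%:R.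
    have := congr1 (fun h : {ffun S -> int} => h sg') (pid sg).
    by rewrite [LHS]ffunE [RHS]ffunE.
  apply/ffunP => sg; rewrite [LHS]ffunE sum_ffunE (bigD1 sg) //= big1 => [|sg' ne].
    by rewrite addr0 ffunMzE pid eqxx intz.
  by rewrite ffunMzE pid eq_sym (negPf ne) mul0rz.
apply: (@kernel_embed _ _ _ G theta (Algebra.to_multiplicative {ffun S -> int}) ZE
  (fun e => ab_hom O F (arc_elt O e)) arc_vec pi psi tau).
- by move=> k e; rewrite [LHS]piD pi_arc.
- move=> g e; rewrite [LHS](_ : _ = psi (g + ab_hom O F (arc_elt O e)) + tau (tgt G e)) //.
  by rewrite psiD psiE /d addrA subrK !addrA.
- by move=> g v; rewrite [LHS]piD piK tau1 addr0.
Qed.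

End CotreeEmbedding.

Section Rigid.
Variables (R : realType) (V E : finType) (G : wgraph R V E) (theta : R).
Local Notation C := R[i].
Variables (D : {set V}) (U : (V -> C) -> Prop).
Hypothesis U_nz : forall v, v \in D -> exists2 F, U F & F v != 0.
Hypothesis U_ratio : forall e, e \in inner G D ->
  exists2 q, q != 0 & forall F, U F -> F (tgt G e) = q * F (org G e).

Lemma component_ratio u v : connect (arc_rel G (inner G D)) u v ->
  exists2 q, q != 0 & forall F, U F -> F v = q * F u.
Proof.
case/connectP=> p; elim: p u => [|w p IH] u /=.
  by move=> _ ->; exists 1; rewrite ?oner_neq0 // => F _; rewrite mul1r.
case/andP=> /exists_inP[e eD /andP[/eqP eu /eqP ew]] /IH{IH}IH /IH[q q0 qF].
have [q' q'0 q'F] := U_ratio eD; exists (q * q'); first by rewrite mulf_neq0.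
by move=> F UF; rewrite qF // -ew q'F // eu mulrA.
Qed.

(* For U a set of solutions with common ratios along the arcs within D: they  *)
(* are proportional to phi on each component of G[D].                         *)
Lemma rigid : exists phi : V -> C,
  [/\ forall v, v \in D -> phi v != 0,
      forall F v, U F -> v \in D -> F v * phi (comp_root G D v) = F (comp_root G D v) * phi v
    & forall v, v \in D -> exists2 F, U F & forall u, comp_root G D u = comp_root G D v -> phi u = F u].
Proof.
have /choice[f fP] : forall v, exists F, v \in D -> U F /\ F v != 0.
  move=> v; have [vD|_] := boolP (v \in D); last by exists (fun=> 0).
  by have [F UF Fv] := U_nz vD; exists F.
have fr v : v \in D -> U (f (comp_root G D v)) /\ f (comp_root G D v) (comp_root G D v) != 0.
  by move=> vD; apply: fP; rewrite comp_root_in.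
have ratio v : exists2 q, q != 0 & forall F, U F -> F v = q * F (comp_root G D v).
  by apply: component_ratio; rewrite (inner_csym G D); apply: connect_root.
exists (fun v => f (comp_root G D v) v); split.
- move=> v vD; have [Uf fv] := fr v vD; have [q q0 ->] := ratio v => //.
  by rewrite mulf_neq0.
- move=> F v UF vD; have [Uf fv] := fr v vD; have [q q0 qF] := ratio v.
  by rewrite comp_rootK qF // [f _ v]qF //; ring.
- move=> v vD; have [Uf fv] := fr v vD; exists (f (comp_root G D v)) => // u ->.
  by [].
Qed.

End Rigid.

(** * The universal cover *)

Section FreeHead.
Variable T : choiceType.
Implicit Types (u : seq (T * bool)) (a : T * bool).

(** Multiplication by a letter on the right affects only the end of a reduced word. *)
Lemma ohead_mul u a : reduced u -> u != [::] -> fmulw u [:: a] != [::] ->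
  ohead (fmulw u [:: a]) = ohead u.
Proof.
elim: u => //= b u IH ru _.
case E : (fmulw u [:: a]) => [|c w] //=; case: (eqVneq c (linv b)) => // cb w0.
have ru' := reduced_tail ru; case: u IH ru ru' E => [|d u] IH ru ru' E.
  by move: E => /= [_ w1]; rewrite -w1 in w0.
have := IH ru' isT; rewrite E => /(_ isT) [] cd.
by move: ru; rewrite /reduced /= -cd cb eqxx.
Qed.

End FreeHead.

Section UniversalKernel.
Variables (R : realType) (V E : finType) (G : wgraph R V E) (theta : R).
Variables (T : choiceType) (s : E -> free_group T) (ltr : E -> T * bool).
Local Notation C := R[i].
Local Notation M := (adj_shift G s theta).
Hypothesis sE : forall e, fword (s e) = [:: ltr e].
Hypothesis ltr_inj : injective ltr.
Hypothesis sV : forall e, s (arev G e) = (s e)^-1%g.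

(* The side, away from 1, of the arc from 1 to s e in the Cayley tree.        *)
Definition branch (e : E) (g : free_group T) : bool := ohead (fword g) == Some (ltr e).

Arguments branch : simpl never.

Lemma branch1 e : branch e 1%g = false. Proof. by []. Qed.

Lemma branch_arc e e' : branch e (s e') = (e' == e).
Proof. by rewrite /branch sE /= (inj_eq Some_inj) (inj_eq ltr_inj). Qed.

Lemma branch_mul e e' g : (e', g) != (e, 1%g) -> (e', g) != (arev G e, s e) ->
  branch e (g * s e')%g = branch e g.
Proof.
move=> h1 h2; have [g1|g1] := eqVneq g 1%g.
  rewrite g1 mul1g branch_arc branch1; apply/negbTE.
  by apply: contraNneq h1 => ->; rewrite g1.
have [g2|g2] := eqVneq (g * s e')%g 1%g.
  rewrite g2 branch1; apply/esym/negbTE; apply: contraNN h2 => bg.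
  have gE : g = s (arev G e') by rewrite sV; apply: (mulIg (s e')); rewrite g2 mulVg.
  move: bg; rewrite gE branch_arc => /eqP <-; rewrite arevK.
  by [].
have w1 : fword g != [::] by apply: contraNneq g1 => h; apply/eqP/val_inj.
have w2 : fmulw (fword g) [:: ltr e'] != [::].
  by rewrite -sE; apply: contraNneq g2 => h; apply/eqP/val_inj.
by rewrite /branch /= sE ohead_mul //; apply: fwordP.
Qed.

Definition ker (f : V * free_group T -> C) := l2 f /\ forall x, op M f x = 0.

Lemma ker_lt g f : ker f -> ker (translate g f).
Proof. by move=> [lf Mf]; split; [exact: l2_lt | move=> x; rewrite op_lt; apply: Mf]. Qed.

(* By flux_kernel for the cut that removes the arc e at 1 from the cover.     *)
Lemma ker_wronskian e f h : ker f -> ker h ->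
  awt G e * ((h (org G e, 1%g))^* * f (tgt G e, s e)) =
  (awt G e)^* * ((h (tgt G e, s e))^* * f (org G e, 1%g)).
Proof.
move=> [lf Mf] [lh Mh].
pose chi (x : V * free_group T) := branch e x.2.
pose Z : seq (eK M * free_group T) := [:: (inr e, 1%g); (inr (arev G e), s e)].
have uZ : uniq Z.
  rewrite /= inE andbT xpair_eqE negb_and; apply/orP; left.
  by apply/eqP => -[] /eqP; rewrite eq_sym (negPf (arev_neq _ _)).
have ZP (k : eK M) g : (k, g) \notin Z -> chi (esrc k, g) = chi (etg k, (g * es M k)%g).
  rewrite !inE negb_or /chi /=; case: k => [v|e'] /=; first by rewrite mulg1.
  by case/andP=> h1 h2; rewrite branch_mul.
have := @flux_kernel _ _ _ _ M chi chi Z uZ ZP h f lh lf.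
rewrite adj_shift_adj // => /(_ Mh Mf).
rewrite /flux big_cons big_seq1 /chi /=.
rewrite mul1g branch_arc eqxx.
rewrite sV mulgV branch1 org_arev tgt_arev awt_arev sub0r subr0 mul1r mulN1r.
by move/eqP; rewrite addrC subr_eq0 => /eqP eq; rewrite -[RHS]mulrCA -[LHS]mulrCA.
Qed.

(** Evaluation at 1 is no restriction, since [ker] is invariant under translation. *)
Definition ksupp : {set V} := [set v | `[< exists2 f, ker f & f (v, 1%g) != 0 >]].

Lemma ksuppP v : reflect (exists2 f, ker f & f (v, 1%g) != 0) (v \in ksupp).
Proof. by rewrite inE; apply: asboolP. Qed.

Lemma ker_off f v g : ker f -> v \notin ksupp -> f (v, g) = 0.
Proof.
move=> kf vD; apply/eqP; apply: contraNT vD => fv; apply/ksuppP.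
by exists (translate g f); [exact: ker_lt | rewrite /translate /= mulg1].
Qed.

Lemma ksupp_at v g : v \in ksupp -> exists2 f, ker f & f (v, g) != 0.
Proof.
case/ksuppP=> f kf fv; exists (translate g^-1%g f); first exact: ker_lt.
by rewrite /translate /= mulVg.
Qed.

(** For a fixed [h] that is nonzero at the terminus, [ker_wronskian] is a linear relation between
    the values of [f] at the two ends whose coefficients do not depend on [f]. An [f] that is
    nonzero at the origin shows that [h] is nonzero there too. *)
Lemma ker_ratio e : e \in inner G ksupp ->
  exists2 q, q != 0 & forall f g, ker f -> f (tgt G e, (g * s e)%g) = q * f (org G e, g).
Proof.
rewrite inE => /andP[oD tD].
have [h kh ht] := ksupp_at (s e) tD.
have w0 := awt_neq0 G e.
have w0' : (awt G e)^* != 0 by rewrite conjc_eq0.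
have ho : (h (org G e, 1%g))^* != 0.
  have [f kf fo] := ksupp_at 1%g oD.
  have := ker_wronskian e kf kh => eq; apply/eqP => h0; move: eq.
  rewrite h0 mul0r mulr0 => /esym/eqP; rewrite !mulf_eq0 !conjc_eq0.
  by rewrite (negPf w0) (negPf ht) (negPf fo).
exists ((awt G e)^* * (h (tgt G e, s e))^* / (awt G e * (h (org G e, 1%g))^*)).
  have ht' : (h (tgt G e, s e))^* != 0 by rewrite conjc_eq0.
  by apply: mulf_neq0; rewrite ?invr_eq0; apply: mulf_neq0.
move=> f g kf; have := ker_wronskian e (ker_lt g kf) kh.
rewrite /translate /= mulg1 => eq; apply: (mulfI (mulf_neq0 w0 ho)).
rewrite -mulrA eq mulrA [RHS]mulrA; congr (_ * _).
by rewrite mulrCA divff ?mulr1 // mulf_neq0.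
Qed.

Lemma l2_infinite (X : choiceType) (f : X -> C) (x : nat -> X) e :
  injective x -> 0 < e -> (forall n, e <= sqmod (f (x n))) -> ~ l2 f.
Proof.
move=> ix e0 ef [B fB].
have B0 : 0 <= B by have := fB [::] isT; rewrite big_nil.
pose n := (Num.truncn (B / e)).+1.
have := fB [seq x k | k <- iota 0 n]; rewrite map_inj_uniq // iota_uniq => /(_ isT).
rewrite big_map leNgt => /negP; apply.
apply: (@lt_le_trans _ _ (\sum_(k <- iota 0 n) e)); last exact: ler_sum.
rewrite big_const_seq count_predT iter_addr_0 size_iota -mulr_natr.
by rewrite mulrC -ltr_pdivrMr // truncnS_gt.
Qed.

Definition walk (p : seq E) : free_group T := foldr (fun e g => (s e * g)%g) 1%g p.

Lemma walk_ratio e p : path.path [rel e e' | tgt G e == org G e'] e p ->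
  all (fun e => e \in inner G ksupp) (e :: p) ->
  exists2 q, q != 0 & forall f g, ker f ->
    f (tgt G (last e p), (g * walk (e :: p))%g) = q * f (org G e, g).
Proof.
elim: p e => [|e' p IH] e /=.
  rewrite andbT => _ eD; have [q q0 qf] := ker_ratio eD.
  by exists q => // f g; rewrite mulg1; apply: qf.
case/andP=> /eqP te pp /andP[eD pD].
have [q q0 qf] := ker_ratio eD; have [q' q'0 q'f] := IH e' pp pD.
exists (q' * q); first by rewrite mulf_neq0.
by move=> f g kf; rewrite mulgA q'f // -te qf // mulrA.
Qed.

(* The exponent sum of x0 in g.                                               *)
Definition wcount (x0 : T) (g : free_group T) : int :=
  flift (fun x : T => (x == x0)%:R : Algebra.to_multiplicative int) g.

Lemma wcountM x0 g h : wcount x0 (g * h)%g = wcount x0 g + wcount x0 h.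
Proof. exact: (@fliftM T (Algebra.to_multiplicative int) (fun x => (x == x0)%:R) g h). Qed.

Lemma wcount1 x0 : wcount x0 1%g = 0. Proof. by []. Qed.

Lemma wcountV x0 g : wcount x0 g^-1%g = - wcount x0 g.
Proof. by apply: (addIr (wcount x0 g)); rewrite -wcountM mulVg wcount1 addNr. Qed.

Lemma wcountX x0 g n : wcount x0 (g ^+ n)%g = wcount x0 g *+ n.
Proof.
elim: n => [|n IH]; first by rewrite mulr0n wcount1.
by rewrite expgS wcountM IH mulrS.
Qed.

Lemma wcount_arc x0 e : wcount x0 (s e) =
  if (ltr e).1 == x0 then (-1) ^+ (ltr e).2 else 0.
Proof.
have -> : wcount x0 (s e) = fletter (fun x : T => (x == x0)%:R : Algebra.to_multiplicative int) (ltr e).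
  by rewrite /wcount /flift sE /= mulg1.
rewrite /fletter; case: (ltr e) => x [] /=; rewrite ?expr1 ?expr0; case: eqP => _ //.
Qed.

Lemma ltr_arev e : ltr (arev G e) = linv (ltr e).
Proof.
have : fword (s (arev G e)) = [:: linv (ltr e)] by rewrite sV /= sE.
by rewrite sE => -[].
Qed.

(** The rest of the cycle contains neither [e] nor its reverse, so the generator of [e] has exponent
    sum 1 or -1. *)
Lemma wcount_walk e p : graph_cycle G (e :: p) -> wcount (ltr e).1 (walk (e :: p)) != 0.
Proof.
move=> cp; rewrite /= wcountM wcount_arc eqxx.
have -> : wcount (ltr e).1 (walk p) = 0.
  have : {in p, forall e', (ltr e').1 != (ltr e).1}.
    have /and3P[_ up _] := cp; have /= /andP[ep _] := map_uniq up.
    have /= := cycle_arev cp (mem_head e p); rewrite inE negb_or => /andP[_ rp].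
    move=> e' e'p; apply/eqP => h.
    have [h2|h2] := eqVneq (ltr e').2 (ltr e).2.
      case/negP: ep; rewrite (_ : e = e') //; apply: ltr_inj.
      by rewrite [LHS]surjective_pairing [RHS]surjective_pairing h h2.
    case/negP: rp; rewrite (_ : arev G e = e') //; apply: ltr_inj.
    rewrite ltr_arev [RHS]surjective_pairing h /linv; congr (_, _).
    by case: (ltr e').2 h2; case: (ltr e).2.
  elim: p {cp} => [|e' p IH] ep /=; first exact: wcount1.
  rewrite wcountM wcount_arc (negPf (ep e' _)) ?mem_head // add0r.
  by apply: IH => e'' e''p; apply: ep; rewrite inE e''p orbT.
by rewrite addr0 signr_eq0.
Qed.

(** The powers of [z] are distinct, having distinct exponent sums, and [f] does not decay along
    them. *)
Lemma no_loop f v z q x0 : ker f -> f (v, 1%g) != 0 -> 1 <= sqmod q ->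
  (forall g, f (v, (g * z)%g) = q * f (v, g)) -> wcount x0 z != 0 -> False.
Proof.
move=> [lf _] fv q1 fz cz; apply: (@l2_infinite _ f (fun n => (v, (z ^+ n)%g)) (sqmod (f (v, 1%g)))).
- by move=> m n [] /(congr1 (wcount x0)); rewrite !wcountX => /(mulrIn cz).
- by rewrite sqmod_gt0.
- elim=> [|n IH]; first exact: lexx.
  rewrite expgSr fz sqmodM; apply: (le_trans IH).
  by rewrite ler_peMl // sqmod_ge0.
- exact: lf.
Qed.

(** Going once around a cycle multiplies every kernel element by the same [q]. If |q| < 1, the cycle
    is followed backwards. *)
Lemma ksupp_acyclic : acyclic G (inner G ksupp).
Proof.
move=> [//|e p] cp; apply/negP => pD.
have /and3P[_ _ /=] := cp; rewrite rcons_path => /andP[pp /andP[/eqP le _]].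
have [|q q0 qf] := @walk_ratio e p _ pD.
  by apply: (sub_path _ pp) => e1 e2 /andP[].
rewrite le in qf; set z := walk _ in qf.
have [f kf fv] : exists2 f, ker f & f (org G e, 1%g) != 0.
  by apply/ksuppP; move: pD => /= /andP[]; rewrite inE => /andP[].
have cz := wcount_walk cp; rewrite -/z in cz.
have [q1|q1] := leP 1 (sqmod q).
  by apply: (no_loop kf fv q1 _ cz) => g; apply: qf.
apply: (@no_loop f (org G e) z^-1%g q^-1 (ltr e).1) => //.
- have qq : sqmod q^-1 * sqmod q = 1 by rewrite -sqmodM mulVf // sqmod1.
  have := sqmod_ge0 q; have := sqmod_ge0 q^-1; nra.
- move=> g; apply: (mulfI q0); rewrite -qf // mulgVK mulrA divff ?mul1r //.
- by rewrite wcountV oppr_eq0.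
Qed.

(** By [rigid], a kernel element is a multiple of phi on each lift of a component, and the multiples
    form a kernel element of [boundary_op]. If the adjoint also had a kernel element, [flux_kernel]
    at a cut crossed by a single term would make a product of nonzero factors vanish. *)
Theorem kernel_certificate : has_kernel M -> certificate G theta.
Proof.
move=> [f0 [lf0 [[v0 g0] f00] Mf0]].
pose D := ksupp.
have [tau tauP _] := potential sV (@inner_arev _ _ _ G D) ksupp_acyclic.
pose U (F : V -> C) := exists2 f, ker f & F = fun v => f (v, tau v).
have U_nz v : v \in D -> exists2 F, U F & F v != 0.
  by case/(ksupp_at (tau v)) => f kf fv; exists (fun v => f (v, tau v)) => //; exists f.
have U_ratio e : e \in inner G D ->
    exists2 q, q != 0 & forall F, U F -> F (tgt G e) = q * F (org G e).
  move=> eD; have [q q0 qf] := ker_ratio eD; exists q => // _ [f kf ->].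
  by rewrite tauP // qf.
have [phi [phi0 phiU phiE]] := rigid U_nz U_ratio.
have Msum f x : ker f -> ((vwt G x.1)%:C - theta%:C) * f x +
    \sum_(e | (org G e == x.1) && (tgt G e \in D)) awt G e * f (tgt G e, (x.2 * s e)%g) = 0.
  move=> kf; have := kf.2 x; rewrite adj_shiftE => Mx; rewrite -[RHS]Mx; congr (_ + _).
  rewrite big_mkcondr; apply: eq_bigr => e _; case: ifP => // /negbT tD.
  by rewrite ker_off // mulr0.
exists D, phi; split=> //; first exact: ksupp_acyclic.
  move=> v vD; have [F [f kf ->] phiF] := phiE v vD.
  rewrite phiF // -[RHS](Msum f (v, tau v) kf) /=; congr (_ + _).
  apply: eq_bigr => e /andP[/eqP ov tD].
  have eD : e \in inner G D by rewrite inE ov vD.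
  by rewrite phiF -?(comp_root_inner eD) ?ov // tauP // ov.
pose T0 := boundary_op G D (fun e => awt G e * phi (tgt G e)) (fun e => (s e * (tau (tgt G e))^-1)%g).
(* The multiple of phi that [f] is on each lift, read at the root. *)
pose cf (f : V * free_group T -> C) : {v | v \in comp_roots G D} * free_group T -> C :=
  fun x => (phi (val x.1))^-1 * f (val x.1, (x.2 * tau (val x.1))%g).
have compsP (i : {v | v \in comp_roots G D}) : val i \in D /\ comp_root G D (val i) = val i.
  by have := valP i; rewrite inE => /andP[-> /eqP].
have lcf f : ker f -> l2 (cf f).
  move=> kf; apply: l2_rows => i; rewrite /cf /=; apply: l2_scale.
  apply: (l2_comp (h := fun g => (val i, (g * tau (val i))%g))); last exact: kf.1.
  by move=> a b /(congr1 snd)/mulIg.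
have prop f v g : ker f -> v \in D ->
    f (v, (g * tau v)%g) * phi (comp_root G D v) = f (comp_root G D v, (g * tau (comp_root G D v))%g) * phi v.
  move=> kf vD; apply: (phiU (fun v => f (v, (g * tau v)%g))) => //.
  by exists (translate g f); first exact: ker_lt.
have cfE f v g : ker f -> v \in D ->
    phi v * ext (cf f) (comp_root G D v, g) = f (v, (g * tau v)%g).
  move=> kf vD; rewrite -[comp_root G D v]/(val (exist (fun v => is_true (v \in comp_roots G D)) _ (comp_root_mem G vD))).
  rewrite extE /cf /=; have r0 : phi (comp_root G D v) != 0 by apply: phi0; rewrite comp_root_in.
  by apply: (mulfI r0); rewrite mulrCA mulVKf // mulrC -prop // mulrC.
have Tcf f : ker f -> forall x, op T0 (cf f) x = 0.
  move=> kf [j g]; rewrite boundary_opE -[RHS](Msum f (val j, g) kf) /=.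
  have jD : val j \notin D.
    by have /imsetP[e] := valP j; rewrite inE => /andP[eD _] ->.
  rewrite ker_off // mulr0 add0r; apply: eq_bigr => e /andP[_ tD].
  by rewrite -mulrA cfE // mulgA mulgVK.
have cf_nz f v g : ker f -> v \in D -> f (v, (g * tau v)%g) != 0 -> exists x, cf f x != 0.
  move=> kf vD fv; have := cfE f v g kf vD => eq; rewrite -eq in fv.
  move: fv; rewrite -[comp_root G D v]/(val (exist (fun v => is_true (v \in comp_roots G D)) _ (comp_root_mem G vD))).
  by rewrite extE mulf_eq0 negb_or => /andP[_ h]; eexists; exact: h.
rewrite -[#|boundary G D|]card_sig -[#|comp_roots G D|]card_sig.
apply: (card_of_has_kernel (T := T0)).
  have kf0 : ker f0 by [].
  have v0D : v0 \in D.
    by apply: contraNT f00 => h; rewrite ker_off.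
  exists (cf f0); split; [exact: lcf| |exact: Tcf].
  by apply: (cf_nz f0 v0 (g0 * (tau v0)^-1)%g); rewrite ?mulgVK.
move=> [h0 [lh0 [[j g] h0j] Th0]].
pose h := translate g h0.
have lh : l2 h by apply: l2_lt.
have hj : h (j, 1%g) != 0 by rewrite /h /translate /= mulg1.
have Th x : op (adj T0) h x = 0 by rewrite op_lt; apply: Th0.
have /imsetP[e0 e0b je0] := valP j.
have /andP[oD tD] : (org G e0 \notin D) && (tgt G e0 \in D) by rewrite inE in e0b.
pose k0 : eK T0 := exist (fun e => is_true (e \in cut_arcs G D)) e0 e0b.
have [f kf ft] := ksupp_at (s e0) tD.
pose chiJ (x : {v | v \in boundary G D} * free_group T) := branch e0 x.2.
pose chiI (x : {v | v \in comp_roots G D} * free_group T) := branch e0 (x.2 * tau (val x.1))%g.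
(* [e0] starts outside [D], so an inner arc is neither [e0] nor its reverse: the cut separates no
   lift of a component. *)
have chi_inner e a : e \in inner G D -> branch e0 (a * tau (tgt G e))%g = branch e0 (a * tau (org G e))%g.
  move=> eD; rewrite tauP // mulgA branch_mul //; move: eD; rewrite inE => /andP[eo et].
    by apply: contraNneq oD => -[<- _].
  apply: contraNneq oD => -[h1 _]; move: et; rewrite h1 tgt_arev.
  by [].
have chi_rt v a : branch e0 (a * tau (comp_root G D v))%g = branch e0 (a * tau v)%g.
  have /connectP[p] := connect_root (arc_rel G (inner G D)) v.
  rewrite -/(comp_root G D v); elim: p v => [|w p IH] v /=; first by move=> _ ->.
  case/andP=> /exists_inP[e eD /andP[/eqP ev /eqP ew]] pp lp.
  have rw : comp_root G D v = comp_root G D w by rewrite -ev -ew comp_root_inner.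
  by rewrite rw (IH w) -?rw // -ew chi_inner // ev.
(* The reverse of [e0] starts in [D] and so is not a term of [T0]; only [e0] itself crosses. *)
have ZP (k : eK T0) a : (k, a) \notin [:: (k0, 1%g)] ->
    chiJ (esrc k, a) = chiI (etg k, (a * es T0 k)%g).
  rewrite inE => ka; rewrite /chiJ /chiI /= chi_rt mulgA mulgVK branch_mul //.
  have := valP k; rewrite inE => /andP[kD _].
  by apply: contraNneq kD => -[h1 _]; rewrite (h1 : val k = _) org_arev.
have := @flux_kernel _ _ _ _ T0 chiI chiJ [:: (k0, 1%g)] isT ZP h (cf f) lh (lcf f kf) Th (Tcf f kf).
rewrite /flux big_seq1 /chiJ /chiI /= chi_rt mul1g mulgVK branch_arc eqxx sub0r mulN1r.
move/eqP; rewrite oppr_eq0 !mulf_eq0 conjc_eq0 (negPf (awt_neq0 G e0)) (negPf (phi0 _ tD)).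
have -> : exist (fun v => is_true (v \in boundary G D)) (org G e0) (cut_org k0) = j.
  by apply: val_inj; rewrite /= je0.
rewrite (negPf hj) /=; apply/negP.
have := cfE f (tgt G e0) (s e0 * (tau (tgt G e0))^-1)%g kf tD; rewrite mulgVK => eq.
move: ft; rewrite -eq -[comp_root G D (tgt G e0)]/(val (exist (fun v => is_true (v \in comp_roots G D)) _ (cut_tgt k0))).
by rewrite extE mulf_eq0 negb_or /cf /= mulf_eq0 => /andP[].
Qed.

End UniversalKernel.

(** * The maximal abelian cover *)

Section RowSpaceBound.
Variable R : realType.
Local Notation C := R[i].

Lemma unitary_sum_sqmod m n (U : 'M[C]_(m, n)) : U \is unitarymx ->
  forall i, \sum_j sqmod (U i j) = 1.
Proof.
move=> /unitarymxP UU i; have := congr1 (fun A : 'M[C]_m => A i i) UU.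
rewrite !mxE eqxx /= => h; apply: complexI; rewrite rmorph_sum -[RHS]h.
by apply: eq_bigr => j _; rewrite /= sqmodE mulrC !mxE.
Qed.

Lemma unitary_mul_sqmod m n (U : 'M[C]_(m, n)) (a : 'rV[C]_m) : U \is unitarymx ->
  \sum_j sqmod ((a *m U) 0 j) = \sum_i sqmod (a 0 i).
Proof.
move=> /unitarymxP UU.
have key p (b : 'rV[C]_p) : (\sum_j sqmod (b 0 j))%:C = (b *m (map_mx Num.conj b^T)) 0 0.
  rewrite rmorph_sum !mxE; apply: eq_bigr => j _.
  by rewrite /= sqmodE mulrC !mxE.
apply: complexI; rewrite !key trmx_mul map_mxM /= mulmxA.
by rewrite -(mulmxA a) UU mulmx1.
Qed.

(* p x is the squared norm of the projection to W of the point mass at x, so  *)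
(* that the sum of p is a trace.                                              *)
Lemma row_space_bound n (W : 'M[C]_n) : exists p : 'I_n -> R,
  [/\ forall x, 0 <= p x, \sum_x p x = (\rank W)%:R
    & forall q : 'rV[C]_n, (q <= W)%MS ->
      forall x, sqmod (q 0 x) <= (\sum_y sqmod (q 0 y)) * p x].
Proof.
pose U := schmidt (row_base W).
have UU : U \is unitarymx by apply: schmidt_unitarymx; apply: rank_leq_row.
exists (fun x => \sum_i sqmod (U i x)); split.
- by move=> x; apply: sumr_ge0 => i _; apply: sqmod_ge0.
- rewrite exchange_big /=; under eq_bigr do rewrite unitary_sum_sqmod //.
  by rewrite sumr_const card_ord.
move=> q qW x; have /submxP[a ->] : (q <= U)%MS.
  by rewrite (eqmx_schmidt_free (row_base_free W)) eq_row_base.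
rewrite unitary_mul_sqmod // mxE.
have := cauchy_schwarz (index_enum 'I_(\rank W)) (fun i => (a 0 i)^*) (fun i => U i x).
under eq_bigr do rewrite conjcK.
by under [X in _ <= X * _ -> _]eq_bigr do rewrite sqmodJ.
Qed.

(* When the equations indexed by int are independent, their solution space    *)
(* has the dimension of the complement of int.                                *)
Lemma constraint_bound (X : finType) (a : X -> X -> C) (int : {set X}) :
  (forall phi : X -> C, (forall y, y \notin int -> phi y = 0) ->
    (forall x, \sum_y phi y * a y x = 0) -> forall y, phi y = 0) ->
  exists p : X -> R,
  [/\ forall x, 0 <= p x, \sum_x p x <= #|~: int|%:R
    & forall q : X -> C, (forall y, y \in int -> \sum_x a y x * q x = 0) ->
      forall x, sqmod (q x) <= (\sum_y sqmod (q y)) * p x].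
Proof.
move=> inj_a; pose ev := @enum_val X X.
have bev (A : nmodType) (F : X -> A) : \sum_x F x = \sum_i F (ev i).
  by rewrite (reindex ev) //; apply: onW_bij; apply: enum_val_bij.
pose A : 'M[C]_#|X| := \matrix_(i, j) (if ev i \in int then a (ev i) (ev j) else 0).
have [p [p0 psum pW]] := row_space_bound (kermx A^T).
(* [A] is square, so both its kernels have the same dimension. By [inj_a], a row vector killed by
   [A] vanishes on [int], hence lies in the span of the other coordinates. *)
have rk : (\rank (kermx A^T) <= #|~: int|)%N.
  rewrite mxrank_ker mxrank_tr -mxrank_ker.
  pose S : 'M[C]_(#|~: int|, #|X|) := \matrix_(k, j) (enum_val k == ev j)%:R.
  apply: leq_trans (rank_leq_row S); apply: mxrankS.
  apply/row_subP => r; apply/submxP.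
  pose phi y := if y \in int then row r (kermx A) 0 (enum_rank y) else 0.
  have phi0 y : phi y = 0.
    apply: inj_a => [z /negPf zi|x]; first by rewrite /phi zi.
    have : (row r (kermx A) *m A) 0 (enum_rank x) = 0.
      by rewrite -row_mul mulmx_ker row0 mxE.
    rewrite mxE bev => rA; rewrite -[RHS]rA; apply: eq_bigr => i _; rewrite /phi [A _ _]mxE /ev.
    by rewrite enum_valK enum_rankK; case: ifP; rewrite ?mul0r ?mulr0.
  exists (\row_k row r (kermx A) 0 (enum_rank (enum_val k))).
  apply/rowP => j; rewrite [RHS]mxE.
  have [jS|jS] := boolP (ev j \in ~: int).
    rewrite (bigD1 (enum_rank_in jS (ev j))) //= big1 => [|k kj]; last first.
      rewrite !mxE; case: eqP => [h|]; last by rewrite mulr0.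
      by case/eqP: kj; apply: enum_val_inj; rewrite enum_rankK_in.
    by rewrite addr0 !mxE enum_rankK_in // eqxx mulr1 /ev enum_valK.
  rewrite big1 => [|k _].
    have := phi0 (ev j); rewrite /phi /ev enum_valK.
    by rewrite inE negbK in jS; rewrite jS.
  rewrite !mxE; case: eqP => [h|]; last by rewrite mulr0.
  by rewrite -h enum_valP in jS.
exists (p \o enum_rank); split=> [x||q qP x]; first exact: p0.
  rewrite bev /= /ev; under eq_bigr do rewrite enum_valK.
  by rewrite psum ler_nat.
pose q' : 'rV[C]_#|X| := \row_j q (ev j).
have qW : (q' <= kermx A^T)%MS.
  apply/sub_kermxP/rowP => i; rewrite !mxE.
  have [iI|iI] := boolP (ev i \in int).
    rewrite -[RHS](qP _ iI) bev; apply: eq_bigr => j _.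
    by rewrite !mxE iI mulrC.
  by rewrite big1 // => j _; rewrite !mxE (negPf iI) mulr0.
have := pW q' qW (enum_rank x); rewrite mxE /ev enum_rankK bev.
by under eq_bigr do rewrite mxE.
Qed.

End RowSpaceBound.

(** * Amenability: a finitely supported eigenfunction *)

Section Folner.
Variables (R : realType) (V E : finType) (G : wgraph R V E) (theta : R).
Local Notation C := R[i].
Local Notation ZE := (Algebra.to_multiplicative {ffun E -> int}).
Local Notation M := (adj_shift G (@arc_vec _ _ _ G) theta).

Lemma zeM (g h : ZE) e : (g * h)%g e = g e + h e.
Proof. exact: ffunE. Qed.

Lemma zeV (g : ZE) e : (g^-1)%g e = - g e.
Proof. exact: ffunE. Qed.

Lemma ze1 e : (1%g : ZE) e = 0.
Proof. exact: ffunE. Qed.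

Lemma step_small (k : eK M) e : -1 <= es M k e <= 1.
Proof.
case: k => [v|a] /=; first by rewrite ze1.
by rewrite ffunE; case: (e == a); case: (e == arev G a).
Qed.

Definition pt_mass (X : choiceType) (x : X) : X -> C := fun z => (z == x)%:R.

Lemma fin_supp_pt_mass (X : choiceType) (x : X) : fin_supp (pt_mass x).
Proof. by exists [:: x] => z; rewrite inE /pt_mass => /negPf->. Qed.

Lemma op_pt_mass_sym (x y : V * ZE) : op M (pt_mass x) y = (op M (pt_mass y) x)^*.
Proof.
have l : iprod (pt_mass y) (op M (pt_mass x)) = op M (pt_mass x) y.
  rewrite /iprod (fin_sum_pt (x := y)) => [|z /negPf zy]; rewrite /pt_mass.
    by rewrite eqxx conjc1 mul1r.
  by rewrite zy conjc0 mul0r.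
rewrite -l adjoint; last exact: fin_supp_pt_mass.
rewrite adj_shift_adj; last exact: arc_vecV.
rewrite /iprod (fin_sum_pt (x := x)) => [|z /negPf zx]; first by rewrite /pt_mass eqxx mulr1.
by rewrite {2}/pt_mass zx mulr0.
Qed.

Section Box.
Variable n : nat.
Local Notation box := {ffun E -> 'I_n.+2}.

Definition emb (l : box) : ZE := [ffun e => (l e : nat)%:Z].
Definition pt (x : V * box) : V * ZE := (x.1, emb x.2).
(** Coordinates between 1 and n, in a box with coordinates from 0 to n + 1: by [step_small], an
    equation at such a point involves only the box. *)
Definition box_int : {set V * box} := [set x : V * box | [forall e, 0 < (x.2 e : nat) < n.+1]%N].

Lemma pt_inj : injective pt.
Proof.
move=> [v l] [w m] [-> /ffunP h]; congr (_, _); apply/ffunP => e; apply: val_inj.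
by have := h e; rewrite !ffunE => -[].
Qed.

Lemma int_nbr (x : V * box) (w : V) (d : ZE) : x \in box_int ->
  (forall e, -1 <= d e <= 1) -> exists z, pt z = (w, ((pt x).2 * d)%g).
Proof.
rewrite inE => /forallP xi dP.
have /fin_all_exists[m mP] e : exists i : 'I_n.+2, (i : nat)%:Z = (x.2 e : nat)%:Z + d e.
  have := xi e; have := dP e; case: (d e) => [[|[|k]]|[|k]] //= _ /andP[x0 xn].
  - by exists (x.2 e); rewrite addr0.
  - have h : ((x.2 e).+1 < n.+2)%N by [].
    by exists (Ordinal h); rewrite /= -addn1 PoszD.
  - have h : ((x.2 e).-1 < n.+2)%N by apply: leq_ltn_trans (leq_pred _) (ltn_ord _).
    by exists (Ordinal h) => /=; move: (nat_of_ord (x.2 e)) x0 => i i0; lia.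
exists (w, [ffun e => m e]); congr (_, _); apply/ffunP => e.
by rewrite zeM /= !ffunE mP.
Qed.

Lemma box_sum (f : V * ZE -> C) (y : V * box) : y \in box_int ->
  \sum_x op M (pt_mass (pt x)) (pt y) * f (pt x) = op M f (pt y).
Proof.
move=> yi; rewrite /op.
under eq_bigr do rewrite mulr_suml; rewrite exchange_big.
apply: eq_bigr => k _.
have [z zE] := int_nbr (etg k) yi (step_small k).
rewrite (bigD1 z) //= big1 ?addr0 => [|x xz].
  by rewrite zE /pt_mass eqxx mulr1.
by rewrite -zE /pt_mass (inj_eq pt_inj) eq_sym (negPf xz) mulr0 mul0r.
Qed.

Lemma box_off (y : V * box) z : y \in box_int ->
  (forall x, pt x != z) -> op M (pt_mass (pt y)) z = 0.
Proof.
move=> yi zX; rewrite /op big1 // => k /eqP kz; rewrite /pt_mass.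
case: eqP => [[h1 h2]|_]; last by rewrite mulr0.
have [x xE] : exists x, pt x = (z.1, ((pt y).2 * (es M k)^-1)%g).
  apply: int_nbr => // e; have := step_small k e; rewrite zeV.
  by rewrite lerN2 lerNl andbC.
case/eqP: (zX x); rewrite xE /= -h2 mulgK; by case: (z).
Qed.

Lemma card_int : (#|V| * n ^ #|E| <= #|box_int|)%N.
Proof.
have -> : (#|V| * n ^ #|E| = #|{: V * {ffun E -> 'I_n}}|)%N.
  by rewrite card_prod card_ffun card_ord.
have h (i : 'I_n) : (i.+1 < n.+2)%N by rewrite ltnS ltnW // ltnS ltn_ord.
pose sh (x : V * {ffun E -> 'I_n}) : V * box := (x.1, [ffun e => Ordinal (h (x.2 e))]).
have ish : injective sh.
  move=> [v l] [w m] [-> /ffunP lm]; congr (_, _); apply/ffunP => e; apply: val_inj.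
  by have := lm e; rewrite !ffunE => -[].
rewrite -(card_imset _ ish); apply: subset_leq_card; apply/fintype.subsetP => _ /imsetP[x _ ->].
by rewrite inE; apply/forallP => e; rewrite ffunE /= ltnS ltn_ord.
Qed.

End Box.

(** Bernoulli's inequality (1 - 2 / (n + 2))^d >= 1 - 2 d / (n + 2), cleared of denominators. *)
Lemma box_growth n d : ((n + 2) * (n + 2) ^ d <= (n + 2) * n ^ d + 2 * d * (n + 2) ^ d)%N.
Proof.
elim: d => [|d IH]; first by rewrite !expn0 muln0 mul0n addn0.
have := leq_mul (leqnn (n + 2)) IH; have : (n ^ d <= (n + 2) ^ d)%N.
  by case: d {IH} => // d; rewrite leq_exp2r ?leq_addr.
rewrite !expnS; move: (n ^ d)%N ((n + 2) ^ d)%N => a b; nia.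
Qed.

(* Otherwise, by constraint_bound, the solutions of the equations inside a    *)
(* box of side n + 2 form a space of dimension O((n + 2)^(|E| - 1)). The (n + *)
(* 2)^|E| translates of an eigenfunction restrict to such solutions of        *)
(* bounded norm, so averaging over the box makes f (v0, 1) arbitrarily small. *)
Theorem finite_kernel : has_kernel M ->
  exists f : V * ZE -> C, [/\ fin_supp f, exists x, f x != 0 & forall x, op M f x = 0].
Proof.
move=> [f0 [lf0 [[v0 g0] f00] Mf0]]; apply: contrapT => nofs.
pose f := translate g0 f0.
have [B fB] : l2 f by apply: l2_lt.
have fv : f (v0, 1%g) != 0 by rewrite /f /translate /= mulg1.
have Mf x : op M f x = 0 by rewrite op_lt; apply: Mf0.
have B0 : 0 <= B by have := fB [::] isT; rewrite big_nil.
have key n : sqmod (f (v0, 1%g)) * (n + 2)%:R <= B * #|V|%:R * (2 * #|E|)%:R.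
  pose box := {ffun E -> 'I_n.+2}.
  (* A dependency among the equations at interior points is, after conjugation, a finitely supported
     kernel element, because the operator is Hermitian; [nofs] excludes it. *)
  have [phi phi0 phiM|p [p0 pS pq]] := @constraint_bound R (V * box)%type
    (fun y x => op M (pt_mass (pt x)) (pt y)) (box_int n).
    pose c : V * ZE -> C := fun z => \sum_y (phi y)^* * pt_mass (pt y) z.
    have cE y : c (pt y) = (phi y)^*.
      rewrite /c (bigD1 y) //= big1 ?addr0 => [|x xy]; rewrite /pt_mass ?eqxx ?mulr1 //.
      by rewrite (inj_eq (@pt_inj n)) eq_sym (negPf xy) mulr0.
    move=> y; apply/eqP; apply: contrapT => /negP py; apply: nofs; exists c; split.
    - apply: fin_supp_sum => x; apply: eq_fin_supp (fin_supp_pt_mass (pt x)) => z ->; exact: mulr0.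
    - by exists (pt y); rewrite cE conjc_eq0.
    move=> z; rewrite /c (op_sum M xpredT).
    have [[x <-]|nx] := pselect (exists x : V * box, pt x = z).
      rewrite -[RHS]conjc0 -[in RHS](phiM x) rmorph_sum; apply: eq_bigr => w _.
      by rewrite rmorphM /= [op M (pt_mass (pt w)) _]op_pt_mass_sym.
    rewrite big1 // => w _; have [wi|wi] := boolP (w \in box_int n).
      rewrite box_off ?mulr0 // => x; apply/eqP => h; apply: nx; by exists x.
    by rewrite phi0 // conjc0 mul0r.
  pose L := ((n + 2) ^ #|E|)%N.
  have cardX : #|{: V * box}| = (#|V| * L)%N by rewrite card_prod card_ffun card_ord /L addn2.
  (* [pq] for the translate of [f] that carries its value at 1 to [l]. *)
  have h1 (l : box) : sqmod (f (v0, 1%g)) <= B * p (v0, l).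
    pose q (x : V * box) := translate (emb l)^-1%g f (pt x).
    have ql : q (v0, l) = f (v0, 1%g) by exact: (congr1 (fun g => f (v0, g)) (mulVg (emb l))).
    rewrite -ql; apply: (le_trans (pq q _ (v0, l))) => [y yi|].
      by rewrite box_sum // op_lt; apply: Mf.
    apply: ler_wpM2r => //.
    have := fB [seq (x.1, ((emb l)^-1 * emb x.2)%g) | x <- index_enum (V * box)%type].
    rewrite big_map; apply; rewrite map_inj_uniq ?index_enum_uniq //.
    move=> [v k] [w m] [-> /mulgI h2]; apply: (@pt_inj n); by rewrite /pt h2.
  (* Sum of [h1] over the box; the sum of [p] is at most the number of points that are not
     interior. *)
  have h2 : sqmod (f (v0, 1%g)) * L%:R <= B * (#|V| * (L - n ^ #|E|))%:R.
    have -> : sqmod (f (v0, 1%g)) * L%:R = \sum_(l : box) sqmod (f (v0, 1%g)).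
      by rewrite sumr_const card_ffun card_ord -addn2 mulr_natr.
    apply: (le_trans (ler_sum _ (fun l _ => h1 l))); rewrite -mulr_sumr ler_wpM2l //.
    apply: (@le_trans _ _ (\sum_x p x)).
      rewrite (eq_bigr (fun x => p (x.1, x.2))) => [|[] //].
      rewrite -(pair_bigA _ (fun v l => p (v, l))) /= [leRHS](bigD1 v0) //= lerDl.
      by apply: sumr_ge0 => v _; apply: sumr_ge0.
    apply: (le_trans pS); rewrite ler_nat cardsCs finset.setCK cardX mulnBr leq_sub2l //.
    exact: card_int.
  have L0 : 0 < (L%:R : R) by rewrite ltr0n expn_gt0 addn2.
  rewrite -(ler_pM2r L0) mulrAC.
  apply: (le_trans (ler_wpM2r (ler0n _ _) h2)).
  rewrite -!mulrA ler_wpM2l // -!natrM ler_nat -!mulnA leq_mul2l.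
  have := box_growth n #|E|; rewrite -/L => hb; apply/orP; right; nia.
pose a := sqmod (f (v0, 1%g)); have a0 : 0 < a by rewrite sqmod_gt0.
pose K := B * #|V|%:R * (2 * #|E|)%:R.
have := key (Num.truncn (K / a)); rewrite leNgt => /negP; apply.
rewrite -/K mulrC -ltr_pdivrMr //.
by apply: (lt_le_trans (truncnS_gt _)); rewrite ler_nat addn2 leqnSn.
Qed.

End Folner.

(** * Fourier transform on the torus *)

Section Circle.
Variable R : realType.
Local Notation C := R[i].

Lemma unit_neq0 (z : C) : sqmod z = 1 -> z != 0.
Proof. by move=> z1; rewrite -sqmod_eq0 z1 oner_neq0. Qed.

Lemma unit_conj (z : C) : sqmod z = 1 -> z^* = z^-1.
Proof.
move=> z1; apply: (mulIf (unit_neq0 z1)); rewrite mulVf ?unit_neq0 //.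
by rewrite -sqmodE z1.
Qed.

Lemma sqmodV (z : C) : sqmod z^-1 = (sqmod z)^-1.
Proof.
have [->|z0] := eqVneq z 0; first by rewrite invr0 sqmod0 invr0.
have nz : sqmod z != 0 by rewrite sqmod_eq0.
by apply: (mulfI nz); rewrite -sqmodM !divff // sqmod1.
Qed.

Lemma sqmod_exprz (z : C) (k : int) : sqmod z = 1 -> sqmod (z ^ k) = 1.
Proof.
have pos n : sqmod z = 1 -> sqmod (z ^+ n) = 1.
  by move=> z1; elim: n => [|n IH]; rewrite ?expr0 ?sqmod1 // exprS sqmodM z1 IH mulr1.
by case: k => n z1; rewrite ?NegzE -?exprnP -?exprnN ?sqmodV pos ?invr1.
Qed.

(** The rational parametrisation of the circle at the natural numbers gives infinitely many points,
    distinct by their real parts. *)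
Lemma circle_avoid (l : seq C) : exists2 z : C, sqmod z = 1 & z \notin l.
Proof.
pose d (n : nat) : R := n%:R ^+ 2 + 1.
have d0 n : 0 < d n by rewrite ltr_wpDl ?sqr_ge0.
have dn n : d n != 0 by rewrite gt_eqF.
pose c (n : nat) : C := Complex (1 - 2 / d n) (2 * n%:R / d n).
have ci : injective c.
  move=> m n [] /eqP; rewrite (inj_eq (addrI _)) eqr_opp => /eqP.
  move/(mulfI (_ : 2 != 0 :> R)); rewrite pnatr_eq0 => /(_ isT)/invr_inj/addIr.
  by move/eqP; rewrite eqrXn2 ?ler0n // eqr_nat => /eqP.
have c1 n : sqmod (c n) = 1.
  rewrite /sqmod /c /=; have := dn n; rewrite /d => h; field; exact: h.
have := @uniq_leq_size _ [seq c k | k <- iota 0 (size l).+1] l.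
rewrite map_inj_uniq // iota_uniq size_map size_iota => /(_ isT) h.
have : ~~ all (mem l) [seq c k | k <- iota 0 (size l).+1].
  by apply/negP => /allP /h; rewrite ltnn.
by case/allPn => z /mapP[k _ ->] kl; exists (c k).
Qed.

Lemma poly_roots_finite (p : {poly C}) : p != 0 ->
  exists l : seq C, forall z, root p z -> z \in l.
Proof.
move=> p0; have [l pE] := closed_field_poly_normal p.
exists l => z; rewrite pE rootZ ?lead_coef_eq0 // root_prod_XsubC.
by [].
Qed.

Lemma circle_exprz_neq (m k : int) : m != k -> exists2 z : C, sqmod z = 1 & z ^ m != z ^ k.
Proof.
move=> mk; wlog km : m k mk / k < m.
  move=> H; case: (ltgtP k m) => [km|mk'|kE]; first exact: H.
    by have [|z z1 h] := H k m _ mk'; [rewrite eq_sym | exists z => //; rewrite eq_sym].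
  by rewrite kE eqxx in mk.
pose n := `|m - k|%N.
have n0 : (0 < n)%N by rewrite absz_gt0 subr_eq0.
have nE : m = k + n%:Z by rewrite /n gez0_abs ?subr_ge0 ?(ltW km) // addrCA subrr addr0.
have p0 : 'X^n - 1 != 0 :> {poly C} by rewrite -size_poly_gt0 size_XnsubC.
have [l lP] := poly_roots_finite p0.
have [z z1 zl] := circle_avoid l; exists z => //; rewrite nE expfzDr ?unit_neq0 //.
apply: contraNneq zl => h; apply: lP; rewrite /root !hornerE subr_eq0.
have zk : z ^ k != 0 by rewrite expfz_neq0 ?unit_neq0.
by apply/eqP; apply: (mulfI zk); rewrite mulr1.
Qed.

End Circle.

Section Characters.
Variables (R : realType) (E : finType).
Local Notation C := R[i].
Local Notation ZE := (Algebra.to_multiplicative {ffun E -> int}).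
Implicit Types (x y : E -> C) (g h : ZE).

Definition circ x := forall e, sqmod (x e) = 1.

Definition chr x h : C := \prod_e (x e) ^ (- h e).

Definition upd x e s : E -> C := fun a => if a == e then s else x a.

Lemma circ_upd x e s : circ x -> sqmod s = 1 -> circ (upd x e s).
Proof. by move=> cx s1 a; rewrite /upd; case: ifP. Qed.

Lemma upd_id x e : upd x e (x e) = x.
Proof. by apply/funext => a; rewrite /upd; case: eqP => // ->. Qed.

Lemma chrM x g h : circ x -> chr x (g * h)%g = chr x g * chr x h.
Proof.
move=> cx; rewrite /chr -big_split; apply: eq_bigr => e _.
by rewrite zeM opprD expfzDr // unit_neq0.
Qed.

Lemma chr1 x : chr x 1%g = 1.
Proof. by rewrite /chr big1 // => e _; rewrite ze1 oppr0 expr0z. Qed.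

Lemma sqmod_chr x h : circ x -> sqmod (chr x h) = 1.
Proof.
move=> cx; rewrite /chr; elim/big_ind: _ => [|a b ha hb|e _].
- exact: sqmod1.
- by rewrite sqmodM ha hb mulr1.
- exact: sqmod_exprz.
Qed.

Lemma chr_neq0 x h : circ x -> chr x h != 0.
Proof. by move=> cx; apply/unit_neq0/sqmod_chr. Qed.

Lemma chrV x h : circ x -> chr x h^-1%g = (chr x h)^-1.
Proof.
move=> cx; apply: (mulIf (chr_neq0 h cx)).
by rewrite -chrM // mulVg chr1 mulVf // chr_neq0.
Qed.

Lemma chr_mul x y h : chr (fun e => x e * y e) h = chr x h * chr y h.
Proof. by rewrite /chr -big_split; apply: eq_bigr => e _; rewrite expfzMl. Qed.

Lemma chr_upd x e s h :
  chr (upd x e s) h = s ^ (- h e) * \prod_(a | a != e) (x a) ^ (- h a).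
Proof.
rewrite /chr (bigD1 e isT) {1}/upd eqxx; congr (_ * _).
by apply: eq_bigr => a /negPf ae; rewrite /upd ae.
Qed.

Lemma chr_separate g h : g != h -> exists2 x, circ x & chr x g != chr x h.
Proof.
move=> gh; have [e he] : exists e, (g : {ffun E -> int}) e != (h : {ffun E -> int}) e.
  by apply: contrapT => ne; case/eqP: gh; apply/ffunP => e; apply/eqP/negPn/negP => he; apply: ne; exists e.
have [|s s1 sn] := @circle_exprz_neq R (- g e) (- h e); first by rewrite eqr_opp.
exists (upd (fun=> 1) e s); first by apply: circ_upd => // a; exact: sqmod1.
have one k : \prod_(a | a != e) (1 : C) ^ (- k a) = 1.
  by rewrite big1 // => a _; rewrite exp1rz.
by rewrite !chr_upd !one !mulr1.
Qed.

(** Artin's argument, with group elements as characters of the torus: the relation at x y minus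
    [chr y h0] times the relation at x no longer contains [h0]. *)
Lemma chr_independent (r : seq ZE) (c : ZE -> C) : uniq r ->
  (forall x, circ x -> \sum_(h <- r) c h * chr x h = 0) -> {in r, forall h, c h = 0}.
Proof.
elim: r c => // h0 r IH c /= /andP[h0r ur] cz.
have tail : {in r, forall h, c h = 0}.
  move=> h hr; have h0h : h0 != h by apply: contraNneq h0r => ->.
  have [y cy yh] := chr_separate h0h.
  have := IH (fun h => c h * (chr y h - chr y h0)) ur _ h hr => /= H.
  apply/eqP; have /eqP : c h * (chr y h - chr y h0) = 0.
    apply: H => x cx.
    have := cz (fun e => x e * y e); rewrite big_cons chr_mul => H1.
    have := cz x cx; rewrite big_cons => H2.
    have cxy : circ (fun e => x e * y e) by move=> e; rewrite sqmodM cx cy mulr1.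
    have {}H1 := H1 cxy.
    transitivity ((c h0 * (chr x h0 * chr y h0) + \sum_(j <- r) c j * chr (fun e => x e * y e) j)
       - chr y h0 * (c h0 * chr x h0 + \sum_(j <- r) c j * chr x j)).
      rewrite mulrDr mulr_sumr opprD addrACA [X in X + _](_ : _ = 0) ?add0r; last by ring.
      by rewrite -sumrB; apply: eq_bigr => j _; rewrite chr_mul; ring.
    by rewrite H1 H2 mulr0 subr0.
  by rewrite mulf_eq0 subr_eq0 [chr y h == _]eq_sym (negPf yh) orbF.
move=> h; rewrite inE => /orP[/eqP->|]; last exact: tail.
have := cz (fun=> 1) (fun _ => sqmod1 R); rewrite big_cons.
rewrite big1_seq ?addr0 => [|j /andP[_ jr]]; last by rewrite tail // mul0r.
by move/eqP; rewrite mulf_eq0 (negPf (chr_neq0 _ (fun _ => sqmod1 R))) orbF => /eqP.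
Qed.

Definition fourier (c : ZE -> C) x : C := fin_sum (fun h => c h * chr x h).

Lemma fourier_neq0 (c : ZE -> C) h : fin_supp c -> c h != 0 -> exists2 x, circ x & fourier c x != 0.
Proof.
move=> /fin_suppP[r ur rc] ch; apply: contrapT => no.
case/eqP: ch; have [hr|/rc //] := boolP (h \in r).
apply: (chr_independent ur) => // x cx; apply/eqP/negPn/negP => cn; apply: no.
by exists x => //; rewrite /fourier (fin_sumE ur) // => j /rc ->; rewrite mul0r.
Qed.

(** In the coordinate [e] alone, the transform times a power of [s] is a polynomial, nonzero at
    [x e], hence with finitely many roots. *)
Lemma fourier_upd (c : ZE -> C) x e : fin_supp c -> circ x -> fourier c x != 0 ->
  exists l : seq C, forall s, sqmod s = 1 -> s \notin l -> fourier c (upd x e s) != 0.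
Proof.
move=> /fin_suppP[r ur rc] cx cn.
pose w h := c h * \prod_(a | a != e) (x a) ^ (- h a).
pose L := (\sum_(h <- r) `|h e|)%N.
have Lh h : h \in r -> h e <= L%:Z.
  move=> hr; apply: (@le_trans _ _ `|h e|%N%:Z); first by rewrite abszE ler_norm.
  by rewrite lez_nat /L (bigD1_seq h) //= leq_addr.
pose p : {poly C} := \sum_(h <- r) w h *: 'X^(`|L%:Z - h e|%N).
have pE s : sqmod s = 1 -> p.[s] = s ^+ L * fourier c (upd x e s).
  move=> s1; rewrite /fourier (fin_sumE ur) => [|h /rc->]; last by rewrite mul0r.
  rewrite /p horner_sum mulr_sumr !big_seq; apply: eq_bigr => h hr.
  rewrite hornerZ hornerXn chr_upd /w [RHS](_ : _ = s ^+ L * s ^ (- h e) * (c h * \prod_(a | a != e) (x a) ^ (- h a))); last by ring.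
  have -> : s ^+ `|L%:Z - h e|%N = s ^+ L * s ^ (- h e).
    rewrite (exprnP s L) -expfzDr ?unit_neq0 // exprnP gez0_abs //.
    by rewrite subr_ge0 Lh.
  by rewrite mulrC.
have p0 : p != 0.
  apply: contraNneq cn => p0; have := pE (x e) (cx e); rewrite p0 horner0 upd_id => /esym/eqP.
  by rewrite mulf_eq0 expf_eq0 (negPf (unit_neq0 (cx e))) andbF.
have [l lP] := poly_roots_finite p0; exists l => s s1; apply: contraNneq => s0.
by apply: lP; rewrite /root pE // s0 mulr0.
Qed.

Lemma common_upd (K : eqType) (ks : seq K) (c : K -> ZE -> C) x e :
  (forall k, fin_supp (c k)) -> circ x -> (forall k, k \in ks -> fourier (c k) x != 0) ->
  exists l : seq C, forall s, sqmod s = 1 -> s \notin l ->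
    forall k, k \in ks -> fourier (c k) (upd x e s) != 0.
Proof.
move=> fc cx; elim: ks => [|j js IHj] uP; first by exists [::] => s _ _ k; rewrite in_nil.
have [|l1 l1P] := IHj; first by move=> i ijs; apply: uP; rewrite inE ijs orbT.
have [l2 l2P] := fourier_upd e (fc j) cx (uP j (mem_head _ _)).
exists (l1 ++ l2) => s s1; rewrite mem_cat negb_or => /andP[sl1 sl2] i.
by rewrite inE => /orP[/eqP->|ijs]; [apply: l2P | apply: l1P].
Qed.

(** A point [x] good for [ks] and a point [y] good for [k] are made equal by setting one coordinate
    after the other to a common value outside finitely many exceptions. *)
Lemma common_point (K : eqType) (ks : seq K) (c : K -> ZE -> C) :
  (forall k, fin_supp (c k)) -> (forall k, k \in ks -> exists h, c k h != 0) ->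
  exists2 x, circ x & forall k, k \in ks -> fourier (c k) x != 0.
Proof.
move=> fc; elim: ks => [|k ks IH] nz.
  by exists (fun=> 1) => // e; exact: sqmod1.
have [j jks|x cx xP] := IH; first by apply: nz; rewrite inE jks orbT.
have [h ch] := nz k (mem_head _ _); have [y cy yP] := fourier_neq0 (fc k) ch.
suff [z [cz z1 z2]] : exists z, [/\ circ z, forall k, k \in ks -> fourier (c k) z != 0 & fourier (c k) z != 0].
  exists z; first exact: cz.
  by move=> j; rewrite inE => /orP[/eqP->|/z1]; first exact: z2.
have agree (es : seq E) : exists u, exists v, [/\ circ u /\ circ v,
    forall k, k \in ks -> fourier (c k) u != 0, fourier (c k) v != 0 & {in es, u =1 v}].
  elim: es => [|e es [u [v [[cu cv] uP vP uv]]]]; first by exists x, y.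
  have [l1 l1P] := common_upd e fc cu uP; have [l2 l2P] := fourier_upd e (fc k) cv vP.
  have [s s1] := circle_avoid (l1 ++ l2); rewrite mem_cat negb_or => /andP[sl1 sl2].
  exists (upd u e s), (upd v e s); split.
  - by split; apply: circ_upd.
  - exact: l1P.
  - exact: l2P.
  - by move=> a; rewrite inE /upd; case: eqP => //= _; apply: uv.
have [u [v [[cu cv] uP vP uv]]] := agree (enum E).
have uvE : u = v by apply/funext => e; apply: uv; rewrite mem_enum.
by exists u; split; [exact: cu | exact: uP | rewrite uvE; exact: vP].
Qed.

End Characters.

(** * Equations twisted by phases on the finite graph *)

Section TwistedEquation.
Variables (R : realType) (V E : finType) (G : wgraph R V E) (theta : R).
Local Notation C := R[i].
Implicit Types (X : E -> C) (F H : V -> C).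

Definition twisted X F := forall v, ((vwt G v)%:C - theta%:C) * F v +
  \sum_(a | org G a == v) awt G a * X a * F (tgt G a) = 0.

(** Green's formula: the equation of F paired with conj H, minus the conjugate equation of H paired
    with F, where the vertex terms cancel. *)
Lemma twisted_wronskian X X' F H :
  (forall a, X' (arev G a) = (X' a)^*) -> twisted X F -> twisted X' H ->
  \sum_a (X a - X' a) * (awt G a * ((H (org G a))^* * F (tgt G a))) = 0.
Proof.
move=> X'J tF tH.
have HF : \sum_v ((vwt G v)%:C - theta%:C) * ((H v)^* * F v) +
    \sum_a X a * (awt G a * ((H (org G a))^* * F (tgt G a))) = 0.
  rewrite -(sum_fiber (org G) (fun v a => X a * (awt G a * ((H v)^* * F (tgt G a))))).
  rewrite -big_split /= big1 // => v _.
  rewrite -[RHS](mulr0 (H v)^*) -[in RHS](tF v) mulrDr mulr_sumr; congr (_ + _).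
    by ring.
  by apply: eq_bigr => a _; ring.
have FH : \sum_v ((vwt G v)%:C - theta%:C) * ((H v)^* * F v) +
    \sum_a X' a * (awt G a * ((H (org G a))^* * F (tgt G a))) = 0.
  rewrite (reindex_inj (can_inj (@arevK _ _ _ G))) /=.
  under [X in _ + X]eq_bigr do rewrite org_arev tgt_arev X'J awt_arev.
  rewrite -(sum_fiber (org G) (fun v a => (X' a)^* * ((awt G a)^* * ((H (tgt G a))^* * F v)))).
  rewrite -big_split /= big1 // => v _.
  have Hv : (((vwt G v)%:C - theta%:C) * H v +
      \sum_(a | org G a == v) awt G a * X' a * H (tgt G a))^* * F v = 0.
    by rewrite tH conjc0 mul0r.
  rewrite -[RHS]Hv rmorphD rmorph_sum /= [in RHS]mulrDl.
  rewrite mulr_suml; congr (_ + _).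
    rewrite rmorphM mulrA; congr (_ * _ * _).
    by apply/eqP; rewrite eq_complex /= subr0 oppr0 !eqxx.
  by apply: eq_bigr => a _; rewrite !rmorphM /=; ring.
have := congr2 (fun a b => a - b) HF FH; rewrite subrr opprD addrACA subrr add0r.
by rewrite -sumrB => eq; rewrite -[RHS]eq; apply: eq_bigr => a _; ring.
Qed.

(** Only [e] and its reverse remain in [twisted_wronskian]. As conjugates of unit numbers are
    inverses, the factor X e - X' e can be divided out. *)
Lemma twisted_one X X' F H e :
  (forall a, X (arev G a) = (X a)^*) -> (forall a, X' (arev G a) = (X' a)^*) ->
  sqmod (X e) = 1 -> sqmod (X' e) = 1 -> X e != X' e ->
  twisted X F -> twisted X' H ->
  (forall a, a != e -> a != arev G e -> X a = X' a \/ (H (org G a))^* * F (tgt G a) = 0) ->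
  awt G e * X e * ((H (org G e))^* * F (tgt G e)) =
  (awt G e * X' e * H (tgt G e))^* * F (org G e).
Proof.
move=> XJ X'J u u' uu' tF tH off.
have := twisted_wronskian X'J tF tH.
rewrite (bigD1 e) //= (bigD1 (arev G e)) /= ?arev_neq // big1 => [|a /andP[a1 a2]]; last first.
  by case: (off a a1 a2) => [->|->]; rewrite ?subrr ?mul0r // !mulr0.
rewrite addr0 org_arev tgt_arev XJ X'J awt_arev !rmorphM /=.
rewrite (unit_conj u) (unit_conj u').
have w0 := unit_neq0 u; have w0' := unit_neq0 u'.
have d0 : X e - X' e != 0 by rewrite subr_eq0.
set P := (H (org G e))^* * _; set Q := (H (tgt G e))^* .
move=> eq; apply: (mulfI d0).
have -> : (X e - X' e) * (awt G e * X e * P) = X e * ((X e - X' e) * (awt G e * P)) by ring.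
rewrite (eqP (_ : (X e - X' e) * (awt G e * P) == - (((X e)^-1 - (X' e)^-1) * ((awt G e)^* * (Q * F (org G e)))))).
  by field; rewrite w0 w0'.
by rewrite -addr_eq0 eq.
Qed.

End TwistedEquation.

Section Ratios.
Variable R : realType.
Implicit Types a b c z : R[i].

Lemma real_ratio_aux a0 a1 a2 z0 z1 z2 : z0 != 0 -> z1 != 0 -> z2 != 0 ->
  a0 * z1^* = a1^* * z0 -> a0 * z2^* = a2^* * z0 -> a1 * z2^* = a2^* * z1 ->
  exists2 k, k^* = k & a0 = k * z0.
Proof.
move=> nz0 nz1 nz2 e1 e2 e3.
have conj_div a b z u : z != 0 -> u != 0 -> a * u^* = b^* * z -> a / z = (b / u)^* .
  move=> nz nu eq; have u0' : u^* != 0 by rewrite conjc_eq0.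
  apply: (mulIf nz); apply: (mulIf u0'); rewrite divfK // eq.
  by rewrite rmorphM /= conjc_inv [RHS]mulrAC divfK.
exists (a0 / z0); last by rewrite divfK.
rewrite [in LHS](conj_div a0 a1 z0 z1) // conjcK (conj_div a1 a2 z1 z2) //.
by rewrite -(conj_div a0 a2 z0 z2).
Qed.

Lemma ratio_aux a b z u v : a != 0 -> z != 0 ->
  a * (z * u) = b * v -> u = b / (a * z) * v.
Proof.
move=> a0 z0 eq; apply: (mulfI (mulf_neq0 a0 z0)); rewrite -[LHS]mulrA eq mulrA.
by rewrite [a * z * _]mulrC divfK // mulf_neq0.
Qed.

End Ratios.

Section FiniteKernel.
Variables (R : realType) (V E : finType) (G : wgraph R V E) (theta : R).
Local Notation C := R[i].
Local Notation ZE := (Algebra.to_multiplicative {ffun E -> int}).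
Local Notation M := (adj_shift G (@arc_vec _ _ _ G) theta).
Implicit Types (x y : E -> C) (f : V * ZE -> C).

Definition fker f := fin_supp f /\ forall z, op M f z = 0.

Definition hat f x : V -> C := fun v => fourier (fun h => f (v, h)) x.

(* The torus has one coordinate for each arc, and phase x a = x_a / x_(a^-1): *)
(* changing x at e changes the phases of e and of its reverse only.           *)
Definition phase x (a : E) : C := (chr x (@arc_vec _ _ _ G a))^-1.

Lemma phase_arev x a : circ x -> phase x (arev G a) = (phase x a)^*.
Proof.
move=> cx; rewrite /phase arc_vecV chrV // invrK unit_conj ?invrK //.
by rewrite sqmodV sqmod_chr // invr1.
Qed.

Lemma sqmod_phase x a : circ x -> sqmod (phase x a) = 1.
Proof. by move=> cx; rewrite /phase sqmodV sqmod_chr // invr1. Qed.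

Lemma phaseE x a : circ x -> phase x a = x a * (x (arev G a))^-1.
Proof.
move=> cx; rewrite /phase /chr (bigD1 a) //= (bigD1 (arev G a)) ?arev_neq //= big1 => [|b /andP[h1 h2]].
  rewrite !ffunE !eqxx eq_sym (negPf (arev_neq G a)) subr0 sub0r opprK mulr1.
  by rewrite invfM [x a ^ _](_ : _ = (x a)^-1) ?invrK // [x (arev G a) ^ _](_ : _ = x (arev G a)).
by rewrite !ffunE (negPf h1) (negPf h2) subrr oppr0 expr0z.
Qed.

(** Translation by the label of an arc becomes multiplication by its phase, so this is the sum over
    [h] of the kernel equations, weighted by [chr x h]. *)
Lemma hat_twisted f x : fker f -> circ x -> twisted G theta (phase x) (hat f x).
Proof.
move=> [fsf Mf] cx v; rewrite /hat /fourier.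
have fr w : fin_supp (fun h => f (w, h)) by apply: fin_supp_row.
have fc w : fin_supp (fun h => f (w, h) * chr x h).
  by apply: eq_fin_supp (fr w) => h ->; rewrite mul0r.
have shift a : phase x a * fin_sum (fun h => f (tgt G a, h) * chr x h) =
    fin_sum (fun h => f (tgt G a, (h * @arc_vec _ _ _ G a)%g) * chr x h).
  rewrite -fin_sumZ // (fin_sum_bij _ (mulg_bij (@arc_vec _ _ _ G a))).
  apply: eq_fin_sum => h; rewrite chrM // /phase.
  have := chr_neq0 (@arc_vec _ _ _ G a) cx => n0.
  by field; exact: n0.
under eq_bigr do rewrite -mulrA shift.
have fa a : fin_supp (fun h => awt G a * (f (tgt G a, (h * @arc_vec _ _ _ G a)%g) * chr x h)).
  have := fin_supp_inj (mulg_bij (@arc_vec _ _ _ G a)) (fr (tgt G a)).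
  by apply: eq_fin_supp => h ->; rewrite mul0r mulr0.
have fa' a : fin_supp (fun h => f (tgt G a, (h * @arc_vec _ _ _ G a)%g) * chr x h).
  have := fin_supp_inj (mulg_bij (@arc_vec _ _ _ G a)) (fr (tgt G a)).
  by apply: eq_fin_supp => h ->; rewrite mul0r.
under eq_bigr do rewrite -fin_sumZ //.
rewrite -fin_sumZ // -fin_sum_sum // -fin_sumD; first last.
- exact: fin_supp_sum.
- by apply: eq_fin_supp (fc v) => h ->; rewrite mulr0.
(* Every summand is 0, so the sum equals its summand at 1, which is 0 as well. *)
rewrite (@fin_sum_pt _ _ _ 1%g) => [|h _]; last first.
  have := Mf (v, h); rewrite adj_shiftE /= => Mh; rewrite -[RHS](mul0r (chr x h)) -[in RHS]Mh.
  by rewrite [in RHS]mulrDl -[in RHS]mulrA mulr_suml; congr (_ + _); apply: eq_bigr => a _; rewrite mulrA.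
have := Mf (v, 1%g); rewrite adj_shiftE /= => Mh; rewrite -[RHS](mul0r (chr x 1%g)) -[in RHS]Mh.
by rewrite [in RHS]mulrDl -[in RHS]mulrA mulr_suml; congr (_ + _); apply: eq_bigr => a _; rewrite mulrA.
Qed.

Lemma hat_upd f x e v : fker f -> circ x -> hat f x v != 0 ->
  exists l : seq C, forall s, sqmod s = 1 -> s \notin l -> hat f (upd x e s) v != 0.
Proof.
move=> [fsf _] cx; apply: fourier_upd => //.
exact: fin_supp_row.
Qed.

Definition fsupp : {set V} :=
  [set v | `[< exists2 f, fker f & exists h, f (v, h) != 0 >]].

Lemma hat_off f x v : fker f -> v \notin fsupp -> hat f x v = 0.
Proof.
move=> kf vD; rewrite /hat /fourier (@fin_sum_pt _ _ _ 1%g) => [|h _].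
all: rewrite (_ : f (v, _) = 0) ?mul0r //; apply/eqP; apply: contraNT vD => fv.
all: by rewrite inE; apply/asboolP; exists f => //; eexists; exact: fv.
Qed.

Local Opaque hat phase.

Lemma phase_upd_other x e s a : circ x -> sqmod s = 1 -> a != e -> a != arev G e ->
  phase (upd x e s) a = phase x a.
Proof.
move=> cx s1 ae ae'; rewrite !phaseE //; last exact: circ_upd.
rewrite /upd (negPf ae) (_ : arev G a == e = false) //.
by apply/negbTE; apply: contraNneq ae' => <-; rewrite arevK.
Qed.

Lemma phase_upd x e s : circ x -> sqmod s = 1 ->
  phase (upd x e s) e = s * (x e)^-1 * phase x e.
Proof.
move=> cx s1; rewrite !phaseE //; last exact: circ_upd.
rewrite /upd eqxx (negPf (arev_neq G e)) mulrA; congr (_ * _).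
by rewrite divfK ?unit_neq0.
Qed.

Lemma phase_upd_neq x e s : circ x -> sqmod s = 1 -> s != x e ->
  phase x e != phase (upd x e s) e.
Proof.
move=> cx s1; rewrite phase_upd //; apply: contraNneq => h.
have p0 := unit_neq0 (sqmod_phase e cx).
have : 1 = s * (x e)^-1 by apply: (mulIf p0); rewrite mul1r.
by move/(congr1 (fun z => z * x e)); rewrite mul1r divfK ?unit_neq0 // => ->.
Qed.

Lemma hat_ratio_conj f g x s e : fker f -> fker g -> circ x -> sqmod s = 1 -> s != x e ->
  awt G e * phase x e * ((hat g (upd x e s) (org G e))^* * hat f x (tgt G e)) =
  (awt G e * phase (upd x e s) e * hat g (upd x e s) (tgt G e))^* * hat f x (org G e).
Proof.
move=> kf kg cx s1 sx; have cx' := circ_upd e cx s1.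
apply: (@twisted_one _ _ _ _ theta (phase x) (phase (upd x e s))).
- by move=> a; apply: phase_arev.
- by move=> a; apply: phase_arev.
- exact: sqmod_phase.
- exact: sqmod_phase.
- exact: phase_upd_neq.
- exact: hat_twisted.
- exact: hat_twisted.
- by move=> a ae ae'; left; rewrite phase_upd_other.
Qed.

(* The ratio q_0 at x and the ratios q_1, q_2 at two changes of x at e        *)
(* satisfy q_0 = conj q_1, q_0 = conj q_2 and q_1 = conj q_2, so q_0 is real. *)
Lemma hat_ratio_real f x e : fker f -> circ x -> hat f x (org G e) != 0 ->
  exists2 k : C, k^* = k & awt G e * phase x e * hat f x (tgt G e) = k * hat f x (org G e).
Proof.
move=> kf cx nx.
have [l lP] := hat_upd e kf cx nx.
have [s s1] := circle_avoid (x e :: l); rewrite inE negb_or => /andP[sx sl].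
have [t t1] := circle_avoid (s :: x e :: l); rewrite !inE !negb_or => /and3P[ts tx tl].
have ns := lP s s1 sl; have nt := lP t t1 tl.
have cxs := circ_upd e cx s1.
have upd2 : upd (upd x e s) e t = upd x e t.
  by apply/funext => a; rewrite /upd; case: (a == e).
have txs : t != upd x e s e by rewrite /upd eqxx.
apply: (@real_ratio_aux _ _ (awt G e * phase (upd x e s) e * hat f (upd x e s) (tgt G e))
  (awt G e * phase (upd x e t) e * hat f (upd x e t) (tgt G e)) _ _ _ nx ns nt).
- by rewrite -(hat_ratio_conj kf kf cx s1 sx); ring.
- by rewrite -(hat_ratio_conj kf kf cx t1 tx); ring.
- by have := hat_ratio_conj kf kf cxs t1 txs; rewrite upd2 => <-; ring.
Qed.

Section Generic.
Variable fv : V -> V * ZE -> C.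
Hypothesis fv_ker : forall v, fker (fv v).
Local Notation D := fsupp.

Definition generic x := circ x /\ forall v, v \in D -> hat (fv v) x v != 0.

Lemma generic_upd x e : generic x ->
  exists l : seq C, forall s, sqmod s = 1 -> s \notin l -> generic (upd x e s).
Proof.
move=> [cx xP].
have [||l lP] := @common_upd R E V (enum D) (fun v h => fv v (v, h)) x e _ cx.
- by move=> v; have [fsv _] := fv_ker v; apply: fin_supp_row.
- by move=> v; rewrite mem_enum; apply: xP.
exists l => s s1 sl; split; first exact: circ_upd.
by move=> v vD; apply: lP => //; rewrite mem_enum.
Qed.

(* Transforms at the points y with the same phases as x within D satisfy the  *)
(* same twisted equations on G[D].                                            *)
Definition local_fields x (F : V -> C) := exists y f,
  [/\ circ y, forall a, a \in inner G D -> phase y a = phase x a, fker f & F = hat f y].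

(** As in [ker_ratio], with the fixed transform H taken at a change of [x] at [e], so that the
    twists differ there. Arcs not inside [D] drop out, since transforms vanish off [D]. *)
Lemma local_ratio x : generic x -> forall e, e \in inner G D ->
  exists2 q, q != 0 & forall F, local_fields x F -> F (tgt G e) = q * F (org G e).
Proof.
move=> [cx xP] e eD; have := eD; rewrite inE => /andP[oD tD].
have kt := fv_ker (tgt G e).
have [l lP] := hat_upd e kt cx (xP _ tD).
have [s s1] := circle_avoid (x e :: l); rewrite inE negb_or => /andP[sx sl].
pose x' := upd x e s; have cx' : circ x' by apply: circ_upd.
pose H := hat (fv (tgt G e)) x'; have Ht : H (tgt G e) != 0 by apply: lP.
have key F : local_fields x F -> awt G e * phase x e * ((H (org G e))^* * F (tgt G e)) =
    (awt G e * phase x' e * H (tgt G e))^* * F (org G e).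
  move=> [y [f [cy yx kf ->]]]; rewrite -(yx e eD).
  apply: (@twisted_one _ _ _ _ theta (phase y) (phase x')).
  - by move=> a; apply: phase_arev.
  - by move=> a; apply: phase_arev.
  - exact: sqmod_phase.
  - exact: sqmod_phase.
  - by rewrite yx //; apply: phase_upd_neq.
  - exact: hat_twisted.
  - exact: hat_twisted.
  move=> a ae ae'; have [aD|aD] := boolP (a \in inner G D).
    by left; rewrite yx // phase_upd_other.
  right; move: aD; rewrite inE negb_and => /orP[]h.
    by rewrite /H (hat_off _ kt h) conjc0 mul0r.
  by rewrite (hat_off _ kf h) mulr0.
have w0 := awt_neq0 G e; have p0 := unit_neq0 (sqmod_phase e cx).
have p'0 := unit_neq0 (sqmod_phase e cx').
have c0 : (awt G e * phase x' e * H (tgt G e))^* != 0.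
  by rewrite conjc_eq0 !mulf_neq0.
have Ho : (H (org G e))^* != 0.
  have lo : local_fields x (hat (fv (org G e)) x) by exists x, (fv (org G e)); split.
  apply/eqP => h; have := key _ lo; rewrite h mul0r mulr0 => /esym/eqP.
  by rewrite mulf_eq0 (negPf c0) (negPf (xP _ oD)).
exists ((awt G e * phase x' e * H (tgt G e))^* / (awt G e * phase x e * (H (org G e))^*)).
  by apply: mulf_neq0; rewrite // invr_eq0; apply: mulf_neq0 => //; apply: mulf_neq0.
move=> F lF; apply: ratio_aux => //; first exact: mulf_neq0.
exact: key.
Qed.

(** The product of the real ratios of [hat_ratio_real]; [local_ratio] ensures that the transform
    stays nonzero along the walk. *)
Lemma generic_walk x e p : generic x ->
  path.path [rel e e' | tgt G e == org G e'] e p ->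
  all (fun a => a \in inner G D) (e :: p) ->
  forall f, fker f -> hat f x (org G e) != 0 ->
  exists2 k : C, k^* = k &
    \prod_(a <- e :: p) (awt G a * phase x a) * hat f x (tgt G (last e p)) =
    k * hat f x (org G e).
Proof.
move=> gx; elim: p e => [|e' p IH] e /= pp /andP[eD pD] f kf fe.
  have [k kr kE] := hat_ratio_real kf gx.1 fe.
  by exists k; rewrite // big_seq1.
case/andP: pp => /eqP te pp.
have [k kr kE] := hat_ratio_real kf gx.1 fe.
have [q q0 qF] := local_ratio gx eD.
have lf : local_fields x (hat f x) by exists x, f; split=> //; case: gx.
have fe' : hat f x (org G e') != 0 by rewrite -te qF // mulf_neq0.
have [k' kr' kE'] := IH e' pp pD f kf fe'.
exists (k' * k); first by rewrite rmorphM /= kr kr'.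
by rewrite big_cons -mulrA kE' -te mulrCA kE mulrA.
Qed.

(* Around a cycle the product of the twisted weights would be real for every  *)
(* generic x, but changing x at one of its arcs rotates it.                   *)
Lemma fsupp_acyclic x : generic x -> acyclic G (inner G D).
Proof.
move=> gx [//|e p] cp; apply/negP => pD.
have /and3P[_ up /=] := cp; rewrite rcons_path => /andP[pp0 /andP[/eqP le _]].
have pp : path.path [rel e e' | tgt G e == org G e'] e p.
  by apply: (sub_path _ pp0) => a b /andP[].
have oD : org G e \in D by move: pD => /= /andP[]; rewrite inE => /andP[].
pose P y := \prod_(a <- e :: p) (awt G a * phase y a).
have Preal y : generic y -> (P y)^* = P y.
  move=> gy; have fe := gy.2 _ oD.
  have [k kr] := generic_walk gy pp pD (fv_ker _) fe.
  by rewrite le => /(mulIf fe) kE; rewrite /P kE.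
have [l lP] := generic_upd e gx.
(* Reality before and after the change forces s^2 = (x e)^2, hence both signs are avoided. *)
have [s s1] := circle_avoid (x e :: - x e :: l).
rewrite !inE !negb_or => /and3P[sx sx' sl].
have gs := lP s s1 sl; have cx := gx.1.
have x0 : x e != 0 by apply: unit_neq0.
have PE : P (upd x e s) = s / x e * P x.
  rewrite /P !big_cons phase_upd // [RHS]mulrCA [in RHS]mulrA -![RHS]mulrA [RHS]mulrCA.
  have -> : \prod_(a <- p) (awt G a * phase (upd x e s) a) = \prod_(a <- p) (awt G a * phase x a).
    rewrite !big_seq; apply: eq_bigr => a ap; rewrite phase_upd_other //.
      by have := map_uniq up => /= /andP[ep _]; apply: contraNneq ep => <-.
    have := cycle_arev cp (mem_head e p); rewrite inE negb_or => /andP[_].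
    by apply: contraNneq => <-.
  by ring.
have P0 : P x != 0.
  rewrite /P; elim: (e :: p) => [|a q IH]; first by rewrite big_nil oner_neq0.
  by rewrite big_cons !mulf_neq0 ?awt_neq0 ?(unit_neq0 (sqmod_phase a cx)).
have := Preal _ gs; rewrite PE rmorphM /= (Preal _ gx) => /(mulIf P0).
rewrite rmorphM /= conjc_inv !unit_conj // invrK => eq.
have : (s - x e) * (s + x e) == 0.
  rewrite -subr_sqr subr_eq0; apply/eqP.
  have s0 := unit_neq0 s1.
  have := congr1 (fun z => z * (s * x e)) eq.
  rewrite [_ / _ * _](_ : _ = s ^+ 2); last by field.
  by move=> <-; field.
by rewrite mulf_eq0 subr_eq0 addr_eq0 (negPf sx) (negPf sx').
Qed.

End Generic.

End FiniteKernel.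

Lemma fin_supp_fin (X : finType) (A : nmodType) (F : X -> A) : fin_supp F.
Proof. by exists (enum X) => x; rewrite mem_enum. Qed.

Lemma l2_fin (R : realType) (X : finType) (f : X -> R[i]) : l2 f.
Proof.
exists (fin_sum (fun x => sqmod (f x))) => r ur.
by apply: sum_le_fin_sum => // [|x]; [exact: fin_supp_fin | exact: sqmod_ge0].
Qed.

Section FiniteCertificate.
Variables (R : realType) (V E : finType) (G : wgraph R V E) (theta : R).
Local Notation C := R[i].
Local Notation ZE := (Algebra.to_multiplicative {ffun E -> int}).
Local Notation M := (adj_shift G (@arc_vec _ _ _ G) theta).
Local Notation D := (fsupp G theta).
Local Opaque hat phase.

Lemma fker0 : fker G theta (fun=> 0).
Proof.
split; first by exists [::].
by move=> z; rewrite /op big1 // => k _; rewrite mulr0.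
Qed.

Lemma fsuppP v : exists f, fker G theta f /\ (v \in D -> exists h, f (v, h) != 0).
Proof.
have [|vD] := boolP (v \in D).
  by rewrite inE => /asboolP[f kf fv]; exists f.
by exists (fun=> 0); split; first exact: fker0.
Qed.

Lemma local_eq x (y : E -> C) f v : circ y ->
  (forall a, a \in inner G D -> phase G y a = phase G x a) -> fker G theta f -> v \in D ->
  ((vwt G v)%:C - theta%:C) * hat f y v +
    \sum_(a | (org G a == v) && (tgt G a \in D)) awt G a * phase G x a * hat f y (tgt G a) = 0.
Proof.
move=> cy yx kf vD; have tw := hat_twisted kf cy v.
rewrite -[RHS]tw; congr (_ + _); rewrite big_mkcondr; apply: eq_bigr => a /eqP av.
case: ifP => [tD|/negbT tD]; first by rewrite yx // inE av vD.
by rewrite (hat_off _ kf tD) mulr0.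
Qed.

Lemma boundary_eq (y : E -> C) f v : circ y -> fker G theta f -> v \notin D ->
  \sum_(a | (org G a == v) && (tgt G a \in D)) awt G a * phase G y a * hat f y (tgt G a) = 0.
Proof.
move=> cy kf vD; have tw := hat_twisted kf cy v.
rewrite -[RHS]tw (hat_off _ kf vD) mulr0 add0r big_mkcondr; apply: eq_bigr => a _.
case: ifP => // /negbT tD.
by rewrite (hat_off _ kf tD) mulr0.
Qed.

(** As in [kernel_certificate], at a generic point [x] of the torus. The adjoint is injective
    because changing [x] at a cut arc yields a vector that the boundary operator maps to a nonzero
    multiple of a point mass. *)
Theorem finite_kernel_certificate :
  (exists f : V * ZE -> C, [/\ fin_supp f, exists x, f x != 0 & forall x, op M f x = 0]) ->
  certificate G theta.
Proof.
move=> [f0 [fsf0 [[v0 g0] f00] Mf0]].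
have kf0 : fker G theta f0 by split.
have v0D : v0 \in D by rewrite inE; apply/asboolP; exists f0 => //; exists g0.
have [fv fvP] := choice fsuppP.
have fvk v : fker G theta (fv v) by case: (fvP v).
have [||x cx xP] := @common_point R E V (enum D) (fun v h => fv v (v, h)).
- by move=> v; have [fsv _] := fvk v; apply: fin_supp_row.
- by move=> v; rewrite mem_enum => vD; case: (fvP v) => _; apply.
have gx : generic G theta fv x.
  by split=> // v vD; apply: xP; rewrite mem_enum.
have self v : local_fields G theta x (hat (fv v) x) by exists x, (fv v).
have U_nz v : v \in D -> exists2 F, local_fields G theta x F & F v != 0.
  by move=> vD; exists (hat (fv v) x) => //; case: gx => _; apply.
have [phi [phi0 phiU phiE]] := rigid U_nz (local_ratio fvk gx).
have aD := fsupp_acyclic fvk gx.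
have [tau tauP _] := potential (@arc_vecV _ _ _ G) (@inner_arev _ _ _ G D) aD.
(* On the forest G[D] the phases are ratios of [sigma], which turns the twisted equation into the
   untwisted one. *)
pose sigma v := (chr x (tau v))^-1.
have sigma0 v : sigma v != 0 by rewrite invr_eq0; apply: chr_neq0.
have sigmaP e : e \in inner G D -> sigma (tgt G e) = sigma (org G e) * phase G x e.
  by move=> eD; rewrite /sigma tauP // chrM // invfM.
exists D, (fun v => phi v * sigma v); split=> //.
- by move=> v vD; rewrite mulf_neq0 // phi0.
- move=> v vD; have [F [y [f [cy yx kf ->]]] phiF] := phiE v vD.
  rewrite -[RHS](mulr0 (sigma v)) -[in RHS](local_eq cy yx kf vD) [in RHS]mulrDr.
  rewrite /= phiF //; congr (_ + _).
    by ring.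
  rewrite mulr_sumr; apply: eq_bigr => e /andP[/eqP ov tD].
  have eD : e \in inner G D by rewrite inE ov vD.
  by rewrite sigmaP // phiF -?(comp_root_inner eD) ?ov //; ring.
(* The trivial group: [boundary_op] is then a matrix, and [card_of_has_kernel] is linear algebra. *)
pose gT : groupType := 'I_1.
pose T0 := boundary_op G D (fun e => awt G e * phase G x e * phi (tgt G e)) (fun=> 1%g : gT).
pose cf (F : V -> C) : {v | v \in comp_roots G D} * gT -> C :=
  fun x => (phi (val x.1))^-1 * F (val x.1).
have cfE F v g : local_fields G theta x F -> v \in D ->
    phi v * ext (cf F) (comp_root G D v, g) = F v.
  move=> lF vD; rewrite -[comp_root G D v]/(val (exist (fun v => is_true (v \in comp_roots G D)) _ (comp_root_mem G vD))).
  rewrite extE /cf /=; have r0 : phi (comp_root G D v) != 0 by apply: phi0; rewrite comp_root_in.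
  by apply: (mulfI r0); rewrite mulrCA mulVKf // mulrC -phiU // mulrC.
have Tcf F j g : local_fields G theta x F -> op T0 (cf F) (j, g) =
    \sum_(a | (org G a == val j) && (tgt G a \in D)) awt G a * phase G x a * F (tgt G a).
  move=> lF; rewrite boundary_opE; apply: eq_bigr => e /andP[_ tD].
  by rewrite -mulrA cfE.
have bdD (j : {v | v \in boundary G D}) : val j \notin D.
  by have /imsetP[e] := valP j; rewrite inE => /andP[eD _] ->.
rewrite -[#|boundary G D|]card_sig -[#|comp_roots G D|]card_sig.
apply: (card_of_has_kernel (T := T0)).
  exists (cf (hat (fv v0) x)); split; first exact: l2_fin.
    have F0 : hat (fv v0) x v0 != 0 by case: gx => _; apply.
    move: F0; rewrite -(cfE _ v0 1%g (self v0) v0D).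
    rewrite -[comp_root G D v0]/(val (exist (fun v => is_true (v \in comp_roots G D)) _ (comp_root_mem G v0D))).
    by rewrite extE mulf_eq0 negb_or => /andP[_ nz]; eexists; exact: nz.
  by move=> [j g]; rewrite Tcf //; apply: boundary_eq.
move=> [h [_ [[j g] hj] Th]].
have /imsetP[e0 e0b je0] := valP j.
have /andP[oD tD] : (org G e0 \notin D) && (tgt G e0 \in D) by rewrite inE in e0b.
have [l lP] := generic_upd fvk e0 gx.
have [s s1] := circle_avoid (x e0 :: l); rewrite inE negb_or => /andP[sx sl].
have gx' := lP s s1 sl; pose x' := upd x e0 s; have cx' : circ x' by case: gx'.
pose F := hat (fv (tgt G e0)) x'.
have Ft : F (tgt G e0) != 0 by case: gx' => _; apply.
have lF : local_fields G theta x F.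
  exists x', (fv (tgt G e0)); split=> // a; rewrite inE => /andP[ao at'].
  apply: phase_upd_other => //.
    by apply: contraNneq oD => <-.
  by apply: contraNneq oD => ae; rewrite -tgt_arev -ae.
pose kappa := awt G e0 * (phase G x e0 - phase G x' e0) * F (tgt G e0).
have kappa0 : kappa != 0.
  apply: mulf_neq0 => //; apply: mulf_neq0; first exact: awt_neq0.
  by rewrite subr_eq0; apply: phase_upd_neq.
(* [F] satisfies the boundary equations with the phases of [x']. Among cut arcs these differ from
   the phases of [x] only at [e0], so only its term remains. *)
have TF i k : op T0 (cf F) (i, k) = if i == j then kappa else 0.
  rewrite Tcf // -[LHS]subr0 -[X in _ - X](boundary_eq cx' (fvk (tgt G e0)) (bdD i)).
  rewrite -sumrB -/F.
  have off a : (org G a == val i) && (tgt G a \in D) -> a != e0 ->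
      awt G a * phase G x a * F (tgt G a) - awt G a * phase G x' a * F (tgt G a) = 0.
    move=> /andP[/eqP oa _] ae; rewrite (@phase_upd_other _ _ _ G x e0 s a) ?subrr //.
    apply: contraNneq (bdD i) => ae'; rewrite -oa ae' org_arev.
    by [].
  case: eqVneq => [ij|ij].
    rewrite (bigD1 e0) /=; last by rewrite ij je0 eqxx tD.
    by rewrite big1 ?addr0 => [|a /andP[a1 a2]]; [rewrite /kappa; ring | exact: off].
  rewrite big1 // => a aP; apply: off => //.
  apply: contraNneq ij => ae; apply/eqP/val_inj; rewrite je0.
  by case/andP: aP => /eqP <- _; rewrite ae.
have := adjoint T0 h (fin_supp_fin (cf F)).
rewrite /iprod (fin_sum_pt (x := (j, g))) => [|[i k] ne]; last first.
  rewrite TF; case: (eqVneq i j) => [ij|_]; last by rewrite mulr0.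
  by case/eqP: ne; rewrite ij (ord1 (k : 'I_1)) (ord1 (g : 'I_1)).
rewrite TF eqxx (@fin_sum_pt _ _ _ (exist (fun v => is_true (v \in comp_roots G D)) _ (comp_root_mem G v0D), 1%g)) => [|z _].
  by rewrite Th conjc0 mul0r => /eqP; rewrite mulf_eq0 conjc_eq0 (negPf hj) (negPf kappa0).
by rewrite Th conjc0 mul0r.
Qed.

End FiniteCertificate.

(** * Equality of the two point spectra *)

Lemma arc_letter (R : realType) (V E : finType) (G : wgraph R V E) (O : orientation G) e :
  exists a : {x | x \in O} * bool,
    fword (arc_elt O e) = [:: a] /\ val a.1 = if a.2 then arev G e else e.
Proof.
rewrite /arc_elt; case: insubP => [x _ xe|eO]; first by exists (x, false).
case: insubP => [x _ xe|]; first by exists (x, true).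
by rewrite orientationP eO.
Qed.

Theorem theorem7 (R : realType) (V E : finType) (G : wgraph R V E)
    (O : orientation G) (F : {set E}) (hF : maximal_spanning_forest G F)
    (theta : R) :
  l2_eigenvalue (universal_cover O F) theta%:C <->
  l2_eigenvalue (maximal_abelian_cover O F) theta%:C.
Proof.
split=> /cover_kernelP ker; apply/cover_kernelP; apply: certificate_kernel; try exact: cover_arcV.
  have /choice[a aP] := arc_letter O.
  apply: (kernel_certificate (s := arc_elt O) (ltr := a)).
  - by move=> e; case: (aP e).
  - apply: (can_inj (g := fun b => if b.2 then arev G (val b.1) else val b.1)) => e.
    by case: (a e) (aP e) => x [] [_ /= ->]; rewrite ?arevK.
  - exact: arc_elt_rev.
  - exact: uni_embed hF.1 ker.
exact/finite_kernel_certificate/finite_kernel/(ab_embed hF.1 ker).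
Qed.
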